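(* Assume the setting described in the context, including the conservativity condition: $\int_\Omega \mathbf F(v):L^*(v^{\#})\,dx=0$ for all smooth $v:\Omega\to\mathcal O$ with $\mathcal A v=0$. Let $v_0\in C(\Omega;\mathcal O)\cap\ker\mathcal A$ and let $v$, with Lagrange multiplier $\pi$, be a strong solution on $[0,T]$ of $\partial_t v=L(\mathbf F(v))$, $v(0)=v_0$, $\mathcal A v=0$, $v\in\operatorname{dom}\mathbf F$. Then for every $T_1\in(0,T)$ the weight can be selected so that the duality scheme is consistent on $[0,T_1]$. That is, there is $\gamma>0$ such that, working on $[0,T_1]$ with the weight $\mathfrak h(t)=\exp(-\gamma t)$ and $\mathfrak H(t)=\int_t^{T_1}\mathfrak h(s)\,ds$, the restriction of $v$ to $[0,T_1]\times\Omega$ is a strong solution on $[0,T_1]$, $$\mathfrak h\,I\,\mathcal L+2\,\mathfrak H\,L^*(v^{\#}\mathcal L)\ge0\quad\text{as symmetric-matrix-valued measures on }[0,T_1]\times\Omega,$$ and consequently $$\mathcal I(v_0,T_1)=\tilde{\mathcal J}(v_0,T_1)=\tilde{\mathcal I}(v_0,T_1)=\mathcal J(v_0,T_1)=\mathfrak H(0)K_0,$$ and the pair $B_+=\mathfrak H L^*(v^{\#}\mathcal L)$, $E_+=\partial_t(\mathfrak H v^{\#}\mathcal L)-\mathfrak H\mathcal A^*\pi$ (measures on $[0,T_1]\times\Omega$) is a maximizer of $\sup\{-\langle v_0,E\rangle+\mathcal K(E,B)\}$ over pairs of finite Radon measures on $[0,T_1]\times\Omega$ satisfying (LC) and $\mathfrak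 h I\mathcal L+2B\ge0$.
   Context: Throughout, objects defined below on $[0,T]$ (with a weight on $[0,T]$) are defined in the same way on $[0,T_1]$, with $T$ replaced by $T_1$ and a weight on $[0,T_1]$. Notation. $\Omega=\mathbb T^d$ is the periodic box with Lebesgue measure $dx$; $T>0$; $\mathcal L=dx\,dt$ is Lebesgue measure on $[0,T]\times\Omega$. $\mathbb R^{N\times N}_s$ and $\mathbb R^{N\times N}_+$ are the symmetric and the positive semidefinite matrices; $A\ge B$ means $A-B\in\mathbb R^{N\times N}_+$; $A:B$ is the Frobenius scalar product; $I$ is the identity matrix. $\mathcal M(Q;V)$ denotes finite $V$-valued Radon measures on $Q$; a symmetric-matrix-valued measure is $\ge0$ if its values are positive semidefinite. $X=C(\Omega)$, and $X^{N\times N}_s=C(\Omega;\mathbb R^{N\times N}_s)$. $\langle f,\mu\rangle=\int_{[0,T]\times\Omega}f\cdot d\mu$ for continuous $f$ and a finite Radon measure $\mu$ (with values in the same Euclidean space). A function of $x$ only is also regarded as a time-independent function of $(t,x)$. Setting. $n,N\in\mathbb N$, $Z\in\mathbb Z_{\ge0}$. $\mathbf F:\operatorname{dom}\mathbf F\subset\mathbb R^n\to\mathbb R^{N\times N}_+$ is Löwner-convex (i.e. $y\mapsto\mathbf F(y):P$ is convex for each $P\ge0$), $\operatorname{dom}\mathbf F$ is convex with non-empty interior $\mathcal O$, and $\mathbf F$ is $C^1$ in $\mathcal O$; $\partial_l\mathbf F$ is the partial derivative in the $l$-th variable. $L:D(L)\subset X^{N\times N}_s\to X^n$ is a closed densely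 defined linear operator, and $\mathcal A:D(\mathcal A)\subset X^n\to X^Z$ is a closed densely defined linear operator with closed range. $L,\mathcal A$ and their adjoints $L^*,\mathcal A^*$ are differential or integral operators in the spatial variable on their natural domains (so they also act on time-dependent functions). The entropy is $\mathbf K(v)=\frac12\operatorname{Tr}\mathbf F(v)$ for $v\in\operatorname{dom}\mathbf F$ and $\mathbf K(v)=+\infty$ otherwise; it is assumed strictly convex in $\mathcal O$ and lower semicontinuous on $\mathbb R^n$. For $v\in\mathcal O$ put $v^{\#}=\nabla\mathbf K(v)$; for $v$ with values in $\mathcal O$, $v^{\#}$ is defined pointwise. $K_0=\int_\Omega\mathbf K(v_0)\,dx$. Weight. A weight on $[0,T]$ is a smooth function $\mathfrak h:[0,T]\to\mathbb R_+$ bounded away from $0$ and $\infty$; $\mathfrak H(t)=\int_t^T\mathfrak h(s)\,ds$. The notion of strong solution below does not depend on the choice of the weight. Linear constraint (LC) on $(E,B)\in\mathcal M([0,T]\times\Omega;\mathbb R^n)\times\mathcal M([0,T]\times\Omega;\mathbb R^{N\times N}_s)$: $\langle\partial_t\Psi,B\rangle+\langle L\Psi,E\rangle=0$ for all smooth $\Psi:[0,T]\times\Omega\to\mathbb R^{N\times N}_s$ with $\mathcal A L\Psi=0$ and $\Psi(0)=0$. Weak solution. $v\in C([0,T]\times\Omega;\mathbb R^n)$ with values in $\operatorname{dom}\mathbf F$, with $\mathbf F(v)\in C([0,T]\times\Omega;\mathbb R^{N\times N}_+)$, such that $\langle v-v_0,E\rangle+\langle\mathbf F(v),B\rangle=0$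 for all pairs of measures $(E,B)$ satisfying (LC). Strong solution (for $v_0\in C(\Omega;\mathcal O)\cap\ker\mathcal A$). A weak solution $v\in C([0,T]\times\Omega;\mathcal O)$ such that: (i) there exist finite measures, denoted $\partial_t(\mathfrak H v^{\#}\mathcal L)\in\mathcal M([0,T]\times\Omega;\mathbb R^n)$ and $\mathfrak H L^*(v^{\#}\mathcal L)\in\mathcal M([0,T]\times\Omega;\mathbb R^{N\times N}_s)$, with $\langle\phi,\partial_t(\mathfrak H v^{\#}\mathcal L)\rangle=-\langle\partial_t\phi,\mathfrak H v^{\#}\mathcal L\rangle$ and $\langle\Phi,\mathfrak H L^*(v^{\#}\mathcal L)\rangle=\langle L\Phi,\mathfrak H v^{\#}\mathcal L\rangle$ for all smooth $\phi,\Phi$ on $[0,T]\times\Omega$ (with values in $\mathbb R^n$, $\mathbb R^{N\times N}_s$) with $\phi(0)=0$; (ii) $cI\mathcal L+\mathfrak H L^*(v^{\#}\mathcal L)\ge0$ for some constant $c\ge0$; (iii) $\int_\Omega\mathbf K(v(t,x))\,dx=K_0$ for all $t\in[0,T]$; (iv) there is $\pi$ with $\mathfrak H\pi\in\mathcal M([0,T]\times\Omega;\mathbb R^Z)$ and $\mathfrak H\mathcal A^*\pi\in\mathcal M([0,T]\times\Omega;\mathbb R^n)$ (where $\langle\phi,\mathfrak H\mathcal A^*\pi\rangle=\langle\mathcal A\phi,\mathfrak H\pi\rangle$ for smooth $\phi$) such that for $l=1,\dots,n$, as finite Radon measures, $\mathfrak h(v^{\#}\mathcal L)_l+\partial_t(\mathfrak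 H v^{\#}\mathcal L)_l+\mathfrak H L^*(v^{\#}\mathcal L):\partial_l\mathbf F(v)=(\mathfrak H\mathcal A^*\pi)_l$. Primal and dual problems. With $(E,B)$ ranging over pairs of measures satisfying (LC): $\mathcal I(v_0,T)=\inf_v\sup_{E,B}[\langle v-v_0,E\rangle+\frac12\langle\mathbf F(v),\mathfrak h I\mathcal L+2B\rangle]$ and $\mathcal J(v_0,T)=\sup_{E,B}\inf_v[\text{same}]$, where $v\in C([0,T]\times\Omega;\mathbb R^n)$ takes values in $\operatorname{dom}\mathbf F$ and $\mathbf F(v)$ is continuous; $\tilde{\mathcal I}(v_0,T)=\inf_{v,M}\sup_{E,B}[\langle v-v_0,E\rangle+\frac12\langle M,\mathfrak h I\mathcal L+2B\rangle]$ and $\tilde{\mathcal J}(v_0,T)=\sup_{E,B}\inf_{v,M}[\text{same}]$, where $(v,M)\in C([0,T]\times\Omega;\mathbb R^n)\times C([0,T]\times\Omega;\mathbb R^{N\times N}_s)$ satisfy $\mathbf F(v)\le M$ pointwise (in particular $v\in\operatorname{dom}\mathbf F$). $\mathcal K(E,B)=\inf_{\mathbf F(z)\le M}\langle z,E\rangle+\frac12\langle M,\mathfrak h I\mathcal L+2B\rangle$ over the same class of pairs $(z,M)$, with value $-\infty$ allowed. The problem $\tilde{\mathcal J}$ is equivalently $\sup\{-\langle v_0,E\rangle+\mathcal K(E,B)\}$ over $(E,B)$ satisfying (LC) and $\mathfrak h I\mathcal L+2B\ge0$. *)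

(* Defs.v *)
From HB Require Import structures.
From mathcomp Require Import all_boot all_order all_algebra.
From mathcomp Require Import all_classical all_reals all_analysis.

Set Implicit Arguments.
Unset Strict Implicit.
Unset Printing Implicit Defensive.

Import Order.TTheory GRing.Theory Num.Theory.
Import numFieldNormedType.Exports.

Local Open Scope classical_set_scope.
Local Open Scope ring_scope.

(* The torus T^d is represented by 'rV[R]_d: functions on T^d are functions on
   'rV[R]_d with period 1 in each coordinate, and Borel measures on T^d are
   measures on 'rV[R]_d that live on the fundamental domain [0,1)^d. *)

(* The sigma-algebra generated by the coordinates is the Borel sigma-algebra
   of 'rV[R]_d. *)
Definition rV_display : measure_display -> measure_display.
Proof. exact. Qed.

Section measurable_rV.
Context {dd : measure_display} {S : sigmaRingType dd} (n : nat).

Let coord : 'I_n -> 'rV[S]_n -> S := fun i x => x ord0 i.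

Let rV_set0 : g_sigma_preimage coord set0.
Proof. exact: sigma_algebra0. Qed.

Let rV_setC A : g_sigma_preimage coord A -> g_sigma_preimage coord (~` A).
Proof. exact: sigma_algebraC. Qed.

Let rV_bigcup (F : (set 'rV[S]_n)^nat) : (forall i, g_sigma_preimage coord (F i)) ->
  g_sigma_preimage coord (\bigcup_i (F i)).
Proof. exact: sigma_algebra_bigcup. Qed.

HB.instance Definition _ := @isMeasurable.Build (rV_display dd)
  'rV[S]_n (g_sigma_preimage coord) rV_set0 rV_setC rV_bigcup.

End measurable_rV.

Section lebesgue_torus.
Context {R : realType}.
Implicit Type n : nat.

Definition rV_cons n (p : R * 'rV[R]_n) : 'rV[R]_n.+1 :=
  \row_i if unlift ord0 i is Some j then p.2 ord0 j else p.1.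

Lemma measurable_rV_cons n : measurable_fun setT (@rV_cons n).
Proof.
move=> _; apply: (@measurability _ _ _ _ setT (@rV_cons n) _ erefl) => //.
move=> _ [B + <-].
rewrite -bigcup_seq/= => -[i _ [C mC <-]]; rewrite !setTI.
case: (unliftP ord0 i) => [j|] ->.
- rewrite [X in measurable X](_ : _ = setT `*` ((fun x : 'rV[R]_n => x ord0 j) @^-1` C)).
    apply: measurableX => //; apply: sub_sigma_algebra.
    rewrite -bigcup_seq/=. exists j => /=; first by rewrite mem_index_enum.
    by exists C => //; rewrite setTI.
  by apply/seteqP; split => [[a x]/=|[a x] [_]/=]; rewrite mxE liftK.
- rewrite [X in measurable X](_ : _ = C `*` setT); first exact: measurableX.
  by apply/seteqP; split => [[a x]/=|[a x] []/=]; rewrite mxE unlift_none.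
Qed.

(* The library's Lebesgue measure, defined on measurableTypeR R, carried over to
   the measurable type R, whose measurable sets are the same. *)
Definition lebesgueR : set R -> \bar R := @lebesgue_measure R.

Let lebesgueR0 : lebesgueR set0 = 0%E.
Proof. exact: (measure0 (@lebesgue_measure R)). Qed.

Let lebesgueR_ge0 A : (0 <= lebesgueR A)%E.
Proof. exact: (measure_ge0 (@lebesgue_measure R)). Qed.

Let lebesgueR_sigma_additive : semi_sigma_additive lebesgueR.
Proof. exact: (@measure_semi_sigma_additive _ _ _ (@lebesgue_measure R)). Qed.

HB.instance Definition _ := isMeasure.Build _ _ _ lebesgueR
  lebesgueR0 lebesgueR_ge0 lebesgueR_sigma_additive.

Let lebesgueR_sigma_finite : sigma_finite setT lebesgueR.
Proof.
by have [F ? ?] := sigma_finiteT (@lebesgue_measure R); exists F.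
Qed.

HB.instance Definition _ := @Measure_isSigmaFinite.Build _ _ _
  lebesgueR lebesgueR_sigma_finite.

Definition lebesgue01 := mrestr lebesgueR
  (measurable_itv `[0, 1[ : measurable (`[0, 1[%classic : set R)).

HB.instance Definition _ := Measure.on lebesgue01.

Let lebesgue01_fin : fin_num_fun lebesgue01.
Proof.
apply: lty_fin_num_fun.
rewrite [X in (X < _)%E](_ : _ = lebesgueR (`[0, 1[%classic : set R)).
  by rewrite [lebesgueR _]lebesgue_measure_itv/= lte01 sube0 ltry.
by rewrite /= /lebesgue01 /mrestr setTI.
Qed.

HB.instance Definition _ :=
  @Measure_isFinite.Build _ _ _ lebesgue01 lebesgue01_fin.

Section step.
Context n (mu : {finite_measure set 'rV[R]_n -> \bar R}).

Definition torus_step : set 'rV[R]_n.+1 -> \bar R :=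
  pushforward (lebesgue01 \x mu)%E (@rV_cons n).

Let mpre A : measurable A -> measurable (@rV_cons n @^-1` A).
Proof. by rewrite -[X in _ -> measurable X]setTI; exact: measurable_rV_cons. Qed.

Let step0 : torus_step set0 = 0%E.
Proof. by rewrite /torus_step /pushforward preimage_set0 measure0. Qed.

Let step_ge0 A : (0 <= torus_step A)%E.
Proof. exact: integral_ge0. Qed.

Let step_sigma_additive : semi_sigma_additive torus_step.
Proof.
move=> F mF tF mUF; rewrite /torus_step /pushforward preimage_bigcup.
apply: measure_semi_sigma_additive; first by move=> i; exact: mpre.
- apply/trivIsetP => i j _ _ ij; rewrite -preimage_setI.
  by move/trivIsetP : tF => ->//; rewrite preimage_set0.
- by rewrite -preimage_bigcup; exact: mpre.
Qed.

HB.instance Definition _ := isMeasure.Build _ _ _ torus_step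
  step0 step_ge0 step_sigma_additive.

Let step_fin : fin_num_fun torus_step.
Proof.
apply: lty_fin_num_fun.
rewrite [X in (X < _)%E](_ : _ = (lebesgue01 \x mu)%E (setT `*` setT)).
  rewrite product_measure1E// lte_mul_pinfty//; first exact: fin_num_measure.
  by rewrite -ge0_fin_numE//; exact: fin_num_measure.
by rewrite setXTT.
Qed.

HB.instance Definition _ :=
  @Measure_isFinite.Build _ _ _ torus_step step_fin.

End step.

(* Lebesgue measure on T^d, i.e. on [0,1)^d. *)
Fixpoint torus_measure n : {finite_measure set 'rV[R]_n -> \bar R} :=
  if n is n'.+1 then torus_step (torus_measure n')
  else dirac (0 : 'rV[R]_0).

End lebesgue_torus.

Section matrices.
Context {R : realType}.

Definition frob m k (A B : 'M[R]_(m, k)) : R := \sum_i \sum_j A i j * B i j.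

Definition psd N (A : 'M[R]_N) :=
  A^T = A /\ forall u : 'rV[R]_N, 0 <= (u *m A *m u^T) ord0 ord0.

End matrices.

Section smooth.
Context {R : realType} {W V : normedModType R}.

Fixpoint iter_derive (s : seq W) (f : W -> V) : W -> V :=
  if s is w :: s' then fun p => 'D_w (iter_derive s' f) p else f.

(* Class C^infinity.  A function on [0,T] or [0,T] x Omega is smooth when it is
   the restriction of a smooth function on R or R x Omega. *)
Definition smooth (f : W -> V) := forall s,
  continuous (iter_derive s f) /\
  forall p w, derivable (iter_derive s f) p w.

End smooth.

Section charges.
Context {R : realType} {dd : measure_display} {S : measurableType dd}.

(* Integral against a finite signed measure, through its Jordan decomposition. *)
Definition charge_int (nu : {charge set S -> \bar R}) (D : set S)
    (f : S -> R) : R :=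
  let P := cid (Hahn_decomposition nu) in
  let N := cid (projT2 P) in
  Rintegral (jordan_pos (projT2 N)) D f - Rintegral (jordan_neg (projT2 N)) D f.

(* Finite signed Borel measures with values in 'M[R]_(m, k), entry by entry; on
   the (compact metrizable) sets used below they are automatically Radon. *)
Definition mx_charge m k := 'M[{charge set S -> \bar R}]_(m, k).

Definition mass m k (mu : mx_charge m k) (A : set S) : 'M[R]_(m, k) :=
  \matrix_(i, j) fine (mu i j A).

(* A measure on D is identified with its extension by zero. *)
Definition measures_on (D : set S) m k : set (mx_charge m k) :=
  [set mu : mx_charge m k |
    forall i j A, measurable A -> mu i j A = mu i j (A `&` D)].

Definition sym_measures_on (D : set S) N : set (mx_charge N N) :=
  [set mu : mx_charge N N | measures_on D mu /\
    forall i j A, measurable A -> mu i j A = mu j i A].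

(* <f, mu> over the set D. *)
Definition pairing (D : set S) m k (f : S -> 'M[R]_(m, k))
    (mu : mx_charge m k) : R :=
  \sum_i \sum_j charge_int (mu i j) D (fun p => f p i j).

(* Nonnegativity on D of a symmetric-matrix-valued measure. *)
Definition measure_ge0_on (D : set S) N (nu : set S -> 'M[R]_N) :=
  forall A, measurable A -> A `<=` D -> psd (nu A).

End charges.
Arguments mx_charge {R dd} S m k.

Section torus.
Context {R : realType} {d : nat}.
Local Notation space := 'rV[R]_d.
Local Notation spacetime := (R * 'rV[R]_d)%type.
Implicit Types (T : R) (h : R -> R).

Definition periodic V (f : space -> V) :=
  forall x (i : 'I_d), f (x + delta_mx ord0 i) = f x.

Definition unit_cube : set space := [set x | forall i, 0 <= x ord0 i < 1].

Definition CX m k : set (space -> 'M[R]_(m, k)) :=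
  [set f | continuous f /\ periodic f].

Definition CX_sym N : set (space -> 'M[R]_N) :=
  [set f | CX f /\ forall x, (f x)^T = f x].

Definition strip T : set spacetime := [set p | 0 <= p.1 <= T].
Definition cylinder T : set spacetime := `[0, T]%classic `*` unit_cube.

(* C([0,T] x Omega). *)
Definition CTX T m k : set (spacetime -> 'M[R]_(m, k)) :=
  [set f | {within strip T, continuous f} /\
    forall t, 0 <= t <= T -> periodic (fun x => f (t, x))].

(* dx dt *)
Definition Leb : set spacetime -> \bar R := (lebesgueR \x torus_measure d)%E.
HB.instance Definition _ := Measure.on Leb.

Definition slice V (Psi : spacetime -> V) (t : R) : space -> V :=
  fun x => Psi (t, x).

(* Smooth functions of (t,x) all of whose slices lie in X. *)
Definition smooth_in m k (X : set (space -> 'M[R]_(m, k))) :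
    set (spacetime -> 'M[R]_(m, k)) :=
  [set Psi | smooth Psi /\ forall t, X (slice Psi t)].

Definition dt m k (Psi : spacetime -> 'M[R]_(m, k)) : spacetime -> 'M[R]_(m, k) :=
  fun p => 'D_((1, 0) : spacetime) Psi p.

Record operator m k m' k' := Operator {
  dom : set (space -> 'M[R]_(m, k)) ;
  app :> (space -> 'M[R]_(m, k)) -> (space -> 'M[R]_(m', k')) }.

Section operators.
Context {m k m' k' : nat}.
Variables (X : set (space -> 'M[R]_(m, k))) (Y : set (space -> 'M[R]_(m', k'))).
Variable G : operator m k m' k'.

Definition linear_operator :=
  [/\ dom G `<=` X, (forall f, dom G f -> Y (G f)) &
    forall (a : R) f g, dom G f -> dom G g ->
      dom G (fun x => a *: f x + g x) /\
      G (fun x => a *: f x + g x) = (fun x => a *: G f x + G g x)].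

Definition densely_defined := forall f (e : R), X f -> 0 < e ->
  exists2 g, dom G g & forall x, `|f x - g x| < e.

Definition closed_operator := forall (f_ : nat -> space -> 'M[R]_(m, k)) f g,
  X f -> Y g -> (forall i, dom G (f_ i)) ->
  {uniform, f_ @ \oo --> f} -> {uniform, (fun i => G (f_ i)) @ \oo --> g} ->
  dom G f /\ G f = g.

Definition closed_range := forall (f_ : nat -> space -> 'M[R]_(m, k)) g,
  Y g -> (forall i, dom G (f_ i)) ->
  {uniform, (fun i => G (f_ i)) @ \oo --> g} ->
  exists2 f, dom G f & G f = g.

Definition ker : set (space -> 'M[R]_(m, k)) :=
  [set f | dom G f /\ G f = cst 0].

Definition slicewise (Psi : spacetime -> 'M[R]_(m, k)) :
    spacetime -> 'M[R]_(m', k') :=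
  fun p => G (slice Psi p.1) p.2.

(* What is retained of "G and its adjoint are differential or integral operators
   in the spatial variable on their natural domains": both are defined on smooth
   functions, act on smooth functions of (t,x) slice by slice, and yield smooth
   functions of (t,x).  The adjoint acts on a function w through the measure
   w dx, by duality with dom G.  No explicit form (order, coefficients, kernel)
   is prescribed, so that singular integral operators and Fourier multipliers are
   covered as well. *)
Definition spatial_operator :=
  (forall Psi, smooth_in X Psi ->
    (forall t, dom G (slice Psi t)) /\ smooth_in Y (slicewise Psi)) /\
  (forall w, smooth_in Y w -> exists2 Gw, smooth_in X Gw &
    forall t f, dom G f ->
      \int[torus_measure d]_(x in unit_cube) frob (G f x) (w (t, x)) =
      \int[torus_measure d]_(x in unit_cube) frob (f x) (Gw (t, x))).

End operators.

Definition weight T h :=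
  smooth (h : R -> R^o) /\
  exists c C, 0 < c /\ forall t, 0 <= t <= T -> c <= h t <= C.

(* H(t), the integral of h over [t, T]. *)
Definition tail T h (t : R) : R := \int[lebesgue_measure]_(s in `[t, T]) h s.

End torus.
Arguments CX {R d} m k.
Arguments CX_sym {R d} N.
Arguments CTX {R d} T m k.
Arguments operator {R} d m k m' k'.

Section problem.
Context {R : realType} {d n N Z : nat}.
Local Notation space := 'rV[R]_d.
Local Notation spacetime := (R * 'rV[R]_d)%type.

Record problem := Problem {
  F_dom : set 'rV[R]_n ;
  F_map : 'rV[R]_n -> 'M[R]_N ;
  L_op : operator (R := R) d N N 1 n ;
  A_op : operator (R := R) d 1 n 1 Z }.

Variable P : problem.
Local Notation domF := (F_dom P).
Local Notation F := (F_map P).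
Local Notation L := (L_op P).
Local Notation A := (A_op P).
Local Notation O := (interior domF).

(* KF is the finite part of the entropy K, meaningful on dom F only. *)
Definition KF (y : 'rV[R]_n) : R := 2^-1 * \tr (F y).
Definition entropy (y : 'rV[R]_n) : \bar R :=
  if y \in domF then (KF y)%:E else +oo%E.

Definition dF (l : 'I_n) (y : 'rV[R]_n) : 'M[R]_N :=
  'D_(delta_mx ord0 l) F y.

(* y^# = grad K (y). *)
Definition sharp (y : 'rV[R]_n) : 'rV[R]_n :=
  \row_l 'D_(delta_mx ord0 l) KF y.

Record setting : Prop := {
  F_psd : forall y, domF y -> psd (F y) ;
  F_Loewner_convex : forall Q : 'M[R]_N, psd Q ->
    convex_function domF (fun y => frob (F y) Q) ;
  domF_convex : convex_set domF ;
  domF_interior : O !=set0 ;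
  F_C1 : forall l y, O y ->
    derivable F y (delta_mx ord0 l) /\ {for y, continuous (dF l)} ;
  entropy_strictly_convex : forall y z (s : R), O y -> O z -> y <> z ->
    0 < s < 1 -> KF (s *: y + (1 - s) *: z) < s * KF y + (1 - s) * KF z ;
  entropy_lsc : lower_semicontinuous entropy ;
  L_linear : linear_operator (CX_sym N) (CX 1 n) L ;
  L_dense : densely_defined (CX_sym N) L ;
  L_closed : closed_operator (CX_sym N) (CX 1 n) L ;
  L_spatial : spatial_operator (CX_sym N) (CX 1 n) L ;
  A_linear : linear_operator (CX 1 n) (CX 1 Z) A ;
  A_dense : densely_defined (CX 1 n) A ;
  A_closed : closed_operator (CX 1 n) (CX 1 Z) A ;
  A_closed_range : closed_range (CX 1 Z) A ;
  A_spatial : spatial_operator (CX 1 n) (CX 1 Z) A }.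

(* L^*(v^#) is the measure mu on T^d representing L^*(v^# dx), where L^* is the
   adjoint of the closed operator L; the condition bears on those v for which
   v^# dx lies in the domain of L^*. *)
Definition conservative := forall v : space -> 'rV[R]_n,
  smooth v -> periodic v -> (forall x, O (v x)) -> ker A v ->
  forall mu, sym_measures_on unit_cube mu ->
  (forall Phi, dom L Phi -> pairing unit_cube Phi mu =
    \int[torus_measure d]_(x in unit_cube) frob (L Phi x) (sharp (v x))) ->
  pairing unit_cube (F \o v) mu = 0.

Implicit Types (T : R) (h : R -> R) (M : spacetime -> 'M[R]_N)
  (E : mx_charge (R := R) spacetime 1 n) (B : mx_charge (R := R) spacetime N N).

Definition K0 (v0 : space -> 'rV[R]_n) : \bar R :=
  (\int[torus_measure d]_(x in unit_cube) entropy (v0 x))%E.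

(* The linear constraint on (E, B). *)
Definition LC T E B :=
  [/\ measures_on (cylinder T) E, sym_measures_on (cylinder T) B &
    forall Psi, smooth_in (CX_sym N) Psi ->
      (forall t, 0 <= t <= T -> ker A (slice (slicewise L Psi) t)) ->
      (forall x, Psi (0, x) = 0) ->
      pairing (cylinder T) (dt Psi) B + pairing (cylinder T) (slicewise L Psi) E
        = 0].

Definition admissible T : set (spacetime -> 'rV[R]_n) :=
  [set v | [/\ CTX T 1 n v, (forall p, strip T p -> domF (v p)) &
    CTX T N N (F \o v)]].

Definition weak_solution T (v0 : space -> 'rV[R]_n)
    (v : spacetime -> 'rV[R]_n) := admissible T v /\
  forall E B, LC T E B ->
    pairing (cylinder T) (fun p => v p - v0 p.2) E +
    pairing (cylinder T) (F \o v) B = 0.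

(* v is a strong solution with respect to the weight h, where
     Dv  stands for the measure  d/dt (H v^# dx dt),
     Lv  for  H L^*(v^# dx dt),
     Hpi  for  H pi,  pi being the Lagrange multiplier,
     HApi  for  H A^* pi,
   and H = tail T h. *)
Record strong_solution T h (v0 : space -> 'rV[R]_n)
    (v : spacetime -> 'rV[R]_n)
    (Dv : mx_charge (R := R) spacetime 1 n)
    (Lv : mx_charge (R := R) spacetime N N)
    (Hpi : mx_charge (R := R) spacetime 1 Z)
    (HApi : mx_charge (R := R) spacetime 1 n) : Prop := {
  strong_weight : weight T h ;
  strong_weak : weak_solution T v0 v ;
  strong_interior : forall p, strip T p -> O (v p) ;
  strong_dt_measure : measures_on (cylinder T) Dv ;
  strong_dt : forall phi, smooth_in (CX 1 n) phi -> (forall x, phi (0, x) = 0) ->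
    pairing (cylinder T) phi Dv =
    - \int[Leb]_(p in cylinder T) (tail T h p.1 * frob (dt phi p) (sharp (v p))) ;
  strong_L_measure : sym_measures_on (cylinder T) Lv ;
  strong_L : forall Phi, smooth_in (CX_sym N) Phi ->
    pairing (cylinder T) Phi Lv =
    \int[Leb]_(p in cylinder T)
      (tail T h p.1 * frob (slicewise L Phi p) (sharp (v p))) ;
  strong_lower_bound : exists2 c : R, 0 <= c &
    measure_ge0_on (cylinder T)
      (fun S => (c * fine (Leb S))%:M + mass Lv S) ;
  strong_energy : forall t, 0 <= t <= T ->
    (\int[torus_measure d]_(x in unit_cube) entropy (v (t, x)))%E = K0 v0 ;
  strong_pi_measure : measures_on (cylinder T) Hpi ;
  strong_Api_measure : measures_on (cylinder T) HApi ;
  strong_Api : forall phi, smooth_in (CX 1 n) phi ->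
    pairing (cylinder T) phi HApi = pairing (cylinder T) (slicewise A phi) Hpi ;
  strong_equation : forall (l : 'I_n) S, measurable S -> S `<=` cylinder T ->
    \int[Leb]_(p in S) (h p.1 * sharp (v p) ord0 l) + fine (Dv ord0 l S) +
    pairing S (fun p => dF l (v p)) Lv = fine (HApi ord0 l S) }.

(* Hpi' on [0,T'] with weight h' and Hpi on [0,T] with weight h come from the
   same multiplier pi: Hpi' = (H'/H) Hpi on [0,T'] x Omega, where T' < T. *)
Definition same_multiplier T h (Hpi : mx_charge (R := R) spacetime 1 Z)
    T' h' (Hpi' : mx_charge (R := R) spacetime 1 Z) :=
  forall k S, measurable S -> S `<=` cylinder T' ->
    fine (Hpi' ord0 k S) =
    charge_int (Hpi ord0 k) S (fun p => tail T' h' p.1 / tail T h p.1).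

(* <z, E> + 1/2 <M, h I dx dt + 2 B> *)
Definition saddle T h (z : spacetime -> 'rV[R]_n) M E B : R :=
  pairing (cylinder T) z E +
  2^-1 * (\int[Leb]_(p in cylinder T) (h p.1 * \tr (M p)) +
          2 * pairing (cylinder T) M B).

Definition Lagrangian T h (v0 : space -> 'rV[R]_n)
    (v : spacetime -> 'rV[R]_n) M (EB : mx_charge (R := R) spacetime 1 n *
    mx_charge (R := R) spacetime N N) : \bar R :=
  (saddle T h (fun p => v p - v0 p.2) M EB.1 EB.2)%:E.

Definition LC_pairs T := [set EB : mx_charge (R := R) spacetime 1 n *
    mx_charge (R := R) spacetime N N | LC T EB.1 EB.2].

Definition relaxed_pairs T :=
  [set vM : (spacetime -> 'rV[R]_n) * (spacetime -> 'M[R]_N) |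
    [/\ CTX T 1 n vM.1, CTX T N N vM.2 & forall p, strip T p ->
      [/\ domF (vM.1 p), (vM.2 p)^T = vM.2 p & psd (vM.2 p - F (vM.1 p))]]].

Definition primal T h (v0 : space -> 'rV[R]_n) : \bar R :=
  ereal_inf [set ereal_sup [set Lagrangian T h v0 v (F \o v) EB
    | EB in LC_pairs T] | v in admissible T].

Definition dual T h (v0 : space -> 'rV[R]_n) : \bar R :=
  ereal_sup [set ereal_inf [set Lagrangian T h v0 v (F \o v) EB
    | v in admissible T] | EB in LC_pairs T].

Definition relaxed_primal T h (v0 : space -> 'rV[R]_n) : \bar R :=
  ereal_inf [set ereal_sup [set Lagrangian T h v0 vM.1 vM.2 EB
    | EB in LC_pairs T] | vM in relaxed_pairs T].

Definition relaxed_dual T h (v0 : space -> 'rV[R]_n) : \bar R :=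
  ereal_sup [set ereal_inf [set Lagrangian T h v0 vM.1 vM.2 EB
    | vM in relaxed_pairs T] | EB in LC_pairs T].

(* K(E, B), with value -oo allowed. *)
Definition dual_functional T h E B : \bar R :=
  ereal_inf [set (saddle T h zM.1 zM.2 E B)%:E | zM in relaxed_pairs T].

(* h I dx dt + 2 B *)
Definition shifted_measure h B (S : set spacetime) : 'M[R]_N :=
  (\int[Leb]_(p in S) h p.1)%:M + 2 *: mass B S.

Definition dual_feasible T h E B :=
  LC T E B /\ measure_ge0_on (cylinder T) (shifted_measure h B).

Definition dual_objective T h (v0 : space -> 'rV[R]_n) E B : \bar R :=
  ((- pairing (cylinder T) (fun p => v0 p.2) E)%:E +
   dual_functional T h E B)%E.

Definition dual_maximizer T h (v0 : space -> 'rV[R]_n) E B := dual_feasible T h E B /\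
  forall E' B', dual_feasible T h E' B' ->
    (dual_objective T h v0 E' B' <= dual_objective T h v0 E B)%E.

End problem.
Arguments problem R d n N Z : clear implicits.

Definition mx_charge_sub {R : realType} {dd} {S : measurableType dd} {m k : nat}
    (mu nu : mx_charge (R := R) S m k) : mx_charge (R := R) S m k :=
  \matrix_(i, j) (cadd (mu i j) (copp (nu i j)) : {charge set S -> \bar R}).

Definition exp_weight {R : realType} (gamma : R) : R -> R :=
  fun t => expR (- gamma * t).

(* Main.v *)
(* Write H = tail T h0, H1 = tail T1 h and w = H1 / H on [0, T1].  On [0, T1] the
   measures of the solution are those on [0, T] with density w, to which
   w' H v^# dx dt is added for the time derivative.  Since w vanishes at T1, its
   extension by 0 is Lipschitz on [0, T]; Bernstein polynomials converge to it,
   with derivatives that converge boundedly off a null set, and a test function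
   times such a polynomial in t is again smooth, so the identities on [0, T]
   pass to the limit.  As H is bounded below on [0, T1], the one-sided bound on
   H L^*(v^#) gives h I dx dt + 2 H1 L^*(v^#) >= 0 once gamma is large.

   For the duality, the Lagrangian at v is H1(0) K0 for every pair satisfying
   the linear constraint, by the weak formulation and conservation of energy.
   The pair (E_+, B_+) satisfies the constraint because L is closed and hence
   commutes with d/dt, and Loewner convexity together with the strong equation
   bounds its Lagrangian below by H1(0) K0 at every competitor (z, M). *)

Require Import Defs.
From mathcomp Require Import all_boot all_order all_algebra.
From mathcomp Require Import all_classical all_reals all_analysis.
From mathcomp Require Import measurable_realfun ring lra.

Set Implicit Arguments.
Unset Strict Implicit.
Unset Printing Implicit Defensive.

Import Order.TTheory GRing.Theory Num.Theory.
Import numFieldNormedType.Exports.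

Local Open Scope classical_set_scope.
Local Open Scope ring_scope.

(** * Bounded measurable functions *)

(** The passage to [T1 < T] is forced because H degenerates at T: the given bound controls only c I
    + H L^* v^#, and division by H is safe where H >= c1 (T - T1), with c1 a lower bound of the old
    weight. For the exponential weight H1 <= h / gamma, so 2 c H1 / H <= h once gamma >= 2 c / (c1
    (T - T1)). The extension of w has a corner at [T1] and cannot multiply test functions.
    Polynomials in t can: they preserve smoothness, periodicity, symmetry and vanishing at t = 0,
    and they commute with [L] and [A]. The signed measures may charge a single time slice, so
    against them the approximants must converge at every point, which holds because the extension of
    w is continuous; their derivatives meet only Lebesgue measure, so the slices 0, [T1] and T may
    be discarded. Integrals against a charge use a chosen Jordan decomposition, which is not
    additive in the charge. Identities between integrals against different charges are therefore
    reduced to linearity, boundedness and agreement on indicators. *)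

Section bounded_measurable.
Context {R : realType} {dd : measure_display} {S : measurableType dd}.
Implicit Types (D : set S) (f g : S -> R).

(** All measures below are finite on the sets used, so this one class guarantees integrability
    everywhere and is stable under the algebra required. *)
Definition bmeas D f :=
  measurable_fun D f /\ exists M, forall p, D p -> `|f p| <= M.

Lemma bmeas_ext D f g : (forall p, D p -> f p = g p) -> bmeas D f -> bmeas D g.
Proof.
move=> fg [mf [M fM]]; split; last by exists M => p Dp; rewrite -fg// fM.
by apply: eq_measurable_fun mf => p; rewrite inE => /fg.
Qed.

Lemma bmeas_cst D (c : R) : bmeas D (fun=> c).
Proof. by split; [exact: measurable_cst|exists `|c|]. Qed.

Lemma bmeasD D f g : bmeas D f -> bmeas D g -> bmeas D (fun p => f p + g p).
Proof.
move=> [mf [M fM]] [mg [K gK]]; split; first exact: measurable_funD.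
by exists (M + K) => p Dp; rewrite (le_trans (ler_normD _ _))// lerD ?fM ?gK.
Qed.

Lemma bmeasM D f g : bmeas D f -> bmeas D g -> bmeas D (fun p => f p * g p).
Proof.
move=> [mf [M fM]] [mg [K gK]]; split; first exact: measurable_funM.
by exists (M * K) => p Dp; rewrite normrM ler_pM ?fM ?gK.
Qed.

Lemma bmeasZ D c f : bmeas D f -> bmeas D (fun p => c * f p).
Proof. by move=> bf; apply: bmeasM bf; exact: bmeas_cst. Qed.

Lemma bmeasN D f : bmeas D f -> bmeas D (fun p => - f p).
Proof. by move=> /(bmeasZ (-1)); apply: bmeas_ext => p _; rewrite mulN1r. Qed.

Lemma bmeasB D f g : bmeas D f -> bmeas D g -> bmeas D (fun p => f p - g p).
Proof. by move=> bf bg; apply: bmeasD => //; exact: bmeasN. Qed.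

Lemma bmeas_sum D (I : Type) (r : seq I) (P : pred I) (f : I -> S -> R) :
  (forall i, bmeas D (f i)) -> bmeas D (fun p => \sum_(i <- r | P i) f i p).
Proof.
move=> bf; elim: r => [|i r IH].
  by apply: bmeas_ext (bmeas_cst D 0) => p _; rewrite big_nil.
case Pi : (P i); last by apply: bmeas_ext IH => p _; rewrite big_cons Pi.
by apply: bmeas_ext (bmeasD (bf i) IH) => p _; rewrite big_cons Pi.
Qed.

Lemma bmeasW D D' f : measurable D' -> D `<=` D' -> bmeas D' f -> bmeas D f.
Proof.
move=> mD' DD' [mf [M fM]]; split; first exact: measurable_funS mf.
by exists M => p /DD'; exact: fM.
Qed.

Lemma bmeas_indic D (A : set S) : measurable A -> bmeas D (\1_A).
Proof.
move=> mA; split; first exact: measurable_indic.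
by exists 1 => p _; rewrite indicE; case: (_ \in _); rewrite ?normr1 ?normr0.
Qed.

Lemma bmeas_restrict D A f : measurable D -> measurable A -> A `<=` D ->
  bmeas A f -> bmeas D (fun p => \1_A p * f p).
Proof.
move=> mD mA AD [mf [M fM]]; split; last first.
  exists `|M| => p _; rewrite indicE; case: (boolP (p \in A)); last by rewrite mul0r normr0.
  by rewrite inE mul1r => Ap; rewrite (le_trans (fM _ Ap))// ler_norm.
have : measurable_fun D (f \_ A).
  apply/(measurable_restrict f mA mD).
  by apply: measurable_funS mf => //; exact: subIsetr.
apply: eq_measurable_fun => p _; rewrite patchE indicE.
by case: ifPn => _; rewrite ?mul1r ?mul0r.
Qed.

Lemma bmeas_integrable (mu : {measure set S -> \bar R}) D f : measurable D ->
  (mu D < +oo)%E -> bmeas D f -> mu.-integrable D (EFin \o f).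
Proof.
move=> mD muD [mf [M fM]]; apply: measurable_bounded_integrable => //.
exists M; split; first exact: num_real.
by move=> x Mx p /= Dp; rewrite (le_trans (fM _ Dp))// ltW.
Qed.

(* Level sets of finitely many bounded functions: the functions oscillate by at
   most e on each cell. *)
Lemma bmeas_grid D (I : finType) (f : I -> S -> R) (e : R) : measurable D ->
  (forall i, bmeas D (f i)) -> 0 < e ->
  exists (K : finType) (A : K -> set S),
    [/\ forall k, measurable (A k), forall k, A k `<=` D,
        forall p, D p -> \sum_k \1_(A k) p = 1 :> R &
        forall k p q, A k p -> A k q -> forall i, `|f i p - f i q| <= e].
Proof.
move=> mD bf e0.
have [M fM] : exists M, forall i p, D p -> `|f i p| <= M.
  have /choice[M fM] : forall i, exists M, forall p, D p -> `|f i p| <= M.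
    by move=> i; case: (bf i).
  exists (\sum_i `|M i|) => i p Dp.
  rewrite (le_trans (fM _ _ Dp))// (le_trans (ler_norm _))//.
  by rewrite (bigD1 i)//= lerDl sumr_ge0.
(* Level j is the interval [j e - M, (j + 1) e - M); since values are at most [M], levels above [m]
   do not occur. *)
pose m := Num.truncn ((M + M) / e).
pose idx (y : R) := Num.truncn ((y + M) / e).
have idxP y : `|y| <= M -> (idx y)%:R * e - M <= y < (idx y).+1%:R * e - M.
  move=> yM; have yM0 : 0 <= (y + M) / e.
    apply: divr_ge0; last exact: ltW.
    by move: yM; rewrite ler_norml => /andP[]; lra.
  have /andP[] := truncn_itv yM0; rewrite ler_pdivlMr// ltr_pdivrMr// -/(idx y).
  lra.
have idxm y : `|y| <= M -> (idx y < m.+1)%N.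
  move=> yM; rewrite ltnS; apply: le_truncn; rewrite ler_pM2r ?invr_gt0//.
  by rewrite lerD2r (le_trans (ler_norm _)).
pose cell j : set R := `[j%:R * e - M, j.+1%:R * e - M[%classic.
(* One level per function: the cells are the fibres of p -> (idx (f i p))_i, hence a partition of
   [D]. *)
exists {ffun I -> 'I_m.+1}.
pose A (k : {ffun I -> 'I_m.+1}) :=
  D `&` \bigcap_(i in [set: I]) (D `&` f i @^-1` cell (k i)).
have AE k p : A k p <-> D p /\ forall i, k i = idx (f i p) :> nat.
  split=> [[Dp Ap]|[Dp Ep]].
    split=> // i; have [_] := Ap i Logic.I.
    rewrite /cell /= in_itv /= => /andP[k1 k2].
    have /andP[i1 i2] := idxP _ (fM i _ Dp).
    have h1 : (k i)%:R * e < (idx (f i p)).+1%:R * e by lra.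
    have h2 : (idx (f i p))%:R * e < (k i).+1%:R * e by lra.
    move: h1 h2; rewrite !(ltr_pM2r e0) !ltr_nat !ltnS => h1 h2.
    by apply/eqP; rewrite eqn_leq h1 h2.
  split=> // i _; split=> //; rewrite /cell /= in_itv /= Ep.
  exact: idxP (fM i _ Dp).
exists A; split.
- move=> k; apply: measurableI => //; apply: fin_bigcap_measurable => [|i _].
    exact: finite_finset.
  by case: (bf i) => mf _; apply: (mf mD); exact: measurable_itv.
- by move=> k p [].
- move=> p Dp.
  pose k0 : {ffun I -> 'I_m.+1} := [ffun i => Ordinal (idxm _ (fM i _ Dp))].
  rewrite (bigD1 k0)//= indicE mem_set; last first.
    by apply/AE; split=> // i; rewrite ffunE.
  rewrite big1 ?addr0// => k kk0; rewrite indicE memNset// => /AE[_ kE].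
  by move/eqP : kk0; apply; apply/ffunP => i; apply/val_inj; rewrite ffunE; exact: kE.
- move=> k p q /AE[Dp kp] /AE[Dq kq] i.
  have /andP[p1 p2] := idxP _ (fM i _ Dp).
  have /andP[q1 q2] := idxP _ (fM i _ Dq).
  move: p1 p2 q1 q2; rewrite -kp -kq -!natr1 !mulrDl !mul1r => *.
  by rewrite ler_norml; apply/andP; split; lra.
Qed.

(** Sums and multiples of indicators give the simple functions, which are uniformly dense among
    bounded measurable functions by [bmeas_grid]. *)
Lemma bmeas_uniform_ind D (P : (S -> R) -> Prop) : measurable D ->
  (forall f g, (forall p, D p -> f p = g p) -> P f -> P g) ->
  (forall A, measurable A -> A `<=` D -> P (\1_A)) ->
  (forall f g, bmeas D f -> bmeas D g -> P f -> P g -> P (fun p => f p + g p)) ->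
  (forall c f, bmeas D f -> P f -> P (fun p => c * f p)) ->
  (forall f, bmeas D f -> (forall e, 0 < e -> exists g,
     [/\ bmeas D g, P g & forall p, D p -> `|f p - g p| <= e]) -> P f) ->
  forall f, bmeas D f -> P f.
Proof.
move=> mD Pext P1 PD PZ Plim f bf; apply: Plim => // e e0.
have [K [A [mA AD A1 Ae]]] := @bmeas_grid D unit (fun=> f) e mD (fun=> bf) e0.
(* A sampled value of [f] on each cell; an empty cell gets 0, which its indicator never shows. *)
pose a k := if pselect (exists p, A k p) is left h then f (sval (cid h)) else 0.
exists (fun p => \sum_k a k * \1_(A k) p); split.
- by apply: bmeas_sum => k; apply: bmeasZ; exact: bmeas_indic.
- suff : forall s : seq K, P (fun p => \sum_(k <- s) a k * \1_(A k) p) by exact.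
  elim=> [|k s IH].
    apply: (Pext (fun p => 0 * \1_set0 p)).
      by move=> p _; rewrite big_nil mul0r.
    by apply: PZ; [exact: bmeas_indic|exact: P1].
  apply: (Pext (fun p => a k * \1_(A k) p + \sum_(k <- s) a k * \1_(A k) p)).
    by move=> p _; rewrite big_cons.
  apply: PD => //.
  + by apply: bmeasZ; exact: bmeas_indic.
  + by apply: bmeas_sum => j; apply: bmeasZ; exact: bmeas_indic.
  + by apply: PZ; [exact: bmeas_indic|exact: P1].
- move=> p Dp; rewrite -[X in `|X - _|]mul1r -(A1 _ Dp) mulr_suml -sumrB.
  rewrite (le_trans (ler_norm_sum _ _ _))//.
  rewrite -[leRHS]mulr1 -(A1 _ Dp) mulr_sumr; apply: ler_sum => k _.
  rewrite mulrC -mulrBl normrM [X in _ * X]ger0_norm; last by rewrite indicE.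
  rewrite indicE; case: (boolP (p \in A k)); rewrite ?mulr0// !mulr1 inE => Ap.
  rewrite /a; case: pselect => [h|]; last by case; exists p.
  by case: cid => q Aq /=; exact: (Ae k p q Ap Aq tt).
Qed.

End bounded_measurable.

(** * Integrals against signed measures *)

Section charge_integral.
Context {R : realType} {dd : measure_display} {S : measurableType dd}.
Implicit Types (D : set S) (f g : S -> R) (nu : {charge set S -> \bar R}).

(** Hides the chosen Hahn set: some pair of finite measures represents both the charge and its
    integral. *)
Lemma charge_int_jordan nu :
  exists mu1 mu2 : {finite_measure set S -> \bar R},
    (forall A, measurable A -> nu A = (mu1 A - mu2 A)%E) /\
    forall D f, charge_int nu D f = Rintegral mu1 D f - Rintegral mu2 D f.
Proof.
pose PN := projT2 (cid (projT2 (cid (Hahn_decomposition nu)))).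
exists (jordan_pos PN), (jordan_neg PN); split => // A mA.
by rewrite (jordan_decomp PN mA) /cadd/= cscaleN1.
Qed.

Lemma Rintegral_bound (mu : {measure set S -> \bar R}) D f M : measurable D ->
  (mu D < +oo)%E -> bmeas D f -> 0 <= M -> (forall p, D p -> `|f p| <= M) ->
  `|Rintegral mu D f| <= M * fine (mu D).
Proof.
move=> mD muD bf M0 fM.
have intf := bmeas_integrable mD muD bf.
rewrite (le_trans (le_normr_Rintegral mD intf))//.
rewrite -(Rintegral_cst mu mD); apply: le_Rintegral => //.
- exact: (integrable_norm intf).
- by apply: (bmeas_integrable mD muD); exact: bmeas_cst.
Qed.

Lemma charge_intD nu D f g : measurable D -> bmeas D f -> bmeas D g ->
  charge_int nu D (fun p => f p + g p) = charge_int nu D f + charge_int nu D g.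
Proof.
move=> mD bf bg; have [m1 [m2 [_ E]]] := charge_int_jordan nu.
have H (mu : {finite_measure set S -> \bar R}) :
    Rintegral mu D (fun p => f p + g p) = Rintegral mu D f + Rintegral mu D g.
  by apply: RintegralD => //; apply: bmeas_integrable => //;
     rewrite -ge0_fin_numE// fin_num_measure.
by rewrite !E !H; ring.
Qed.

Lemma charge_intZ nu D c f : measurable D -> bmeas D f ->
  charge_int nu D (fun p => c * f p) = c * charge_int nu D f.
Proof.
move=> mD bf; have [m1 [m2 [_ E]]] := charge_int_jordan nu.
have H (mu : {finite_measure set S -> \bar R}) :
    Rintegral mu D (fun p => c * f p) = c * Rintegral mu D f.
  by apply: RintegralZl => //; apply: bmeas_integrable => //;
     rewrite -ge0_fin_numE// fin_num_measure.
by rewrite !E !H; ring.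
Qed.

Lemma charge_intN nu D f : measurable D -> bmeas D f ->
  charge_int nu D (fun p => - f p) = - charge_int nu D f.
Proof.
move=> mD bf; rewrite -mulN1r -charge_intZ//; congr charge_int.
by apply/funext => p; rewrite mulN1r.
Qed.

Lemma charge_intB nu D f g : measurable D -> bmeas D f -> bmeas D g ->
  charge_int nu D (fun p => f p - g p) = charge_int nu D f - charge_int nu D g.
Proof.
by move=> mD bf bg; rewrite charge_intD// ?charge_intN//; exact: bmeasN.
Qed.

Lemma eq_charge_int nu D f g : (forall p, D p -> f p = g p) ->
  charge_int nu D f = charge_int nu D g.
Proof.
move=> fg; have [m1 [m2 [_ E]]] := charge_int_jordan nu.
by rewrite !E; congr (_ - _); apply: eq_Rintegral => p; rewrite inE => /fg.
Qed.

Lemma charge_int0 nu D : charge_int nu D (fun=> 0) = 0.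
Proof.
have [m1 [m2 [_ E]]] := charge_int_jordan nu.
by rewrite E /Rintegral !integral0 subrr.
Qed.

Lemma charge_int_sum nu D (I : Type) (r : seq I) (f : I -> S -> R) :
  measurable D -> (forall i, bmeas D (f i)) ->
  charge_int nu D (fun p => \sum_(i <- r) f i p) =
  \sum_(i <- r) charge_int nu D (f i).
Proof.
move=> mD bf; elim: r => [|i r IH].
  rewrite big_nil -[RHS](charge_int0 nu D).
  by congr charge_int; apply/funext => p; rewrite big_nil.
rewrite big_cons -IH -charge_intD//; last exact: bmeas_sum.
by congr charge_int; apply/funext => p; rewrite big_cons.
Qed.

Lemma charge_int_indic nu D A : measurable D -> measurable A ->
  charge_int nu D (\1_A) = fine (nu (A `&` D)).
Proof.
move=> mD mA; have [m1 [m2 [nuE E]]] := charge_int_jordan nu.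
rewrite E nuE; last exact: measurableI.
rewrite /Rintegral !integral_indic//.
have mAD : measurable (A `&` D) by exact: measurableI.
by rewrite fineB// fin_num_measure.
Qed.

(** The constant is the mass of the two Jordan parts on [D]; this is the continuity under uniform
    limits that [charge_int_ext] relies on. *)
Lemma charge_int_bound nu D : measurable D -> exists2 C, 0 <= C &
  forall f M, bmeas D f -> 0 <= M -> (forall p, D p -> `|f p| <= M) ->
  `|charge_int nu D f| <= C * M.
Proof.
move=> mD; have [m1 [m2 [_ E]]] := charge_int_jordan nu.
exists (fine (m1 D) + fine (m2 D)); first by rewrite addr_ge0// fine_ge0.
move=> f M bf M0 fM; rewrite E (le_trans (ler_normB _ _))// mulrC mulrDr.
by apply: lerD; apply: Rintegral_bound => //;
  rewrite -ge0_fin_numE// fin_num_measure.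
Qed.

(** Uniqueness of the integral: a functional that is linear, bounded in the sup norm and correct on
    indicators agrees with it on simple functions, then on their uniform limits. Every change of
    charge or of domain below is an instance. *)
Lemma charge_int_ext nu D (La : (S -> R) -> R) C : measurable D ->
  (forall f g, bmeas D f -> bmeas D g -> La (fun p => f p + g p) = La f + La g) ->
  (forall c f, bmeas D f -> La (fun p => c * f p) = c * La f) ->
  (forall f g, (forall p, D p -> f p = g p) -> La f = La g) ->
  (forall f M, bmeas D f -> 0 <= M -> (forall p, D p -> `|f p| <= M) ->
    `|La f| <= C * M) ->
  (forall A, measurable A -> A `<=` D -> La (\1_A) = fine (nu A)) ->
  forall f, bmeas D f -> charge_int nu D f = La f.
Proof.
move=> mD LaD LaZ Lae LaC La1 f bf.
pattern f; apply: (bmeas_uniform_ind mD) bf => {f}.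
- by move=> f g fg; rewrite (Lae _ _ fg) (eq_charge_int nu fg).
- move=> A mA AD; rewrite charge_int_indic// La1//.
  by rewrite (setIidl AD).
- by move=> f g bf bg Ef Eg; rewrite charge_intD// LaD// Ef Eg.
- by move=> c f bf Ef; rewrite charge_intZ// LaZ// Ef.
- move=> f bf fe; have [C' C'0 nuC] := charge_int_bound nu mD.
  apply/eqP; rewrite -subr_eq0 -normr_eq0; apply/eqP/le_anti.
  rewrite normr_ge0 andbT; apply/ler_addgt0Pl => e e0; rewrite addr0.
  (* The error is chosen so that both functionals together contribute at most [e]; the summand 1
     keeps the denominator positive. *)
  have [|g [bg Eg fg]] := fe (e / (C' + `|C| + 1)).
    by rewrite divr_gt0// ltr_wpDl// addr_ge0.
  have bfg := bmeasB bf bg.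
  have -> : charge_int nu D f - La f =
      charge_int nu D (fun p => f p - g p) - La (fun p => f p - g p).
    have -> : La (fun p => f p - g p) = La f - La g.
      rewrite (Lae _ (fun p => f p + (-1) * g p)); last by move=> p _; rewrite mulN1r.
      by rewrite LaD ?LaZ ?mulN1r//; exact: bmeasZ.
    by rewrite charge_intB// Eg; ring.
  have d0 : 0 < C' + `|C| + 1 by rewrite ltr_wpDl// addr_ge0.
  have e'0 : 0 <= e / (C' + `|C| + 1) by rewrite divr_ge0// ltW.
  rewrite (le_trans (ler_normB _ _))//.
  apply: (@le_trans _ _ ((C' + C) * (e / (C' + `|C| + 1)))).
    by rewrite mulrDl lerD// ?nuC// LaC.
  rewrite mulrCA; apply: ler_piMr; first exact: ltW.
  rewrite ler_pdivrMr// mul1r.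
  have := ler_norm C; lra.
Qed.

(** The Jordan parts of a combination are not the combinations of the Jordan parts, so linearity in
    the charge is obtained from [charge_int_ext]. *)
Lemma charge_int_lin nu nu1 nu2 D (a b : R) f : measurable D ->
  (forall A, measurable A -> A `<=` D ->
    fine (nu A) = a * fine (nu1 A) + b * fine (nu2 A)) -> bmeas D f ->
  charge_int nu D f = a * charge_int nu1 D f + b * charge_int nu2 D f.
Proof.
move=> mD nuE.
have [C1 C10 B1] := charge_int_bound nu1 mD.
have [C2 C20 B2] := charge_int_bound nu2 mD.
apply: (charge_int_ext (La := fun f => a * charge_int nu1 D f + b * charge_int nu2 D f)
  (C := `|a| * C1 + `|b| * C2)) => //.
- by move=> g h bg bh; rewrite !charge_intD//; ring.
- by move=> c g bg; rewrite !charge_intZ//; ring.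
- by move=> g h gh; rewrite !(eq_charge_int _ gh).
- move=> g M bg M0 gM; rewrite (le_trans (ler_normD _ _))// !normrM mulrDl -!mulrA.
  by apply: lerD; apply: ler_wpM2l; rewrite ?B1 ?B2.
- by move=> A mA AD; rewrite !charge_int_indic// (setIidl AD) nuE.
Qed.

Lemma eq_charge_int_charge nu nu' D f : measurable D ->
  (forall A, measurable A -> A `<=` D -> fine (nu A) = fine (nu' A)) ->
  bmeas D f -> charge_int nu D f = charge_int nu' D f.
Proof.
move=> mD nuE bf; rewrite (@charge_int_lin nu nu' nu' D 1 0)//; first by ring.
by move=> A mA AD; rewrite nuE//; ring.
Qed.

Lemma charge_int_supp nu D D' f : measurable D -> measurable D' -> D `<=` D' ->
  (forall A, measurable A -> nu A = nu (A `&` D)) -> bmeas D' f ->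
  charge_int nu D' f = charge_int nu D f.
Proof.
move=> mD mD' DD' nuD.
have [C C0 B] := charge_int_bound nu mD.
apply: (charge_int_ext (La := charge_int nu D) (C := C)) => //.
- by move=> g h bg bh; rewrite charge_intD//; exact: bmeasW DD' _.
- by move=> c g bg; rewrite charge_intZ//; exact: bmeasW DD' _.
- by move=> g h gh; apply: eq_charge_int => p /DD'; exact: gh.
- move=> g M bg M0 gM; apply: B => //; first exact: bmeasW DD' _.
  by move=> p /DD'; exact: gM.
- by move=> A mA AD; rewrite charge_int_indic// -nuD.
Qed.

Lemma charge_int_sub nu D A f : measurable D -> measurable A -> A `<=` D ->
  bmeas A f -> charge_int nu A f = charge_int nu D (fun p => \1_A p * f p).
Proof.
move=> mD mA AD.
have [C C0 B] := charge_int_bound nu mD.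
apply: (charge_int_ext (La := fun f => charge_int nu D (fun p => \1_A p * f p))
    (C := C)) => //.
- move=> g h bg bh; rewrite -charge_intD//; [|exact: bmeas_restrict..].
  by apply: eq_charge_int => p _; ring.
- move=> c g bg; rewrite -charge_intZ//; last exact: bmeas_restrict.
  by apply: eq_charge_int => p _; ring.
- move=> g h gh; apply: eq_charge_int => p _; rewrite indicE.
  by case: (boolP (p \in A)); rewrite ?mul0r// inE => /gh ->.
- move=> g M bg M0 gM; apply: B => //; first exact: bmeas_restrict.
  move=> p _; rewrite indicE; case: (boolP (p \in A)); rewrite ?mul0r ?normr0//.
  by rewrite inE mul1r => /gM.
- move=> X mX XA; rewrite (_ : (fun p => _) = \1_X).
    by rewrite charge_int_indic// (setIidl (subset_trans XA AD)).
  apply/funext => p; rewrite !indicE; case: (boolP (p \in X)).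
    by rewrite inE => Xp; rewrite !mem_set ?mul1r//; exact: XA.
  by rewrite mulr0.
Qed.

(** Dominated convergence on each Jordan part. Convergence is asked at every point because [nu] may
    charge sets that are Lebesgue-null. *)
Lemma charge_int_cvg nu D (f_ : nat -> S -> R) f M : measurable D ->
  (forall k, bmeas D (f_ k)) -> measurable_fun D f ->
  (forall k p, D p -> `|f_ k p| <= M) ->
  (forall p, D p -> f_ k p @[k --> \oo] --> f p) ->
  charge_int nu D (f_ k) @[k --> \oo] --> charge_int nu D f.
Proof.
move=> mD bf mf fM ff; have [m1 [m2 [_ E]]] := charge_int_jordan nu.
have H (mu : {finite_measure set S -> \bar R}) :
    Rintegral mu D (f_ k) @[k --> \oo] --> Rintegral mu D f.
  have muD : (mu D < +oo)%E by rewrite -ge0_fin_numE// fin_num_measure.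
  have [i1 _ i3] : [/\ mu.-integrable D (EFin \o f),
      (\int[mu]_(x in D) `|(EFin \o f_ n) x - (EFin \o f) x| @[n --> \oo] --> 0)%E &
      (\int[mu]_(x in D) (EFin \o f_ n) x @[n --> \oo] --> \int[mu]_(x in D) (EFin \o f) x)%E].
    apply: (@dominated_convergence _ _ _ mu D mD (fun k => EFin \o f_ k) _ (fun=> M%:E)).
    - by move=> k; apply/measurable_EFinP; case: (bf k).
    - exact/measurable_EFinP.
    - apply: aeW => p Dp; apply: cvg_EFin; last exact: ff.
      exact: nearW.
    - by apply: bmeas_integrable => //; exact: bmeas_cst.
    - by apply: aeW => p Dp k; rewrite /= lee_fin fM.
  apply: fine_cvg; rewrite fineK//; exact: integrable_fin_num.
by under eq_fun do rewrite E; rewrite E; apply: cvgB.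
Qed.

End charge_integral.

(** * Densities and semidefinite matrix measures *)

Section densities.
Context {R : realType} {dd : measure_display} {S : measurableType dd}.
Implicit Types (D : set S) (f g : S -> R) (nu : {charge set S -> \bar R}).

(** The density is set to 0 off [D] before integrating, so the resulting charge is already supported
    in [D]. *)
Lemma measure_density (mu : {measure set S -> \bar R}) D g : measurable D ->
  (mu D < +oo)%E -> bmeas D g ->
  exists nu' : {charge set S -> \bar R},
    [/\ forall A, measurable A -> nu' A = nu' (A `&` D),
        forall A, measurable A -> A `<=` D -> fine (nu' A) = Rintegral mu A g &
        forall f, bmeas D f ->
          charge_int nu' D f = Rintegral mu D (fun p => f p * g p)].
Proof.
move=> mD muD bg.
have ig : mu.-integrable setT ((EFin \o g) \_ D).
  by apply/(integrable_mkcond _ mD); exact: bmeas_integrable.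
pose nu' : {charge set S -> \bar R} := induced_charge ig.
have nu'E A : measurable A -> A `<=` D -> fine (nu' A) = Rintegral mu A g.
  move=> mA AD; rewrite /nu' /= /induced_charge /Rintegral; congr fine.
  by apply: eq_integral => p; rewrite inE => /AD Dp; rewrite patchE mem_set.
exists nu'; split => //.
  move=> A mA; rewrite /nu' /= /induced_charge integral_mkcondr/=.
  by apply: eq_integral => p _; rewrite !patchE; case: ifP.
have intf h : bmeas D h -> mu.-integrable D (EFin \o h) by exact: bmeas_integrable.
case: (bg) => mg [K gK].
apply: (charge_int_ext (La := fun f => Rintegral mu D (fun p => f p * g p))
  (C := `|K| * fine (mu D))) => //.
- move=> f h bf bh; rewrite -RintegralD//; try by apply: intf; exact: bmeasM.
  by apply: eq_Rintegral => p _; ring.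
- move=> c f bf; rewrite -RintegralZl//; try by apply: intf; exact: bmeasM.
  by apply: eq_Rintegral => p _; rewrite mulrA.
- by move=> f h fh; apply: eq_Rintegral => p; rewrite inE => /fh ->.
- move=> f M bf M0 fM; rewrite mulrC mulrA.
  apply: Rintegral_bound => //; first exact: bmeasM.
    by rewrite mulr_ge0.
  move=> p Dp; rewrite normrM ler_pM ?fM//.
  by rewrite (le_trans (gK _ Dp))// ler_norm.
- move=> A mA AD; rewrite nu'E// Rintegral_mkcond [RHS]Rintegral_mkcond.
  apply: eq_Rintegral => p _; rewrite !patchE.
  case: ifPn => [|pD].
    by rewrite inE indicE => Dp; case: ifPn; rewrite ?mul1r ?mul0r.
  by rewrite ifN//; apply: contra pD; rewrite !inE => /AD.
Qed.

Lemma charge_density nu D g : measurable D -> bmeas D g ->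
  exists nu' : {charge set S -> \bar R},
    [/\ forall A, measurable A -> nu' A = nu' (A `&` D),
        forall A, measurable A -> A `<=` D -> fine (nu' A) = charge_int nu A g &
        forall f, bmeas D f ->
          charge_int nu' D f = charge_int nu D (fun p => f p * g p)].
Proof.
move=> mD bg; have [m1 [m2 [_ E]]] := charge_int_jordan nu.
have fin (mu : {finite_measure set S -> \bar R}) : (mu D < +oo)%E.
  by rewrite -ge0_fin_numE// fin_num_measure.
have [n1 [s1 v1 i1]] := measure_density mD (fin m1) bg.
have [n2 [s2 v2 i2]] := measure_density mD (fin m2) bg.
pose nu' : {charge set S -> \bar R} := cadd n1 (copp n2).
have nu'E A : measurable A -> nu' A = (n1 A - n2 A)%E by [].
exists nu'; split.
- move=> A mA; have mAD : measurable (A `&` D) by exact: measurableI.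
  by rewrite !nu'E// -s1// -s2.
- by move=> A mA AD; rewrite nu'E// fineB ?v1 ?v2 ?E// fin_num_measure.
- move=> f bf; rewrite E -i1// -i2//.
  rewrite (@charge_int_lin _ _ _ nu' n1 n2 D 1 (-1))//; first by ring.
  by move=> A mA AD; rewrite nu'E// fineB ?fin_num_measure//; ring.
Qed.

End densities.

(** * Positive semidefinite matrices and the Frobenius product *)

Section psd.
Context {R : realType}.
Implicit Types N : nat.

Lemma psd_entry N (A : 'M[R]_N) (u w : 'rV[R]_N) :
  (u *m A *m w^T) ord0 ord0 = \sum_i \sum_j u ord0 i * A i j * w ord0 j.
Proof.
rewrite mxE exchange_big/=; apply: eq_bigr => j _.
by rewrite !mxE mulr_suml; apply: eq_bigr.
Qed.

Lemma psd_outer N (u : 'rV[R]_N) : psd (u^T *m u).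
Proof.
split; first by rewrite trmx_mul trmxK.
move=> w; rewrite mulmxA -mulmxA.
have -> : u *m w^T = (w *m u^T)^T by rewrite trmx_mul trmxK.
by rewrite mxE big_ord1 [X in _ * X]mxE -expr2 sqr_ge0.
Qed.

Lemma frob_outer N (A : 'M[R]_N) (u : 'rV[R]_N) :
  frob A (u^T *m u) = (u *m A *m u^T) ord0 ord0.
Proof.
rewrite psd_entry; apply: eq_bigr => i _; apply: eq_bigr => j _.
by rewrite mxE big_ord1 !mxE; ring.
Qed.

Lemma frobDl m k (A B C : 'M[R]_(m, k)) : frob (A + B) C = frob A C + frob B C.
Proof.
rewrite -big_split; apply: eq_bigr => i _; rewrite -big_split.
by apply: eq_bigr => j _; rewrite mxE mulrDl.
Qed.

Lemma frobZl m k a (A C : 'M[R]_(m, k)) : frob (a *: A) C = a * frob A C.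
Proof.
rewrite mulr_sumr; apply: eq_bigr => i _; rewrite mulr_sumr.
by apply: eq_bigr => j _; rewrite mxE mulrA.
Qed.

Lemma frobC m k (A B : 'M[R]_(m, k)) : frob A B = frob B A.
Proof. by apply: eq_bigr => i _; apply: eq_bigr => j _; rewrite mulrC. Qed.

(** This is the quadratic form of [A] at u - s e_i, expanded; suitable choices of [u] and [s] give
    the facts that follow. *)
Lemma psd_quad N (A : 'M[R]_N) (u : 'rV[R]_N) i (s : R) : psd A ->
  0 <= (u *m A *m u^T) ord0 ord0 - (u *m A) ord0 i * s *+ 2 + s ^+ 2 * A i i.
Proof.
move=> [At Ap]; have := Ap (u - s *: delta_mx ord0 i).
have Ai (w : 'rV[R]_N) : (w *m A *m (delta_mx ord0 i : 'rV_N)^T) ord0 ord0 = (w *m A) ord0 i.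
  rewrite trmx_delta mxE (bigD1 i)//= big1 ?addr0 ?mxE ?eqxx ?mulr1//.
  by move=> j ji; rewrite !mxE (negbTE ji) mulr0.
have iA (w : 'rV[R]_N) : ((delta_mx ord0 i : 'rV_N) *m A *m w^T) ord0 ord0 = (w *m A) ord0 i.
  rewrite -Ai -[in RHS]At -[w in RHS]trmxK -!trmx_mul [RHS]mxE; congr (_ ord0 ord0).
  by rewrite mulmxA.
pose q (u w : 'rV[R]_N) := (u *m A *m w^T) ord0 ord0.
have qC x y : q x y = q y x.
  have -> : q y x = (x *m A *m y^T)^T ord0 ord0.
    by rewrite /q !trmx_mul trmxK At mulmxA.
  by rewrite [RHS]mxE.
have qB x y z : q (x - s *: y) z = q x z - s * q y z.
  rewrite /q !mulmxBl -!scalemxAl [LHS]mxE [X in _ + X]mxE.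
  by rewrite [X in _ - X]mxE.
pose e : 'rV[R]_N := delta_mx ord0 i.
have qee : q e e = A i i.
  rewrite /q Ai mxE (bigD1 i)//= big1 ?addr0 ?mxE ?eqxx ?mul1r//.
  by move=> j ji; rewrite !mxE (negbTE ji) andbF mul0r.
move=> h; have : 0 <= q (u - s *: e) (u - s *: e) by [].
rewrite qB !(qC _ (u - _)) !qB qee (qC e u) [q u e]Ai => {}h.
by apply: (le_trans h); rewrite le_eqVlt; apply/orP; left; apply/eqP; rewrite /q; ring.
Qed.

Lemma psd_diag_ge0 N (A : 'M[R]_N) i : psd A -> 0 <= A i i.
Proof.
by move=> /(psd_quad 0 i 1); rewrite !mul0mx !mxE mul0r mul0rn subr0 expr1n mul1r add0r.
Qed.

Lemma psd_diag0 N (A : 'M[R]_N) i : psd A -> A i i = 0 -> forall j, A j i = 0.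
Proof.
move=> pA Aii j; have h s := psd_quad (delta_mx ord0 j) i s pA.
have e1 : ((delta_mx ord0 j : 'rV_N) *m A) ord0 i = A j i.
  rewrite mxE (bigD1 j)//= big1 ?addr0 ?mxE ?eqxx ?mul1r//.
  by move=> k kj; rewrite !mxE (negbTE kj) andbF mul0r.
have e2 : ((delta_mx ord0 j : 'rV_N) *m A *m (delta_mx ord0 j : 'rV_N)^T) ord0 ord0 = A j j.
  rewrite psd_entry (bigD1 j)//= [X in _ + X]big1 ?addr0.
    rewrite (bigD1 j)//= big1 ?addr0 ?mxE ?eqxx ?mul1r ?mulr1//.
    by move=> k kj; rewrite !mxE (negbTE kj) andbF mulr0.
  by move=> k kj; rewrite big1// => l _; rewrite !mxE (negbTE kj) andbF !mul0r.
apply/eqP; apply: contraT => Aji.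
(* For this s the form would equal A_jj - 2 (A_jj + 1), which is negative. *)
have := h ((A j j + 1) / A j i); rewrite e1 e2 Aii mulr0 addr0 mulrCA divff// mulr1.
have := psd_diag_ge0 j pA; lra.
Qed.

(* Subtracting a rank-one matrix clears one more row of A, so A is a
   nonnegative combination of outer products. *)
Lemma psd_frob_ge0 N (A B : 'M[R]_N) : psd A -> psd B -> 0 <= frob A B.
Proof.
move=> pA pB; have [m] := ubnP #|[pred i | row i A != 0]|.
elim: m A pA => // m IH A pA; rewrite ltnS => cA.
have [/existsP[i Ai]|/existsPn A0] := boolP [exists i, A i i != 0]; last first.
  rewrite /frob big1// => i _; rewrite big1// => j _.
  by rewrite (psd_diag0 pA) ?mul0r//; apply/eqP; rewrite -[_ == _]negbK A0.
have Ai0 : 0 < A i i by rewrite lt_neqAle eq_sym Ai psd_diag_ge0.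
(* Schur complement with respect to the pivot A_ii. *)
pose A' := A - (A i i)^-1 *: ((row i A)^T *m row i A).
have [At _] := pA.
have Asym k l : A k l = A l k by rewrite -[in LHS]At mxE.
have A'E k l : A' k l = A k l - A i k * A i l / A i i.
  by rewrite !mxE big_ord1 !mxE; field.
have pA' : psd A'.
  split.
    by apply/matrixP => k l; rewrite mxE !A'E Asym; congr (_ - _); rewrite mulrAC [LHS]mulrC mulrA [_ / _]mulrC mulrC; ring.
  (* The minimizing s: [psd_quad] then states exactly that the form of [A'] is nonnegative at
     [u]. *)
  move=> u; have := psd_quad u i ((u *m A) ord0 i / A i i) pA.
  rewrite /A' mulmxBr mulmxBl [X in _ -> 0 <= X]mxE [X in _ -> 0 <= _ + X]mxE.
  rewrite -scalemxAr -scalemxAl [X in _ -> 0 <= _ - X]mxE.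
  have -> : (u *m ((row i A)^T *m row i A) *m u^T) ord0 ord0 = ((u *m A) ord0 i) ^+ 2.
    have -> : u *m ((row i A)^T *m row i A) *m u^T =
        (u *m (row i A)^T) *m (u *m (row i A)^T)^T.
      by rewrite trmx_mul trmxK !mulmxA.
    rewrite mxE big_ord1 [X in _ * X]mxE -expr2; congr (_ ^+ 2).
    by rewrite !mxE; apply: eq_bigr => k _; rewrite !mxE Asym.
  move=> h; apply: (le_trans h); rewrite le_eqVlt; apply/orP; left.
  by apply/eqP; field.
have -> : A = A' + (A i i)^-1 *: ((row i A)^T *m row i A) by rewrite subrK.
rewrite frobDl frobZl addr_ge0//; last first.
  apply: mulr_ge0; first by rewrite invr_ge0 ltW.
  by rewrite frobC frob_outer; case: pB => _ H; exact: H.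
apply: IH => //; apply: leq_trans cA; apply: proper_card; apply/properP; split.
  apply/fintype.subsetP => k; rewrite !inE; apply: contra => /eqP Ak.
  have Ak0 l : A k l = 0 by have /rowP/(_ l) := Ak; rewrite !mxE.
  by apply/eqP/rowP => l; rewrite [LHS]mxE A'E [RHS]mxE Ak0 [A i k]Asym Ak0 !mul0r subr0.
exists i; rewrite !inE.
  by apply: contra Ai => /eqP/rowP/(_ i); rewrite !mxE => ->.
by rewrite negbK; apply/eqP/rowP => l; rewrite [LHS]mxE A'E [RHS]mxE mulrC mulKf ?subrr.
Qed.

End psd.

(** * Pairings with semidefinite matrix measures *)

Section psd_measures.
Context {R : realType} {dd : measure_display} {S : measurableType dd}.
Variables (D : set S) (mD : measurable D).

Lemma pairingD m k (f g : S -> 'M[R]_(m, k)) mu :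
  (forall i j, bmeas D (fun p => f p i j)) -> (forall i j, bmeas D (fun p => g p i j)) ->
  pairing D (fun p => f p + g p) mu = pairing D f mu + pairing D g mu.
Proof.
move=> bf bg; rewrite /pairing -big_split; apply: eq_bigr => i _.
rewrite -big_split; apply: eq_bigr => j _ /=; rewrite -charge_intD//.
by apply: eq_charge_int => p _; rewrite mxE.
Qed.

Lemma pairingZ m k c (f : S -> 'M[R]_(m, k)) mu :
  (forall i j, bmeas D (fun p => f p i j)) ->
  pairing D (fun p => c *: f p) mu = c * pairing D f mu.
Proof.
move=> bf; rewrite /pairing mulr_sumr; apply: eq_bigr => i _.
rewrite mulr_sumr; apply: eq_bigr => j _ /=; rewrite -charge_intZ//.
by apply: eq_charge_int => p _; rewrite mxE.
Qed.

Lemma pairingN m k (f : S -> 'M[R]_(m, k)) mu :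
  (forall i j, bmeas D (fun p => f p i j)) ->
  pairing D (fun p => - f p) mu = - pairing D f mu.
Proof.
move=> bf; rewrite -mulN1r -pairingZ//; congr pairing.
by apply/funext => p; rewrite scaleN1r.
Qed.

Lemma pairingB m k (f g : S -> 'M[R]_(m, k)) mu :
  (forall i j, bmeas D (fun p => f p i j)) -> (forall i j, bmeas D (fun p => g p i j)) ->
  pairing D (fun p => f p - g p) mu = pairing D f mu - pairing D g mu.
Proof.
move=> bf bg; rewrite pairingD// ?pairingN// => i j.
by apply: bmeas_ext (bmeasN (bg i j)) => p _; rewrite mxE.
Qed.

Lemma eq_pairing m k (f g : S -> 'M[R]_(m, k)) mu :
  (forall p, D p -> f p = g p) -> pairing D f mu = pairing D g mu.
Proof.
move=> fg; apply: eq_bigr => i _; apply: eq_bigr => j _.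
by apply: eq_charge_int => p /fg ->.
Qed.

(** For a simple function with semidefinite values a_k on cells A_k the pairing is the sum of a_k :
    mu(A_k), nonnegative by [psd_frob_ge0]; the general case follows by uniform approximation. *)
Lemma pairing_psd_ge0 N (G : S -> 'M[R]_N) (mu : mx_charge S N N) :
  (forall i j, bmeas D (fun p => G p i j)) -> (forall p, D p -> psd (G p)) ->
  measure_ge0_on D (mass mu) -> 0 <= pairing D G mu.
Proof.
move=> bG pG mu0.
have /choice[C HC] : forall ij : 'I_N * 'I_N, exists C, 0 <= C /\
    forall f M, bmeas D f -> 0 <= M -> (forall p, D p -> `|f p| <= M) ->
    `|charge_int (mu ij.1 ij.2) D f| <= C * M.
  by move=> ij; have [C C0 H] := charge_int_bound (mu ij.1 ij.2) mD; exists C.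
set c := \sum_i \sum_j C (i, j).
have c0 : 0 <= c by apply: sumr_ge0 => i _; apply: sumr_ge0 => j _; case: (HC (i, j)).
suff H e : 0 < e -> - (c * e) <= pairing D G mu.
  apply/ler_addgt0Pl => e e0; have c1 : 0 < c + 1 by lra.
  have := H (e / (c + 1)) (divr_gt0 e0 c1).
  suff : c * (e / (c + 1)) <= e by lra.
  by rewrite mulrCA ler_piMr ?(ltW e0)// ler_pdivrMr// mul1r; lra.
move=> e0.
(* One grid for all entries at once, so that each nonempty cell carries an actual value of [G] and
   semidefiniteness survives the approximation. *)
have [K [A [mA AD A1 Ae]]] := bmeas_grid mD (fun ij : 'I_N * 'I_N => bG ij.1 ij.2) e0.
pose a k := if pselect (exists p, A k p) is left h then G (sval (cid h)) else 0.
pose G' p := \sum_k \1_(A k) p *: a k.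
have bG' i j : bmeas D (fun p => G' p i j).
  have : bmeas D (fun p => \sum_k a k i j * \1_(A k) p).
    by apply: bmeas_sum => k; apply: bmeasZ; exact: bmeas_indic.
  apply: bmeas_ext => p _; rewrite summxE.
  by apply: eq_bigr => k _; rewrite mxE mulrC.
have G'0 : 0 <= pairing D G' mu.
  have -> : pairing D G' mu = \sum_k frob (a k) (mass mu (A k)).
    transitivity (\sum_i \sum_j \sum_k a k i j * fine (mu i j (A k))).
      apply: eq_bigr => i _; apply: eq_bigr => j _.
      transitivity (charge_int (mu i j) D (fun p => \sum_k a k i j * \1_(A k) p)).
        apply: eq_charge_int => p _; rewrite summxE.
        by apply: eq_bigr => k _; rewrite mxE mulrC.
      rewrite charge_int_sum//; last by move=> k; apply: bmeasZ; exact: bmeas_indic.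
      apply: eq_bigr => k _; rewrite charge_intZ ?charge_int_indic//; last exact: bmeas_indic.
      by rewrite (setIidl (AD k)).
    under eq_bigr do rewrite exchange_big/=.
    rewrite exchange_big/=; apply: eq_bigr => k _; apply: eq_bigr => i _.
    by apply: eq_bigr => j _; rewrite mxE.
  apply: sumr_ge0 => k _; apply: psd_frob_ge0; last exact: mu0.
  rewrite /a; case: pselect => [h|_].
    by case: cid => p Ap /=; apply: pG; exact: AD Ap.
  by split; [rewrite trmx0|move=> u; rewrite mulmx0 mul0mx mxE].
have GG' p i j : D p -> `|G p i j - G' p i j| <= e.
  move=> Dp; rewrite summxE -[X in `|X - _|]mul1r -(A1 _ Dp) mulr_suml -sumrB.
  rewrite (le_trans (ler_norm_sum _ _ _))//.
  rewrite -[leRHS]mulr1 -(A1 _ Dp) mulr_sumr; apply: ler_sum => k _.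
  rewrite mxE -mulrBr normrM mulrC [X in _ * X]ger0_norm; last by rewrite indicE.
  rewrite indicE; case: (boolP (p \in A k)); rewrite ?mulr0// !mulr1 inE => Ap.
  rewrite /a; case: pselect => [h|]; last by case; exists p.
  by case: cid => q Aq /=; exact: (Ae k p q Ap Aq (i, j)).
suff : `|pairing D G mu - pairing D G' mu| <= c * e.
  by rewrite ler_norml => /andP[]; lra.
rewrite -pairingB// /pairing (le_trans (ler_norm_sum _ _ _))// mulr_suml.
apply: ler_sum => i _; rewrite (le_trans (ler_norm_sum _ _ _))// mulr_suml.
apply: ler_sum => j _; have [_] := HC (i, j); apply => //=; first last.
- by move=> p Dp; rewrite !mxE GG'.
- exact: ltW.
- by apply: bmeas_ext (bmeasB (bG i j) (bG' i j)) => p _; rewrite !mxE.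
Qed.

End psd_measures.

(** * Borel sets and continuous functions on the cylinder *)

Section borel.
Context {R : realType} {d : nat}.
Local Notation space := 'rV[R]_d.
Local Notation spacetime := (R * 'rV[R]_d)%type.

Lemma measurable_coord (i : 'I_d) : measurable_fun setT (fun x : space => x ord0 i).
Proof.
move=> _ C mC; rewrite setTI; apply: sub_sigma_algebra.
rewrite -bigcup_seq/=; exists i => /=; first by rewrite mem_index_enum.
by exists C => //; rewrite setTI.
Qed.

Lemma ball_spacetime (p q : spacetime) e : 0 < e -> `|p.1 - q.1| < e ->
  (forall i, `|p.2 ord0 i - q.2 ord0 i| < e) -> ball p e q.
Proof.
move=> e0 h1 h2; split; first exact: h1.
by split=> // i j; rewrite (ord1 i); exact: h2.
Qed.

(** An open set is a countable union of boxes with rational centres and radii, and such boxes lie in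
    the product sigma-algebra generated by the coordinates. *)
Lemma open_spacetime_measurable (U : set spacetime) : open U -> measurable U.
Proof.
move=> oU.
pose I := (rat * {ffun 'I_d -> rat} * rat)%type.
pose box (q : I) : set spacetime :=
  (fst @^-1` ball (ratr q.1.1 : R) (ratr q.2 : R)) `&`
  \bigcap_(i in [set: 'I_d]) (snd @^-1`
    ((fun x : space => x ord0 i) @^-1` ball (ratr (q.1.2 i) : R) (ratr q.2 : R))).
have mbox q : measurable (box q).
  apply: measurableI.
    rewrite -[X in measurable X]setTI; apply: measurable_fst => //.
    exact: measurable_ball.
  apply: fin_bigcap_measurable => [|i _]; first exact: finite_finset.
  rewrite -[X in measurable X]setTI; apply: measurable_snd => //.
  rewrite -[X in measurable X]setTI; apply: measurable_coord => //.
  exact: measurable_ball.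
pose F (q : I) := if pselect (box q `<=` U) then box q else set0.
suff -> : U = \bigcup_q F q.
  apply: countable_bigcupT_measurable; first exact: countableP.
  by move=> q; rewrite /F; case: pselect => h; [exact: mbox|exact: measurable0].
apply/seteqP; split; last first.
  by move=> p [q _]; rewrite /F; case: pselect => // qU /qU.
move=> p Up; have /nbhs_ballP[e /= e0 eU] : nbhs p U by exact: open_nbhs_nbhs.
have e20 : 0 < e / 2 by rewrite divr_gt0.
(* The centre lies within r of [p] and the box has radius r, so its points are within 2 r < e of
   [p]. *)
have [r] := rat_in_itvoo e20; rewrite in_itv/= => /andP[r0 re].
have near (x : R) : exists q : rat, `|ratr q - x| < ratr r.
  have xr : x - ratr r < x + ratr r by lra.
  have [q] := rat_in_itvoo xr.
  rewrite in_itv/= => /andP[a b]; exists q.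
  by rewrite ltr_norml; apply/andP; split; lra.
have [q1 Hq1] := near p.1.
have /choice[q2 Hq2] := fun i => near (p.2 ord0 i).
pose q : I := (q1, [ffun i => q2 i], r).
exists q => //; rewrite /F.
have Bp : box q p.
  split; first exact: Hq1.
  by move=> i _; rewrite /= ffunE; exact: Hq2.
case: pselect => // nU; exfalso; apply: nU => p' [/= h1 h2]; apply: eU.
apply: ball_spacetime => //.
  by move: Hq1 h1; rewrite /ball/= !ltr_norml => /andP[? ?] /andP[? ?];
     apply/andP; split; lra.
move=> i; have := Hq2 i; have := h2 i Logic.I.
by rewrite /= ffunE /ball/= !ltr_norml => /andP[? ?] /andP[? ?]; apply/andP; split; lra.
Qed.

Lemma within_continuous_measurable (D E : set spacetime) (f : spacetime -> R) :
  measurable D -> D `<=` E -> {within E, continuous f} -> measurable_fun D f.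
Proof.
move=> mD DE cf; apply: (measurability _ (RGenOpens.measurableE R)).
move=> _ [_ [a [b ->] <-]].
have /continuousP/(_ `]a, b[%classic (@interval_open _ (BRight a) (BLeft b) isT isT)) := cf.
move=> /open_subspaceP[V oV VE].
have -> : D `&` f @^-1` `]a, b[ = D `&` V.
  apply/seteqP; split => p [Dp Hp]; split=> //.
    have : (f @^-1` `]a, b[%classic `&` E) p by split => //; exact: DE.
    by rewrite -VE => -[].
  have : (V `&` E) p by split => //; exact: DE.
  by rewrite VE => -[].
by apply: measurableI => //; exact: open_spacetime_measurable.
Qed.

Lemma measurable_unit_cube : measurable (unit_cube : set space).
Proof.
rewrite (_ : unit_cube = \bigcap_(i in [set: 'I_d])
   ((fun x : space => x ord0 i) @^-1` `[0, 1[%classic)).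
  apply: fin_bigcap_measurable => [|i _]; first exact: finite_finset.
  by rewrite -[X in measurable X]setTI; apply: measurable_coord.
apply/seteqP; split => x /= h i; last by have := h i Logic.I; rewrite /= in_itv.
by move=> _; rewrite /= in_itv /=; exact: h.
Qed.

Lemma measurable_cylinder (T : R) : measurable (cylinder T : set spacetime).
Proof. by apply: measurableX => //; exact: measurable_unit_cube. Qed.

Lemma cylinder_strip (T : R) : cylinder T `<=` (strip T : set spacetime).
Proof. by move=> p [/=]; rewrite in_itv. Qed.

Lemma compact_unit_box : compact [set x : space | forall i, 0 <= x ord0 i <= 1].
Proof.
have := @rV_compact R d (fun=> `[0, 1]%classic) (fun=> @segment_compact R 0 1).
congr compact; apply/seteqP; split => x /= h i; have := h i; rewrite in_itv//.
Qed.

(** A compact set between the half-open [cylinder] and the spatially unbounded [strip]; bounds on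
    continuous functions are taken here. *)
Definition closed_cylinder (T : R) : set spacetime :=
  `[0, T]%classic `*` [set x : space | forall i, 0 <= x ord0 i <= 1].

Lemma closed_cylinder_strip T : closed_cylinder T `<=` strip T.
Proof. by move=> p [/=]; rewrite in_itv. Qed.

Lemma cylinder_closed_cylinder T : cylinder T `<=` closed_cylinder T.
Proof. by move=> p [/= h c]; split => //= i; have /andP[-> /ltW] := c i. Qed.

Lemma compact_closed_cylinder T : compact (closed_cylinder T).
Proof.
by apply: compact_setX; [exact: segment_compact|exact: compact_unit_box].
Qed.

Lemma within_continuous_bounded T (f : spacetime -> R) :
  {within strip T, continuous f} ->
  exists M, forall p, closed_cylinder T p -> `|f p| <= M.
Proof.
move=> /(continuous_subspaceW (@closed_cylinder_strip T)) cf.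
have /compact_bounded[M [_ HM]] := continuous_compact cf (@compact_closed_cylinder T).
exists (M + 1) => p Dp; apply: (HM (M + 1)); first by rewrite ltrDl.
by exists p.
Qed.

Lemma continuous_bmeas T (f : spacetime -> R) :
  {within strip T, continuous f} -> bmeas (cylinder T) f.
Proof.
move=> cf; split.
  by apply: within_continuous_measurable cf;
    [exact: measurable_cylinder|exact: cylinder_strip].
have [M HM] := within_continuous_bounded cf.
by exists M => p /cylinder_closed_cylinder; exact: HM.
Qed.

Lemma continuous_entry (X : topologicalType) m k (f : X -> 'M[R]_(m, k)) i j :
  continuous f -> continuous (fun p => f p i j).
Proof.
move=> cf p; apply: (@continuous_comp _ _ _ f (fun M : 'M[R]_(m, k) => M i j)).
  exact: cf.
exact: coord_continuous.
Qed.

Lemma CTX_bmeas T m k (f : spacetime -> 'M[R]_(m, k)) i j :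
  CTX T m k f -> bmeas (cylinder T) (fun p => f p i j).
Proof.
move=> [cf _]; apply: continuous_bmeas.
exact: (@continuous_entry (subspace (strip T)) _ _ f).
Qed.

Lemma within_continuous_glue T (f : spacetime -> R) :
  (forall p, strip T p -> {for p, continuous f}) -> {within strip T, continuous f}.
Proof.
move=> cf; apply/subspace_continuousP => p Sp.
by apply: cvg_trans (cf p Sp); apply: cvg_app; exact: cvg_within.
Qed.

Lemma Leb_cylinder_fin T : (Leb (cylinder T : set spacetime) < +oo)%E.
Proof.
rewrite /Leb /cylinder product_measure1E//; last exact: measurable_unit_cube.
apply: lte_mul_pinfty => //.
  rewrite fin_numElt (lt_le_trans _ (measure_ge0 _ _))//.
  by rewrite [X in (X < _)%E]lebesgue_measure_itv/=; case: ifP => //; rewrite ltry.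
by rewrite -ge0_fin_numE// fin_num_measure//; exact: measurable_unit_cube.
Unshelve. all: by []. Qed.

Lemma continuous_torus_bmeas (f : space -> R) : continuous f -> bmeas unit_cube f.
Proof.
(* A function of x is viewed on the degenerate strip t = 0, where the spacetime results apply. *)
move=> cf; have c2 : {within strip (0 : R), continuous (fun p : spacetime => f p.2)}.
  apply: continuous_subspaceT => p.
  by apply: continuous_comp; [exact: cvg_snd|exact: cf].
have mp : measurable_fun setT (fun x : space => (0 : R, x)) by exact: measurable_pair1.
have [m1 [M HM]] := continuous_bmeas c2.
split; last first.
  exists M => x Cx; apply: (HM (0, x)); split => //=.
  by rewrite in_itv/= lexx.
apply: (@measurable_comp _ _ _ _ _ _ (cylinder 0) (fun p : spacetime => f p.2) _
  (fun x => (0, x))) => //.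
- exact: measurable_cylinder.
- by move=> _ [x Cx <-]; split => //=; rewrite in_itv/= lexx.
- exact: measurable_funTS.
Qed.

Lemma torus_cube_fin : (torus_measure d (unit_cube : set space) < +oo)%E.
Proof.
by rewrite -ge0_fin_numE// fin_num_measure//; exact: measurable_unit_cube.
Qed.

End borel.

(** * Smooth functions *)

Section smooth_functions.
Context {R : realType}.

(** Coinductive form of smoothness: a class of continuous, differentiable functions that is stable
    under directional derivatives contains all iterated derivatives of its members. *)
Lemma smooth_class (W V : normedModType R) (C : (W -> V) -> Prop) :
  (forall f, C f -> [/\ continuous f, forall p w, derivable f p w &
    forall w, C (fun p => 'D_w f p)]) -> forall f, C f -> smooth f.
Proof.
move=> HC f Cf s; suff /HC[] : C (iter_derive s f) by [].
by elim: s => //= w s /HC[].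
Qed.

Lemma is_derive_cvg (W V : normedModType R) (f : W -> V) a w l :
  h^-1 *: (f (h *: w + a) - f a) @[h --> (0 : R)^'] --> l -> is_derive a w f l.
Proof.
move=> fl; apply: DeriveDef; first exact: (cvgP _ fl).
exact: (cvg_lim _ fl).
Qed.

Lemma is_derive_along (f : R -> R) (p w df : R) :
  is_derive p 1 f df -> is_derive p w f (w * df).
Proof.
move=> [df1 Df]; have dp : differentiable f p by exact/derivable1_diffP.
apply: DeriveDef; first exact: diff_derivable.
by rewrite deriveE// -Df deriveE// -[in LHS](mulr1 w) linearZ.
Qed.

Lemma is_derive_mx (W : normedModType R) m k (f : W -> 'M[R]_(m, k)) a w (df : 'M[R]_(m, k)) :
  (forall i j, is_derive a w (fun x => f x i j) (df i j)) -> is_derive a w f df.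
Proof.
move=> H; have df' : derivable f a w by apply/derivable_mxP => i j; case: (H i j).
apply: DeriveDef => //; rewrite derive_mx//; apply/matrixP => i j; rewrite mxE.
by case: (H i j).
Qed.

Lemma is_derive_scalemx (W : normedModType R) m k (c : W -> R) dc
    (f : W -> 'M[R]_(m, k)) a w :
  is_derive a w c dc -> derivable f a w ->
  is_derive a w (fun x => c x *: f x) (dc *: f a + c a *: 'D_w f a).
Proof.
move=> Hc Hf; apply: is_derive_mx => i j.
have Hfij : derivable (fun x => f x i j) a w by move/derivable_mxP : Hf.
have -> : (fun x => (c x *: f x) i j) = c * (fun x => f x i j).
  by apply/funext => x; rewrite mxE.
have D := is_deriveM Hc (derivableP Hfij); apply: (is_derive_eq D).
by rewrite derive_mx// !mxE /GRing.scale/=; ring.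
Qed.

Lemma iter_derive_rcons (W V : normedModType R) s w (f : W -> V) :
  iter_derive (rcons s w) f = iter_derive s (fun p => 'D_w f p).
Proof. by elim: s => //= v s ->. Qed.

Lemma smooth_derive (W V : normedModType R) w (f : W -> V) :
  smooth f -> smooth (fun p => 'D_w f p).
Proof. by move=> sf s; have := sf (rcons s w); rewrite iter_derive_rcons. Qed.

Lemma smooth_continuous (W V : normedModType R) (f : W -> V) :
  smooth f -> continuous f.
Proof. by move=> /(_ [::])[]. Qed.

Lemma smooth_derivable (W V : normedModType R) (f : W -> V) p w :
  smooth f -> derivable f p w.
Proof. by move=> /(_ [::])[_]; exact. Qed.

(** * Polynomials in time multiplied by smooth functions *)

Section time_polynomials.
Variables (d m k : nat).
Local Notation spacetime := (R * 'rV[R]_d)%type.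

Lemma is_derive_fst (p w : spacetime) :
  is_derive p w (fst : spacetime -> R) w.1.
Proof.
apply: is_derive_cvg; apply: cvg_near_cst; near=> h.
have h0 : h != 0 by near: h; exact: nbhs_dnbhs_neq.
by rewrite /= addrK scalerA mulVf ?scale1r.
Unshelve. all: by end_near. Qed.

Lemma is_derive_horner_fst (q : {poly R}) (p w : spacetime) :
  is_derive p w (fun p : spacetime => q.[p.1]) (w.1 * q^`().[p.1]).
Proof.
elim/poly_ind: q => [|q c IH].
  rewrite deriv0 horner0 mulr0 (_ : (fun p => _) = cst 0).
    exact: is_derive_cst.
  by apply/funext => x; rewrite horner0.
have -> : (fun p : spacetime => (q * 'X + c%:P).[p.1]) =
    (fun p : spacetime => q.[p.1]) * (fst : spacetime -> R) + cst c.
  by apply/funext => x; rewrite !hornerE.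
have F := is_derive_fst p w.
have Dq := is_deriveD (is_deriveM IH F) (is_derive_cst c p w).
apply: (is_derive_eq Dq).
rewrite derivD derivC addr0 derivM derivX mulr1 !hornerE.
by rewrite /GRing.scale/=; ring.
Qed.

(** The Leibniz rule turns a derivative of q(t) phi into a sum of two such products; adding sums
    makes the class stable under differentiation, as [smooth_class] requires. *)
Inductive time_poly_span : (spacetime -> 'M[R]_(m, k)) -> Prop :=
| Time_poly_scale (q : {poly R}) phi : smooth phi ->
    time_poly_span (fun p => q.[p.1] *: phi p)
| Time_poly_add f g : time_poly_span f -> time_poly_span g ->
    time_poly_span (fun p => f p + g p).

Lemma is_derive_scale (q : {poly R}) (phi : spacetime -> 'M[R]_(m, k)) p w :
  derivable phi p w ->
  is_derive p w (fun p => q.[p.1] *: phi p)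
    ((w.1 * q^`().[p.1]) *: phi p + q.[p.1] *: 'D_w phi p).
Proof. by move=> dphi; apply: is_derive_scalemx => //; exact: is_derive_horner_fst. Qed.

Lemma continuous_scale_time (q : {poly R}) (phi : spacetime -> 'M[R]_(m, k)) :
  continuous phi -> continuous (fun p => q.[p.1] *: phi p).
Proof.
move=> cphi p; apply: (@cvgZ _ _ _ _ _ (fun p : spacetime => q.[p.1]) phi).
  apply: (@continuous_comp _ _ _ fst (horner q)); first exact: cvg_fst.
  exact: continuous_horner.
exact: cphi.
Qed.

Lemma smooth_time_poly (q : {poly R}) (phi : spacetime -> 'M[R]_(m, k)) :
  smooth phi -> smooth (fun p => q.[p.1] *: phi p).
Proof.
move=> sphi; apply: (@smooth_class _ _ time_poly_span); last exact: Time_poly_scale.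
move=> f; elim=> {q phi sphi f} [q phi sphi|f g _ [cf df Df] _ [cg dg Dg]].
- split.
  + exact: continuous_scale_time (smooth_continuous sphi).
  + by move=> p w; case: (is_derive_scale q (smooth_derivable (p := p) (w := w) sphi)).
  + move=> w.
    rewrite (_ : (fun p => 'D_w (fun r : spacetime => q.[r.1] *: phi r) p) =
        (fun p : spacetime => (w.1 *: q^`()).[p.1] *: phi p + q.[p.1] *: 'D_w phi p)).
      exact (Time_poly_add (Time_poly_scale (w.1 *: q^`()) sphi)
        (Time_poly_scale q (smooth_derive w sphi))).
    apply/funext => p; rewrite hornerZ.
    by case: (is_derive_scale q (smooth_derivable (p := p) (w := w) sphi)).
- split.
  + by move=> p; apply: cvgD; [exact: cf|exact: cg].
  + by move=> p w; exact: derivableD (df p w) (dg p w).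
  + move=> w; rewrite (_ : (fun p => _) = (fun p => 'D_w f p + 'D_w g p)).
      exact: Time_poly_add.
    by apply/funext => p; rewrite -deriveD.
Qed.

Lemma smooth_in_time_poly (q : {poly R}) X (phi : spacetime -> 'M[R]_(m, k)) :
  (forall a f, X f -> X (fun x => a *: f x)) ->
  smooth_in X phi -> smooth_in X (fun p => q.[p.1] *: phi p).
Proof.
move=> XZ [sphi Xphi]; split; first exact: smooth_time_poly.
by move=> t; exact: (XZ q.[t] _ (Xphi t)).
Qed.

Lemma dt_time_poly (q : {poly R}) (phi : spacetime -> 'M[R]_(m, k)) p :
  smooth phi -> dt (fun p => q.[p.1] *: phi p) p =
    q^`().[p.1] *: phi p + q.[p.1] *: dt phi p.
Proof.
move=> sphi; rewrite -[q^`().[p.1]]mul1r.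
by case: (is_derive_scale q (smooth_derivable (p := p) (w := (1, 0)) sphi)).
Qed.

End time_polynomials.

Lemma CXZ d m k a (f : 'rV[R]_d -> 'M[R]_(m, k)) : CX m k f -> CX m k (fun x => a *: f x).
Proof.
move=> [cf pf]; split; last by move=> x i; rewrite pf.
by move=> x; apply: (@continuous_comp _ _ _ f (fun M => a *: M)); [exact: cf|exact: scaler_continuous].
Qed.

Lemma CX_symZ d N a (f : 'rV[R]_d -> 'M[R]_N) : CX_sym N f -> CX_sym N (fun x => a *: f x).
Proof.
move=> [cf sf]; split; first exact: CXZ.
by move=> x; rewrite linearZ/= sf.
Qed.

Lemma weight_exp (T gamma : R) : 0 < T -> 0 < gamma -> weight T (exp_weight gamma).
Proof.
move=> T0 g0; split.
  (* Multiples of the exponential are stable under derivatives; a direction [w] only changes the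
     factor. *)
  pose C (f : R -> R^o) := exists a : R, f = fun t => a * expR (- gamma * t).
  apply: (@smooth_class _ _ C); last by exists 1; apply/funext => t; rewrite mul1r.
  move=> _ [a ->].
  have H (p w : R) : is_derive p w (fun t => a * expR (- gamma * t))
      (w * (a * - gamma) * expR (- gamma * p)).
    have E := @is_derive1_comp R expR (fun t => - gamma * t) p _ _ (is_derive_expR _)
      (is_deriveZ (- gamma) (is_derive_id p 1)).
    have D := is_derive_along w (is_deriveZ a E).
    by apply: (is_derive_eq D); rewrite /GRing.scale /= mulr1; ring.
  split.
  - move=> t; apply: differentiable_continuous; apply/derivable1_diffP.
    by case: (H t 1).
  - by move=> p w; have [] := H p w.
  - by move=> w; exists (w * (a * - gamma)); apply/funext => p; have [_ ->] := H p w.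
exists (expR (- gamma * T)), 1; split; first exact: expR_gt0.
move=> t /andP[t0 tT]; rewrite /exp_weight -[X in _ && (_ <= X)]expR0 !ler_expR.
by rewrite !mulNr lerN2 ler_pM2l// tT oppr_le0 mulr_ge0// ltW.
Qed.

End smooth_functions.

(** * Bernstein approximation *)

Ltac nonzero :=
  repeat (apply/andP; split); rewrite ?nat1r ?natr1 ?pnatr_eq0 ?gt_eqF //.

Section bernstein.
Context {R : realType}.
Implicit Types (a b : nat -> R) (t : R).

(* De Casteljau's recursion for the Bernstein polynomial with control values
   a 0, ..., a k. *)
Fixpoint bern k a : {poly R} :=
  if k is k'.+1 then (1 - 'X) * bern k' a + 'X * bern k' (fun j => a j.+1)
  else (a 0)%:P.

Lemma eq_bern k a b : (forall j, a j = b j) -> bern k a = bern k b.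
Proof. by move=> ab; congr bern; apply/funext. Qed.

Lemma bernS k a t :
  (bern k.+1 a).[t] = (1 - t) * (bern k a).[t] + t * (bern k (fun j => a j.+1)).[t].
Proof. by rewrite /= !hornerE. Qed.

Lemma bernD k a b : bern k (fun j => a j + b j) = bern k a + bern k b.
Proof. by elim: k a b => [|k IH] a b /=; rewrite ?polyCD// !IH; ring. Qed.

Lemma bernZ k c a : bern k (fun j => c * a j) = c *: bern k a.
Proof.
elim: k a => [|k IH] a /=; first by rewrite polyCM mul_polyC.
by rewrite !IH scalerDr !scalerAr.
Qed.

Lemma bernB k a b : bern k (fun j => a j - b j) = bern k a - bern k b.
Proof.
rewrite bernD; congr (_ + _); rewrite -scaleN1r -bernZ.
by apply: eq_bern => j; rewrite mulN1r.
Qed.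

Lemma bern_cst k c t : (bern k (fun=> c)).[t] = c.
Proof. by elim: k => [|k IH]; rewrite ?hornerC// bernS IH; ring. Qed.

(** On [0, 1] each step of the recursion is a convex combination, so the Bernstein operator is
    monotone. *)
Lemma bern_le k a b t : 0 <= t <= 1 -> (forall j, (j <= k)%N -> a j <= b j) ->
  (bern k a).[t] <= (bern k b).[t].
Proof.
move=> /andP[t0 t1]; elim: k a b => [|k IH] a b ab; first by rewrite !hornerC ab.
rewrite !bernS lerD// ler_wpM2l//; first by rewrite subr_ge0.
  by apply: IH => j jk; apply: ab; exact: leqW.
by apply: IH => j jk; apply: ab.
Qed.

Lemma bern_norm k a t : 0 <= t <= 1 ->
  `|(bern k a).[t]| <= (bern k (fun j => `|a j|)).[t].
Proof.
move=> t01; rewrite ler_norml; apply/andP; split.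
  rewrite -hornerN -scaleN1r -bernZ; apply: bern_le => // j _.
  by rewrite mulN1r lerNl -normrN ler_norm.
by apply: bern_le => // j _; exact: ler_norm.
Qed.

(** The second moment about [c] of the binomial law with parameters k and t; it plays the part of
    Chebyshev's inequality in the approximation. *)
Lemma bern_var k c t :
  (bern k (fun j => (j%:R - c) ^+ 2)).[t] = (k%:R * t - c) ^+ 2 + k%:R * t * (1 - t).
Proof.
elim: k c => [|k IH] c; first by rewrite hornerC !mul0r addr0.
rewrite bernS IH (@eq_bern _ _ (fun j => (j%:R - (c - 1)) ^+ 2)).
  by rewrite IH -natr1; ring.
by move=> j; rewrite -natr1; ring.
Qed.

Lemma deriv_bern k a :
  (bern k.+1 a)^`() = k.+1%:R *: bern k (fun j => a j.+1 - a j).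
Proof.
elim: k a => [|k IH] a.
  rewrite /= !derivD !derivM !derivC !derivB !derivX derivC scale1r polyCB; ring.
have -> : bern k.+2 a = (1 - 'X) * bern k.+1 a + 'X * bern k.+1 (fun j => a j.+1) by [].
rewrite derivD !derivM derivB derivX derivC !IH.
have -> : bern k.+1 (fun j => a j.+1 - a j) =
  (1 - 'X) * bern k (fun j => a j.+1 - a j) +
  'X * bern k (fun j => a j.+2 - a j.+1) by [].
have H : bern k.+1 (fun j => a j.+1) - bern k.+1 a =
  (1 - 'X) * bern k (fun j => a j.+1 - a j) +
  'X * bern k (fun j => a j.+2 - a j.+1) by rewrite -bernB.
rewrite -[k.+2%:R]natr1 scalerDl scale1r -[in X in _ = _ + X]H scalerDr !scalerAr.
ring.
Qed.

Section approximation.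
Variables (T C : R) (g : R -> R).
Hypotheses (T0 : 0 < T)
  (gC : forall s1 s2, 0 <= s1 <= T -> 0 <= s2 <= T -> `|g s1 - g s2| <= C * `|s1 - s2|).

(** The grid has n + 1 steps so that the mesh T / (n + 1) makes sense for every n. *)
Let node n j := T * j%:R / n.+1%:R.
Let G n := bern n.+1 (fun j => g (node n j)) \Po (T^-1 *: 'X).

Let GE n t : (G n).[t] = (bern n.+1 (fun j => g (node n j))).[t / T].
Proof. by rewrite horner_comp hornerZ hornerX mulrC. Qed.

(** The derivative is a Bernstein polynomial, of degree n, whose control values are the slopes of
    [g] between consecutive nodes. The uniform bound and the limit of the derivatives are read off
    from it. *)
Let dGE n t : (G n)^`().[t] =
  (bern n (fun j => n.+1%:R / T * (g (node n j.+1) - g (node n j)))).[t / T].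
Proof.
rewrite deriv_comp hornerM horner_comp hornerZ hornerX [T^-1 * t]mulrC derivZ derivX.
rewrite hornerZ hornerC mulr1 deriv_bern bernZ !hornerZ.
by rewrite mulrAC.
Qed.

Let node_itv n j : (j <= n.+1)%N -> 0 <= node n j <= T.
Proof.
move=> jn; rewrite /node; apply/andP; split.
  by rewrite divr_ge0// mulr_ge0// ltW.
by rewrite ler_pdivrMr// ler_pM2l// ler_nat.
Qed.

Let scaled t : 0 <= t <= T -> 0 <= t / T <= 1.
Proof.
by move=> /andP[t0 tT]; rewrite divr_ge0// ?(ltW T0)// ler_pdivrMr// mul1r.
Qed.

Let C0 : 0 <= C.
Proof.
have := @gC 0 T; rewrite !lexx (ltW T0) => /(_ isT isT).
rewrite sub0r normrN (gtr0_norm T0) => h.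
by rewrite -(pmulr_lge0 _ T0); exact: le_trans h.
Qed.

Let dnode n j : (j <= n)%N ->
  `|n.+1%:R / T * (g (node n j.+1) - g (node n j))| <= C.
Proof.
move=> jn; have nT : 0 < n.+1%:R / T by rewrite divr_gt0.
rewrite normrM gtr0_norm// -ler_pdivlMl//.
have := gC (node_itv (n := n) (j := j.+1) jn) (node_itv (leqW jn)).
have -> : node n j.+1 - node n j = T / n.+1%:R.
  by rewrite /node -[j.+1%:R]natr1; field; nonzero.
rewrite [X in _ * X]gtr0_norm ?divr_gt0// => h; apply: (le_trans h).
by rewrite invf_div mulrC.
Qed.

(** The last clause assumes strict differentiability at t, with slopes between any two nearby
    points, because the derivative averages slopes over node intervals that need not contain t. *)
Lemma bernstein_approximation : exists (P : nat -> {poly R}) (M : R),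
  [/\ forall n t, 0 <= t <= T -> `|(P n).[t]| <= M,
      forall n t, 0 <= t <= T -> `|(P n)^`().[t]| <= M,
      forall t, 0 <= t <= T -> (P n).[t] @[n --> \oo] --> g t &
      forall t l, 0 <= t <= T ->
        (forall e, 0 < e -> exists2 r, 0 < r & forall s1 s2,
          0 <= s1 <= T -> 0 <= s2 <= T -> s1 < s2 -> `|s1 - t| < r -> `|s2 - t| < r ->
          `|g s2 - g s1 - l * (s2 - s1)| <= e * (s2 - s1)) ->
        (P n)^`().[t] @[n --> \oo] --> l].
Proof.
exists G, (`|g 0| + C * T + C); split.
- move=> n t tT; rewrite GE (le_trans (bern_norm _ _ (scaled tT)))//.
  rewrite -[leRHS](bern_cst n.+1 _ (t / T)); apply: bern_le; first exact: scaled.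
  move=> j jn; have := gC (node_itv jn) (s2 := 0); rewrite lexx (ltW T0) => /(_ isT).
  rewrite subr0 [`|node _ _|]ger0_norm; last by case/andP: (node_itv jn).
  have := ler_wpM2l C0 (proj2 (andP (node_itv jn))).
  have := ler_normD (g (node n j) - g 0) (g 0); rewrite subrK; have := C0; lra.
- move=> n t tT; rewrite dGE (le_trans (bern_norm _ _ (scaled tT)))//.
  rewrite -[leRHS](bern_cst n _ (t / T)); apply: bern_le; first exact: scaled.
  move=> j jn; have := dnode jn; have := mulr_ge0 C0 (ltW T0).
  have := normr_ge0 (g 0); lra.
- move=> t tT; apply/cvgrPdist_le => e e0.
  (* A positive [K] is needed as a divisor even when [C] is 0. *)
  have [K K0 KC] : exists2 K, 0 < K & C * T <= K.
    by exists (C * T + 1); rewrite ?ltr_wpDl ?mulr_ge0 ?(ltW T0)// lerDl.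
  pose e1 := e / (2 * K); have e10 : 0 < e1 by rewrite divr_gt0// mulr_gt0.
  have e2 : 0 < e1 ^+ 2 by rewrite exprn_gt0.
  have d0 : 0 < e / 2 / (K / e1) by exact: (divr_gt0 (divr_gt0 e0 (ltr0n R 2)) (divr_gt0 K0 e10)).
  near=> n; rewrite GE -normrN opprB.
  rewrite -[X in _ - X](bern_cst n.+1 _ (t / T)) -hornerN -hornerD -bernB.
  rewrite (le_trans (bern_norm _ _ (scaled tT)))//.
  (* With y = j / (n + 1) - t / T, the deviation K |y| is at most K (e1 + y^2 / e1). This majorant
     is quadratic in j, so [bern_var] averages it exactly, to e / 2 plus a term of order 1 / n. *)
  pose a0 j : R := K * e1 + K / e1 / n.+1%:R ^+ 2 * (j%:R - n.+1%:R * (t / T)) ^+ 2.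
  apply: (@le_trans _ _ (bern n.+1 a0).[t / T]).
    apply: bern_le; first exact: scaled.
    move=> j jn; rewrite (le_trans (gC (node_itv jn) tT))// /a0.
    set y := j%:R / n.+1%:R - t / T.
    have -> : node n j - t = T * y by rewrite /node /y; field; nonzero.
    have -> : K / e1 / n.+1%:R ^+ 2 * (j%:R - n.+1%:R * (t / T)) ^+ 2 = K / e1 * y ^+ 2.
      rewrite /y; field; nonzero.
    rewrite normrM (gtr0_norm T0) mulrA (le_trans (ler_wpM2r _ KC))//.
    rewrite -mulrA -mulrDr ler_pM2l//.
    have -> : y ^+ 2 = `|y| ^+ 2 by rewrite real_normK// num_real.
    rewrite [_^-1 * _]mulrC -(ler_pM2r e10) mulrDl divfK ?gt_eqF//.
    by have := sqr_ge0 (e1 - `|y|); have := sqr_ge0 `|y|; have := sqr_ge0 e1; nra.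
  rewrite /a0 bernD hornerD bern_cst bernZ hornerZ bern_var subrr expr0n/= add0r.
  have tt : t / T * (1 - t / T) <= 1 by have := scaled tT; nra.
  apply: (@le_trans _ _ (K * e1 + K / e1 / n.+1%:R)).
    rewrite lerD2l [leLHS](_ : _ = K / e1 / n.+1%:R * (t / T * (1 - t / T))).
      by apply: ler_piMr => //; rewrite divr_ge0 // divr_ge0 ?ltW.
    by field; nonzero.
  have -> : K * e1 = e / 2 by rewrite /e1; field; nonzero.
  rewrite [leRHS]splitr lerD2l.
  have ne : n.+1%:R^-1 < e / 2 / (K / e1).
    by near: n; exact: (near_infty_natSinv_lt (PosNum d0)).
  rewrite -ler_pdivlMl; last exact: (divr_gt0 K0 e10).
  by rewrite [leRHS]mulrC; exact: ltW.
- move=> t l tT Hl; apply/cvgrPdist_le => e e0.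
  have [r r0 Hr] := Hl _ (divr_gt0 e0 (ltr0n _ 2)).
  pose K := C + `|l|; have K0 : 0 <= K by rewrite addr_ge0.
  (* For nodes at distance at least r / 2 from t, [Q] makes the quadratic term Q y^2 / T^2 exceed
     [K], the crude bound on slope minus [l]; nearer nodes are handled by the error e / 2. *)
  pose Q := K * (2 * T / r) ^+ 2 + 1.
  have Q0 : 0 < Q by rewrite ltr_wpDl// mulr_ge0// sqr_ge0.
  have d1 : 0 < T^-1 * (r / 2) by rewrite mulr_gt0 ?invr_gt0 ?divr_gt0.
  have d2 : 0 < e / 2 / Q by do !apply: divr_gt0.
  near=> n; rewrite dGE -normrN opprB.
  have n0 : 0 < n.+1%:R :> R by [].
  have nr : T / n.+1%:R < r / 2.
    rewrite -ltr_pdivlMl//.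
    by near: n; exact: (near_infty_natSinv_lt (PosNum d1)).
  rewrite -[X in _ - X](bern_cst n _ (t / T)) -hornerN -hornerD -bernB.
  rewrite (le_trans (bern_norm _ _ (scaled tT)))//.
  pose a0 j : R := e / 2 + Q / n.+1%:R ^+ 2 * (j%:R - n.+1%:R * (t / T)) ^+ 2.
  apply: (@le_trans _ _ (bern n a0).[t / T]).
    apply: bern_le; first exact: scaled.
    move=> j jn; rewrite /a0.
    set y := node n j - t.
    have yE : Q / n.+1%:R ^+ 2 * (j%:R - n.+1%:R * (t / T)) ^+ 2 = Q / T ^+ 2 * y ^+ 2.
      rewrite /y /node; field; nonzero.
    rewrite yE.
    have dn : node n j.+1 - node n j = T / n.+1%:R.
      by rewrite /node -[j.+1%:R]natr1; field; nonzero.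
    have dn0 : 0 < T / n.+1%:R by rewrite divr_gt0.
    have Qy : 0 <= Q / T ^+ 2 * y ^+ 2 by rewrite mulr_ge0 ?divr_ge0 ?sqr_ge0 ?ltW.
    have [yr|yr] := ltP `|y| (r / 2).
      have y1 : `|node n j - t| < r by rewrite (lt_trans yr)//; lra.
      have y2 : `|node n j.+1 - t| < r.
        have -> : node n j.+1 - t = y + T / n.+1%:R by rewrite -dn /y; ring.
        by rewrite (le_lt_trans (ler_normD _ _))// (gtr0_norm dn0) [ltRHS]splitr ltrD.
      have := Hr _ _ (node_itv (leqW jn)) (node_itv (n := n) (j := j.+1) jn) _ y1 y2.
      rewrite -subr_gt0 dn => /(_ dn0) h.
      have -> : n.+1%:R / T * (g (node n j.+1) - g (node n j)) - l =
          (T / n.+1%:R)^-1 * (g (node n j.+1) - g (node n j) - l * (T / n.+1%:R)).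
        by field; nonzero.
      rewrite normrM gtr0_norm ?invr_gt0// ler_pdivrMl// (le_trans h)//.
      by rewrite mulrC ler_pM2l// lerDl.
    rewrite (le_trans (ler_normB _ _))// (le_trans (lerD (dnode jn) (lexx _)))//.
    have yy : (r / 2) ^+ 2 <= y ^+ 2.
      by rewrite -[leRHS]real_normK ?num_real// ler_sqr ?nnegrE// ltW// divr_gt0.
    have QT : 0 <= Q / T ^+ 2 by rewrite divr_ge0 ?sqr_ge0 ?ltW.
    have := ler_wpM2l QT yy.
    have -> : Q / T ^+ 2 * (r / 2) ^+ 2 = K + (r / (2 * T)) ^+ 2.
      by rewrite /Q; field; nonzero.
    have := sqr_ge0 (r / (2 * T)); rewrite -/K; lra.
  rewrite /a0 bernD hornerD bern_cst bernZ hornerZ bern_var.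
  have /andP[t0 t1] := scaled tT.
  apply: (@le_trans _ _ (e / 2 + Q / n.+1%:R)).
    rewrite lerD2l -[Q / n.+1%:R](_ : Q / n.+1%:R ^+ 2 * n.+1%:R = _); last first.
      by field; nonzero.
    rewrite ler_wpM2l ?divr_ge0 ?(ltW Q0) ?sqr_ge0// -natr1.
    have := ler0n R n; set N := n%:R => N0.
    (* The degree is n but the nodes have mesh T / (n + 1), so the mean is off by t / T; this shift
       still leaves a second moment of at most n + 1. *)
    have -> : N * (t / T) - (N + 1) * (t / T) = - (t / T) by ring.
    by rewrite sqrrN; nra.
  have ne : n.+1%:R^-1 < e / 2 / Q.
    by near: n; exact: (near_infty_natSinv_lt (PosNum d2)).
  rewrite [leRHS]splitr lerD2l.
  by rewrite -ler_pdivlMl// [leRHS]mulrC; exact: ltW.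
Unshelve. all: by end_near. Qed.

End approximation.
End bernstein.

(** * Weights *)

Section tails.
Context {R : realType}.
Implicit Types (T t : R) (h : R -> R).
Local Notation mu := (@lebesgue_measure R).

Lemma continuous_itv_integrable h (a b : R) : continuous h ->
  mu.-integrable `[a, b] (EFin \o h).
Proof.
move=> ch; apply: continuous_compact_integrable; first exact: segment_compact.
exact: continuous_subspaceT.
Qed.

(** Near t the tail is F T - F s, with F the primitive started at t - 1, so t is interior to the
    interval of integration. *)
Lemma is_derive_tail T h t : continuous h -> t < T ->
  is_derive t 1 (tail T h) (- h t).
Proof.
move=> ch tT; pose a := t - 1.
pose F x := \int[mu]_(s in `[a, x]) h s.
have atl : a < t by rewrite /a; lra.
have [dF DF] : derivable F t 1 /\ (F^`())%classic t = h t.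
  exact: (continuous_FTC1_closed tT (continuous_itv_integrable a T ch) atl (ch t)).
have F1 : is_derive t 1 F (h t) by apply: DeriveDef; [exact: dF|rewrite -derive1E; exact: DF].
have D : is_derive t 1 (cst (F T) - F) (- h t).
  by have D := is_deriveB (is_derive_cst (F T) t 1) F1; apply: (is_derive_eq D); rewrite sub0r.
apply: (near_eq_is_derive _ D).
have eqF s : a < s -> s < T -> F T - F s = tail T h s.
  move=> sa sT; rewrite /F /tail Rintegral_itvB ?bnd_simp ?(ltW sT) ?(ltW sa)//.
    rewrite Rintegral_itv_obnd_cbnd//.
    apply: integrableS (continuous_itv_integrable s T ch) => //.
    exact: subset_itv_oc_cc.
  exact: continuous_itv_integrable.
near=> s; apply: eqF.
  by near: s; exact: lt_nbhsr.
by near: s; exact: lt_nbhsl.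
Unshelve. all: by end_near. Qed.

Lemma tail_ge T h c t : continuous h -> t <= T -> (forall s, t <= s <= T -> c <= h s) ->
  c * (T - t) <= tail T h t.
Proof.
move=> ch tT hc; rewrite /tail.
have -> : c * (T - t) = \int[mu]_(s in `[t, T]) (fun=> c) s.
  rewrite Rintegral_cst//= lebesgue_measure_itv/= lte_fin.
  move: tT; rewrite le_eqVlt => /predU1P[->|->]; last by rewrite -EFinB.
  by rewrite ltxx subrr mulr0.
apply: le_Rintegral => //.
- by apply: continuous_itv_integrable => s; exact: cvg_cst.
- exact: continuous_itv_integrable.
Qed.

Lemma is_derive_exp_weight gamma t :
  is_derive t 1 (exp_weight gamma) (- gamma * exp_weight gamma t).
Proof.
have E := @is_derive1_comp R expR (fun t => - gamma * t) t _ _ (is_derive_expR _)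
  (is_deriveZ (- gamma) (is_derive_id t 1)).
by apply: (is_derive_eq E); rewrite /GRing.scale /= /exp_weight; ring.
Qed.

Lemma is_derive_continuous (f : R -> R) t df : is_derive t 1 f df -> {for t, continuous f}.
Proof.
by move=> [Df _]; apply: differentiable_continuous; exact/derivable1_diffP.
Qed.

Lemma continuous_exp_weight gamma : continuous (exp_weight gamma : R -> R).
Proof. by move=> t; exact: (is_derive_continuous (is_derive_exp_weight gamma t)). Qed.

Lemma tail_exp_weight gamma T t : gamma != 0 -> t <= T ->
  tail T (exp_weight gamma) t = (exp_weight gamma t - exp_weight gamma T) / gamma.
Proof.
move=> g0; rewrite /tail le_eqVlt => /predU1P[->|tT].
  by rewrite set_itv1 Rintegral_set1 subrr mul0r.
pose F : R -> R := fun s => - gamma^-1 * exp_weight gamma s.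
have dF (s : R) : is_derive s 1 F (exp_weight gamma s).
  have D := is_deriveZ (- gamma^-1) (is_derive_exp_weight gamma s).
  by apply: (is_derive_eq D); rewrite /GRing.scale/= mulrA mulrNN mulVf// mul1r.
rewrite /Rintegral (@continuous_FTC2 _ _ F)//.
- by rewrite /= /F; field.
- by apply: continuous_subspaceT; exact: continuous_exp_weight.
- split.
  + by move=> s _; case: (dF s).
  + by apply: cvg_at_right_filter; exact: is_derive_continuous (dF t).
  + by apply: cvg_at_left_filter; exact: is_derive_continuous (dF T).
- by move=> s _; rewrite derive1E; case: (dF s).
Qed.

Lemma is_deriveV_R (f : R -> R) t df : is_derive t 1 f df -> f t != 0 ->
  is_derive t 1 (fun s => (f s)^-1) (- df / f t ^+ 2).
Proof.
move=> [Df Ef] f0; apply: DeriveDef; first exact: derivableV.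
by rewrite (deriveV f0 Df) Ef /GRing.scale/=; rewrite mulrC mulNr mulrN.
Qed.

Lemma MVT_itv (f df : R -> R) (a b : R) : a < b ->
  (forall s, a <= s <= b -> is_derive s 1 f (df s)) ->
  exists2 c, a < c < b & f b - f a = df c * (b - a).
Proof.
move=> ab Hf; have [||c] := @MVT R f df a b ab.
- by move=> s; rewrite in_itv/= => /andP[/ltW h1 /ltW h2]; apply: Hf; rewrite h1.
- apply: continuous_in_subspaceT => s; rewrite inE/= in_itv/= => /Hf.
  exact: is_derive_continuous.
- by rewrite in_itv/= => h1 h2; exists c.
Qed.

(** * The quotient w of the two tails and its polynomial approximants *)

Section weight_quotient.
Variables (T T1 : R) (h0 : R -> R) (gamma : R).
Hypotheses (wh0 : weight T h0) (T1_bounds : 0 < T1 < T) (gamma0 : 0 < gamma).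
Let h1 : R -> R := exp_weight gamma.
Let H0 := tail T h0.
(** The closed form of the new tail on t <= [T1]. It continues smoothly past [T1], which gives
    two-sided differentiability of the quotient at [T1] itself. *)
Let K1 (t : R) := (h1 t - h1 T1) / gamma.
Let u t := K1 t / H0 t.
Let u' t := - h1 t * (H0 t)^-1 + K1 t * h0 t * ((H0 t)^-1 * (H0 t)^-1).

Let ch0 : continuous h0. Proof. by case: wh0 => /smooth_continuous. Qed.

Lemma tail_gt0 t : 0 <= t < T -> 0 < H0 t.
Proof.
move=> /andP[t0 tT]; case: wh0 => _ [c [C [c0 hc]]].
apply: lt_le_trans (tail_ge ch0 (ltW tT) (c := c) _).
  by rewrite mulr_gt0// subr_gt0.
by move=> s /andP[ts sT]; have /andP[] := hc s ltac:(apply/andP; split; lra).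
Qed.

Let du t : 0 <= t < T -> is_derive t 1 u (u' t).
Proof.
move=> tT; have Ht := tail_gt0 tT; have Hn : H0 t != 0 by rewrite gt_eqF.
have dH : is_derive t 1 H0 (- h0 t) by apply: is_derive_tail => //; case/andP: tT.
have dV := is_deriveV_R dH Hn.
have dK : is_derive t 1 K1 (- h1 t).
  have D := is_deriveZ gamma^-1 (is_deriveB (is_derive_exp_weight gamma t) (is_derive_cst (h1 T1) t 1)).
  have -> : K1 = gamma^-1 *: (exp_weight gamma - cst (h1 T1)).
    by apply/funext => s; rewrite /K1 mulrC.
  by apply: (is_derive_eq D); rewrite /GRing.scale/= subr0 mulrA mulrN mulVf ?gt_eqF// mulN1r.
have D := is_deriveM dK dV; apply: (is_derive_eq D).
by rewrite /u' /GRing.scale/=; field.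
Qed.

Let cu' t : 0 <= t < T -> {for t, continuous u'}.
Proof.
move=> tT; have Hn : H0 t != 0 by rewrite gt_eqF// tail_gt0.
have cH : {for t, continuous H0}.
  by apply: is_derive_continuous; apply: is_derive_tail => //; case/andP: tT.
have ch1 : {for t, continuous h1} by exact: continuous_exp_weight.
have cV : {for t, continuous (fun s => (H0 s)^-1)} by exact: cvgV.
have cK : {for t, continuous K1}.
  by apply: cvgM; [apply: cvgB => //; exact: cvg_cst|exact: cvg_cst].
apply: cvgD; first by apply: cvgM => //; exact: cvgN.
by apply: cvgM; apply: cvgM => //; exact: ch0.
Qed.

Let T1T t : 0 <= t <= T1 -> 0 <= t < T.
Proof. by case/andP: T1_bounds => _ ? /andP[-> ?]; exact: le_lt_trans T1 _ _ _ _. Qed.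

Let bounded_on (f : R -> R) : (forall t, 0 <= t < T -> {for t, continuous f}) ->
  exists2 M, 0 <= M & forall t, 0 <= t <= T1 -> `|f t| <= M.
Proof.
move=> cf; have cw : {within `[0, T1], continuous f}.
  by apply: continuous_in_subspaceT => s; rewrite inE/= in_itv/= => /T1T/cf.
have /compact_bounded[M [_ HM]] := continuous_compact cw (@segment_compact R 0 T1).
exists (`|M| + 1) => [|t tT]; first by rewrite addr_ge0.
apply: (HM (`|M| + 1)); first by rewrite (le_lt_trans (ler_norm M))// ltrDl.
by exists t => //=; rewrite in_itv.
Qed.

Let g t := if t <= T1 then u t else 0.

Let uT1 : u T1 = 0. Proof. by rewrite /u /K1 subrr !mul0r. Qed.

Let g_lip : exists2 C, 0 <= C & forall s1 s2, 0 <= s1 <= T -> 0 <= s2 <= T ->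
  `|g s1 - g s2| <= C * `|s1 - s2|.
Proof.
have [C C0 HC] := bounded_on cu'.
have ulip s1 s2 : 0 <= s1 -> s2 <= T1 -> s1 <= s2 -> `|u s1 - u s2| <= C * (s2 - s1).
  move=> s10 s2T; rewrite le_eqVlt => /predU1P[->|s12].
    by rewrite !subrr normr0 mulr0.
  have [|c /andP[c1 c2] cE] := @MVT_itv u u' s1 s2 s12.
    by move=> s /andP[a b]; apply: du; apply: T1T; apply/andP; split; lra.
  rewrite distrC cE normrM [`|s2 - s1|]gtr0_norm ?subr_gt0//.
  by apply: ler_wpM2r; [rewrite subr_ge0 ltW|apply: HC; apply/andP; split; lra].
have glip s1 s2 : 0 <= s1 -> s1 <= s2 -> `|g s1 - g s2| <= C * (s2 - s1).
  move=> s10 s12; rewrite /g; case: (leP s2 T1) => s2T.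
    by rewrite (le_trans s12 s2T) ulip.
  case: (leP s1 T1) => s1T; last by rewrite subrr normr0 mulr_ge0// subr_ge0.
  (* Past [T1] the value 0 equals u(T1), so a slope across [T1] is controlled by a slope of [u] up
     to [T1]. *)
  rewrite -uT1 (le_trans (ulip s1 T1 s10 _ s1T))//.
  by apply: ler_wpM2l => //; lra.
exists C => // s1 s2 /andP[s10 _] /andP[s20 _]; case: (leP s1 s2) => s12.
  by rewrite [`|s1 - s2|]distrC [`|s2 - s1|]ger0_norm ?subr_ge0// glip.
by rewrite [`|g s1 - g s2|]distrC [`|s1 - s2|]gtr0_norm ?subr_gt0// glip// ltW.
Qed.

(** The identity for [w'] is the derivative of w H = H1, and it is what later rebalances the strong
    equation. The derivatives are not claimed to converge at [T1], where the extension has a corner,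
    nor at the endpoints. *)
Lemma weight_quotient : exists (w w' : R -> R) (P : nat -> {poly R}) (M : R),
  [/\ forall t, 0 <= t <= T1 ->
        [/\ w t = tail T1 h1 t / tail T h0 t,
            w' t * tail T h0 t = w t * h0 t - h1 t & 0 <= w t],
      forall t, 0 <= t <= T1 -> {for t, continuous w} /\ {for t, continuous w'},
      forall n t, 0 <= t <= T -> `|(P n).[t]| <= M /\ `|(P n)^`().[t]| <= M,
      forall t, 0 <= t <= T ->
        (P n).[t] @[n --> \oo] --> (if t <= T1 then w t else 0) &
      forall t, 0 < t < T -> t != T1 ->
        (P n)^`().[t] @[n --> \oo] --> (if t <= T1 then w' t else 0)].
Proof.
have /andP[T10 T1T'] := T1_bounds; have T0 : 0 < T by lra.
have [C C0 HC] := g_lip.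
have [P [M [P1 P2 P3 P4]]] := bernstein_approximation T0 HC.
exists u, u', P, M; split => //.
- move=> t tT1; have Hp := tail_gt0 (T1T tT1); have /andP[t0 tT] := tT1; split.
  + by rewrite tail_exp_weight ?gt_eqF.
  + by rewrite -/H0 /u' /u; field; rewrite gt_eqF.
  + rewrite /u divr_ge0 ?(ltW Hp)// divr_ge0 ?(ltW gamma0)// subr_ge0 /h1 /exp_weight.
    by rewrite ler_expR !mulNr lerN2 ler_pM2l.
- move=> t /T1T tT; split; last exact: cu'.
  exact: is_derive_continuous (du tT).
- by move=> n t tT; split; [exact: P1|exact: P2].
- move=> t tT tT1; have tT' : 0 <= t <= T by case/andP: tT => ? ?; apply/andP; split; lra.
  apply: P4 => // e e0; case: ifPn => tle.
    have ltT1 : t < T1 by rewrite lt_neqAle tT1.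
    have tT2 : 0 <= t < T by case/andP: tT => ? ?; apply/andP; split; lra.
    have /cvgrPdist_le/(_ _ e0)/nbhs_ballP[r /= r0 Hr] := cu' tT2.
    (* Within T1 - t of t both points stay left of [T1], where g = u, while [r] controls the
       oscillation of [u']; the mean value theorem then gives the slope estimate. *)
    exists (Num.min r (Num.min t (T1 - t))).
      by rewrite !lt_min r0 subr_gt0 ltT1; case/andP: tT => ->.
    move=> s1 s2 /andP[s10 s1T] /andP[s20 s2T] s12; rewrite !lt_min.
    move=> /and3P[a1 a2 a3] /and3P[b1 b2 b3].
    have {}a3 : s1 < T1 by move: a3; rewrite ltr_norml => /andP[]; lra.
    have {}b3 : s2 < T1 by move: b3; rewrite ltr_norml => /andP[]; lra.
    rewrite /g (ltW a3) (ltW b3).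
    have [|c /andP[c1 c2] cE] := @MVT_itv u u' s1 s2 s12.
      by move=> s /andP[a b]; apply: du; apply/andP; split; lra.
    rewrite cE -mulrBl normrM [`|s2 - s1|]gtr0_norm ?subr_gt0//.
    apply: ler_wpM2r; first by rewrite subr_ge0 ltW.
    rewrite distrC; apply: Hr; rewrite /ball/= distrC.
    move: a1 b1; rewrite !ltr_norml => /andP[? ?] /andP[? ?].
    by apply/andP; split; lra.
  rewrite -ltNge in tle; exists (t - T1); first by rewrite subr_gt0.
  move=> s1 s2 _ _ s12; rewrite !ltr_norml => /andP[? ?] /andP[? ?].
  rewrite /g !ifF; [|by apply/negbTE; rewrite -ltNge; lra..].
  by rewrite subrr mul0r subrr normr0 mulr_ge0 ?(ltW e0)// subr_ge0 ltW.
Qed.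

End weight_quotient.
End tails.

(** * Loewner convexity *)

Section convexity.
Context {R : realType} {n : nat}.
Local Notation vec := 'rV[R]_n.

Lemma convex_function_le (D : set vec) (f : vec -> R) (x y : vec) (s : R) :
  convex_function D f -> D x -> D y -> 0 <= s <= 1 ->
  f (s *: x + (1 - s) *: y) <= s * f x + (1 - s) * f y.
Proof.
move=> cf Dx Dy /andP[s0 s1].
by apply: (cf (Itv01 s0 s1)); rewrite inE.
Qed.

(** [c] bounds from above the right derivative of [f] at [y] along [w]. For convex [f] such bounds
    add up over directions, so partial derivatives suffice to reach every direction. *)
Let upper_slope (D : set vec) (f : vec -> R) (y w : vec) (c : R) :=
  forall e : R, 0 < e -> exists2 r, 0 < r & forall s, 0 < s < r ->
    D (y + s *: w) /\ f (y + s *: w) <= f y + s * (c + e).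

(** The point y + s (w1 + w2) is the midpoint of y + 2 s w1 and y + 2 s w2; hence the doubled steps
    and the halved radius. *)
Let upper_slopeD D f y w1 w2 c1 c2 : convex_set D -> convex_function D f ->
  upper_slope D f y w1 c1 -> upper_slope D f y w2 c2 ->
  upper_slope D f y (w1 + w2) (c1 + c2).
Proof.
move=> cD cf U1 U2 e e0; have e20 : 0 < e / 2 by rewrite divr_gt0.
have [r1 r10 H1] := U1 _ e20; have [r2 r20 H2] := U2 _ e20.
exists (Num.min r1 r2 / 2); first by rewrite divr_gt0// lt_min r10.
move=> s /andP[s0]; rewrite ltr_pdivlMr// lt_min => /andP[sr1 sr2].
have [D1 f1] := H1 (s * 2) ltac:(by rewrite mulr_gt0).
have [D2 f2] := H2 (s * 2) ltac:(by rewrite mulr_gt0).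
have h0 : 0 <= 2^-1 :> R by lra.
have h1 : 2^-1 <= 1 :> R by lra.
have E : y + s *: (w1 + w2) =
    2^-1 *: (y + (s * 2) *: w1) + (1 - 2^-1) *: (y + (s * 2) *: w2).
  by apply/rowP => i; rewrite !mxE; field.
split; last first.
  have h01 : 0 <= (2^-1 : R) <= 1 by rewrite h0 h1.
  rewrite E (le_trans (convex_function_le cf D1 D2 h01))//.
  have -> : f y + s * (c1 + c2 + e) = 2^-1 * (f y + s * 2 * (c1 + e / 2)) +
      (1 - 2^-1) * (f y + s * 2 * (c2 + e / 2)) by field.
  by apply: lerD; apply: ler_wpM2l; rewrite // subr_ge0.
have := cD _ _ (Itv01 h0 h1) (mem_set D1) (mem_set D2).
by rewrite inE; congr D; rewrite E.
Qed.

(** The partial derivative is two-sided, so the sign of [a] is free; |a| + 1 absorbs the scaling and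
    stays positive at a = 0. *)
Let upper_slope_coord D f y (l : 'I_n) a : D^° y ->
  derivable f y (delta_mx ord0 l) ->
  upper_slope D f y (a *: delta_mx ord0 l) (a * 'D_(delta_mx ord0 l) f y).
Proof.
move=> Dy df e e0.
set v := delta_mx ord0 l; set c := 'D_v f y.
have e1 : 0 < e / (`|a| + 1) by rewrite divr_gt0// ltr_wpDl.
have cvgc : h^-1 *: (f (h *: v + y) - f y) @[h --> (0 : R)^'] --> c by exact: df.
have /cvgrPdist_lt/(_ _ e1) H1 := cvgc.
have H2 : \forall h \near (0 : R), D (y + h *: v).
  have ch : {for (0 : R), continuous (fun h : R => y + h *: v)}.
    by apply: cvgD; [exact: cvg_cst|exact: scalel_continuous].
  apply: ch; rewrite scale0r addr0.
  exact: Dy.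
have [r1 /= r10 B1] := H1; have [r2 /= r20 B2] := H2.
exists (Num.min r1 r2 / (`|a| + 1)).
  by rewrite divr_gt0// ?lt_min ?r10// ltr_wpDl.
have a1 : 0 < `|a| + 1 by rewrite ltr_wpDl.
move=> s /andP[s0]; rewrite ltr_pdivlMr// lt_min => /andP[sr1 sr2].
have sa : `|s * a| < s * (`|a| + 1) by rewrite normrM gtr0_norm// ltr_pM2l// ltrDl.
rewrite scalerA; split.
  by apply: B2; rewrite /ball/= sub0r normrN (lt_trans sa).
have [->|an0] := eqVneq a 0.
  rewrite mulr0 scale0r addr0 mul0r add0r lerDl mulr_ge0 ?(ltW s0) ?(ltW e0)//.
have h0 : s * a != 0 by rewrite mulf_neq0// gt_eqF.
have := B1 (s * a); rewrite /ball/= sub0r normrN => /(_ (lt_trans sa sr1) h0).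
rewrite [_ *: v + y]addrC; set q := f (y + _) - f y.
have -> : f (y + (s * a) *: v) = f y + q by rewrite /q addrCA subrr addr0.
rewrite lerD2l => h.
have -> : q = s * (a * c + a * ((s * a)^-1 * q - c)).
  by field; rewrite an0 gt_eqF.
rewrite ler_pM2l// lerD2l (le_trans (ler_norm _))// normrM.
rewrite distrC in h.
rewrite (le_trans (ler_wpM2l (normr_ge0 _) (ltW h)))//.
rewrite mulrCA ler_piMr ?(ltW e0)// ler_pdivrMr// mul1r; lra.
Qed.

(* Only the partial derivatives of f are used: convexity bounds f (y - s w) by
   values along the coordinate axes, hence f (y + s w) from below. *)
Lemma convex_gradient (D : set vec) (f : vec -> R) (y z : vec) :
  convex_set D -> convex_function D f -> D^° y -> D z ->
  (forall l, derivable f y (delta_mx ord0 l)) ->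
  f y + \sum_l (z - y) ord0 l * 'D_(delta_mx ord0 l) f y <= f z.
Proof.
move=> cD cf Oy Dz df; have Dy : D y by exact: interior_subset Oy.
set S := \sum_l _; set w := z - y.
have U : upper_slope D f y (- w) (- S).
  have -> : - w = \sum_l (- w ord0 l) *: delta_mx ord0 l.
    by rewrite [LHS]row_sum_delta; apply: eq_bigr => l _; rewrite mxE.
  have -> : - S = \sum_l (- w ord0 l) * 'D_(delta_mx ord0 l) f y.
    by rewrite -sumrN; apply: eq_bigr => l _; rewrite mulNr.
  elim: (index_enum _) => [|l r IH].
    rewrite !big_nil => e e0; exists 1 => // s /andP[s0 _].
    by rewrite scaler0 addr0 add0r lerDl mulr_ge0// ltW.
  by rewrite !big_cons; apply: upper_slopeD => //; exact: upper_slope_coord.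
apply/ler_addgt0Pr => e e0; have [r r0 Hr] := U _ e0.
pose s := Num.min (r / 2) 2^-1.
have s0 : 0 < s by rewrite lt_min divr_gt0//=; lra.
have s1 : s <= 2^-1 by rewrite ge_min lexx orbT.
have sr : s < r by rewrite (@le_lt_trans _ _ (r / 2)) ?ge_min ?lexx//; lra.
have [Dm fm] := Hr s ltac:(by rewrite s0).
have s01 : 0 <= s <= 1 by apply/andP; split; lra.
have fp : f (y + s *: w) <= s * f z + (1 - s) * f y.
  have := convex_function_le cf Dz Dy s01; congr (f _ <= _).
  by apply/rowP => i; rewrite !mxE; ring.
have Dp : D (y + s *: w).
  have /andP[s0' s1'] := s01.
  have := cD _ _ (Itv01 s0' s1') (mem_set Dz) (mem_set Dy).
  have E : y + s *: w = s *: z + (1 - s) *: y.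
    by apply/rowP => i; rewrite !mxE; ring.
  by rewrite inE; congr D; rewrite E.
have h01 : 0 <= (2^-1 : R) <= 1 by apply/andP; split; lra.
have fy : f y <= 2^-1 * f (y + s *: w) + (1 - 2^-1) * f (y + s *: - w).
  have := convex_function_le cf Dp Dm h01; congr (f _ <= _).
  by apply/rowP => i; rewrite !mxE; field.
have : 0 <= s * (f z - f y - S + e) by lra.
rewrite pmulr_rge0//; lra.
Qed.

End convexity.

Section frob_derive.
Context {R : realType} (W : normedModType R) (m k : nat).
Implicit Types (f : W -> 'M[R]_(m, k)).

Lemma derivable_entry f a w i j : derivable f a w ->
  is_derive a w (fun x => f x i j) ('D_w f a i j).
Proof.
move=> df; have /derivable_mxP/(_ i j) dij := df.
by apply: DeriveDef => //; rewrite derive_mx// mxE.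
Qed.

Lemma is_derive_sum_fun (I : finType) (f : I -> W -> R) (df : I -> R) a w :
  (forall i, is_derive a w (f i) (df i)) ->
  is_derive a w (fun x => \sum_i f i x) (\sum_i df i).
Proof.
move=> H; elim: (index_enum I) => [|i r IH].
  have -> : (fun x => \sum_(i <- [::]) f i x) = cst 0.
    by apply/funext => x; rewrite big_nil.
  by rewrite big_nil; exact: is_derive_cst.
have -> : (fun x => \sum_(i <- i :: r) f i x) = f i + (fun x => \sum_(i <- r) f i x).
  by apply/funext => x; rewrite big_cons.
by rewrite big_cons; exact: is_deriveD.
Qed.

Lemma is_derive_frob f (Q : 'M[R]_(m, k)) a w : derivable f a w ->
  is_derive a w (fun x => frob (f x) Q) (frob ('D_w f a) Q).
Proof.
move=> df; apply: is_derive_sum_fun => i; apply: is_derive_sum_fun => j.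
have D := is_deriveM (derivable_entry i j df) (is_derive_cst (Q i j) a w).
by apply: (is_derive_eq D); rewrite /cst /GRing.scale/= mulr0 add0r mulrC.
Qed.

End frob_derive.

Lemma frobNl {R : realType} m k (A C : 'M[R]_(m, k)) : frob (- A) C = - frob A C.
Proof. by rewrite -scaleN1r frobZl mulN1r. Qed.

Section problem_calculus.
Context {R : realType} {d n N Z : nat} (P : problem R d n N Z) (PS : setting P).
Local Notation domF := (F_dom P).
Local Notation F := (F_map P).

Lemma is_derive_KF l y : domF^° y ->
  is_derive y (delta_mx ord0 l) (KF P) (2^-1 * \tr (dF P l y)).
Proof.
move=> Oy; have [dF _] := F_C1 PS l Oy.
have D := is_deriveZ 2^-1 (is_derive_sum_fun (fun i => derivable_entry i i dF)).
exact: (is_derive_eq D).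
Qed.

Lemma sharpE y l : domF^° y -> sharp P y ord0 l = 2^-1 * \tr (dF P l y).
Proof. by move=> Oy; rewrite mxE; case: (is_derive_KF l Oy). Qed.

(** [F] is known to be symmetric only on its domain, which is a neighbourhood of an interior point,
    and a derivative depends on nothing more. *)
Lemma dF_sym l y : domF^° y -> (dF P l y)^T = dF P l y.
Proof.
move=> Oy; have [dF _] := F_C1 PS l Oy; apply/matrixP => i j; rewrite mxE /Defs.dF.
have [_ <-] := derivable_entry i j dF; have [_ <-] := derivable_entry j i dF.
apply: near_eq_derive.
have Dx : \forall x \near y, domF x by exact: Oy.
by apply: filterS Dx => x /(F_psd PS)[Fx _]; rewrite -[in LHS]Fx mxE.
Qed.

(** Tested against the rank-one matrix u^T u, Loewner convexity becomes scalar convexity, to which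
    [convex_gradient] applies. *)
Lemma loewner_gradient y z : domF^° y -> domF z ->
  psd (F z - F y - \sum_l (z - y) ord0 l *: dF P l y).
Proof.
move=> Oy Dz; have Dy : domF y by exact: interior_subset Oy.
split.
  have [Fy _] := F_psd PS Dy; have [Fz _] := F_psd PS Dz.
  rewrite !linearB/= Fy Fz raddf_sum/=; congr (_ - _); apply: eq_bigr => l _.
  by rewrite linearZ/= dF_sym.
move=> u; pose Q := u^T *m u; rewrite -frob_outer -/Q.
have H l : is_derive y (delta_mx ord0 l) (fun y => frob (F y) Q) (frob (dF P l y) Q).
  by apply: is_derive_frob; case: (F_C1 PS l Oy).
have := convex_gradient (domF_convex PS) (F_Loewner_convex PS (psd_outer u)) Oy Dz
  (fun l => ltac:(by case: (H l))).
rewrite -/Q => h.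
have -> : frob (F z - F y - \sum_l (z - y) ord0 l *: dF P l y) Q =
    frob (F z) Q - frob (F y) Q - \sum_l (z - y) ord0 l * frob (dF P l y) Q.
  rewrite !frobDl !frobNl; congr (_ - _).
  elim: (index_enum _) => [|l r IH].
    by rewrite !big_nil /frob big1// => i _; rewrite big1// => j _; rewrite mxE mul0r.
  by rewrite !big_cons frobDl frobZl IH.
have : \sum_l (z - y) ord0 l * 'D_(delta_mx ord0 l) (fun y => frob (F y) Q) y =
    \sum_l (z - y) ord0 l * frob (dF P l y) Q.
  by apply: eq_bigr => l _; case: (H l) => _ ->.
by move=> E; rewrite E in h; lra.
Qed.

End problem_calculus.

(** * Time derivatives and spatial operators *)

Section time_derivative.
Context {R : realType} {d : nat}.
Local Notation space := 'rV[R]_d.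
Local Notation spacetime := (R * 'rV[R]_d)%type.

(** The representative is fixed before the function, so one point serves several periodic functions
    at once. *)
Lemma periodic_unit_cube (x : space) : exists2 y, unit_cube y &
  forall (V : Type) (f : space -> V), Defs.periodic f -> f x = f y.
Proof.
pose y : space := \row_i (x ord0 i - (Num.floor (x ord0 i))%:~R).
exists y.
  move=> i; rewrite mxE; have := floor_itv (x ord0 i).
  by rewrite intrD => /andP[? ?]; apply/andP; split; lra.
move=> V f pf.
have pn (k : nat) i z : f (z + k%:R *: delta_mx ord0 i) = f z.
  elim: k => [|k IH]; first by rewrite scale0r addr0.
  by rewrite -natr1 scalerDl scale1r addrA pf IH.
have pz (k : int) i z : f (z + k%:~R *: delta_mx ord0 i) = f z.
  case: k => k; first exact: pn.
  by rewrite NegzE mulrNz -[in RHS](subrK (k.+1%:R *: delta_mx ord0 i) z) pn scaleNr.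
have -> : x = y + \sum_i (Num.floor (x ord0 i))%:~R *: delta_mx ord0 i.
  rewrite [y]row_sum_delta -big_split/= [LHS]row_sum_delta.
  by apply: eq_bigr => i _; rewrite -scalerDl mxE subrK.
elim: (index_enum _) => [|i r IH]; first by rewrite big_nil addr0.
by rewrite big_cons addrCA addrC pz.
Qed.

Lemma is_derive_time m k (Phi : spacetime -> 'M[R]_(m, k)) (t : R) (x : space) i j : smooth Phi ->
  is_derive t 1 (fun s => Phi (s, x) i j) (dt Phi (t, x) i j).
Proof.
move=> sPhi.
have [D1 D2] := derivable_entry i j (smooth_derivable (p := (t, x)) (w := (1, 0)) sPhi).
apply: is_derive_cvg; rewrite /dt -D2.
have := D1; rewrite /derivable /derive => /cvgP; apply: cvg_trans.
apply: near_eq_cvg; near=> h => /=.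
have -> : h *: ((1, 0) : spacetime) + (t, x) = (h *: (1 : R) + t, x).
  by rewrite [LHS]surjective_pairing /= scaler0 add0r.
by [].
Unshelve. all: by end_near. Qed.

(** Each entry of the derivative is a one-variable derivative of s -> Phi (s, x), and these curves
    agree at x and at its translates, so periodicity is inherited. *)
Lemma smooth_in_dt m k (Phi : spacetime -> 'M[R]_(m, k)) :
  smooth_in (CX m k) Phi -> smooth_in (CX m k) (dt Phi).
Proof.
move=> [sPhi cPhi]; split; first exact: smooth_derive.
move=> t; split.
  move=> x; apply: (@continuous_comp _ _ _ (fun x => (t, x)) (dt Phi)).
    move=> U [[U1 U2] /= [n1 n2] sub]; apply: (@filterS _ (nbhs x) _ U2) n2 => y Uy.
    by apply: sub; split => //=; exact: nbhs_singleton.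
  have c : continuous (dt Phi) by apply: smooth_continuous; exact: smooth_derive.
  exact: c.
move=> x i; apply/matrixP => a b; rewrite /slice.
have [_ <-] := is_derive_time t x a b sPhi.
have [_ <-] := is_derive_time t (x + delta_mx ord0 i) a b sPhi.
congr ('D_1 _ t); apply/funext => s.
by have [_ p] := cPhi s; have := p x i; rewrite /slice => ->.
Qed.

Lemma smooth_in_sym_dt N (Psi : spacetime -> 'M[R]_N) :
  smooth_in (CX_sym N) Psi -> smooth_in (CX_sym N) (dt Psi).
Proof.
move=> [sPsi cPsi].
have [_ H] := smooth_in_dt (conj sPsi (fun t => proj1 (cPsi t))).
split; first exact: smooth_derive.
move=> t; split; first exact: H.
move=> x; apply/matrixP => a b; rewrite mxE /slice.
have [_ <-] := is_derive_time t x a b sPsi.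
have [_ <-] := is_derive_time t x b a sPsi.
congr ('D_1 _ t); apply/funext => s.
by have [_ p] := cPsi s; have := p x; rewrite /slice => {1}<-; rewrite mxE.
Qed.

Lemma uniform_cvg_entries m k (f_ : nat -> space -> 'M[R]_(m, k)) (f : space -> 'M[R]_(m, k)) :
  (forall e, 0 < e -> \forall l \near \oo, forall x i j, `|f x i j - f_ l x i j| < e) ->
  {uniform, f_ @ \oo --> f}.
Proof.
move=> H U /uniform_nbhs[E [+ EU]].
rewrite -entourage_ballE => -[e /= e0 eE].
have := H e e0; apply: filterS => l Hl; apply: EU => y _; apply: eE.
by split=> // i j; exact: Hl.
Qed.

(** Written as a combination of two slices, the form on which a linear operator can act. *)
Definition diff_quotient m k (Phi : spacetime -> 'M[R]_(m, k)) t (l : nat) : space -> 'M[R]_(m, k) :=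
  fun x => l.+1%:R *: Phi (t + l.+1%:R^-1, x) + (- l.+1%:R) *: Phi (t, x).

(** Two applications of the mean value theorem bound the error by B / (l + 1), with [B] a bound on
    the second time derivative over a compact cylinder; periodicity makes the bound uniform over all
    x. *)
Lemma diff_quotient_cvg m k (Phi : spacetime -> 'M[R]_(m, k)) t : 0 <= t ->
  smooth_in (CX m k) Phi ->
  {uniform, diff_quotient Phi t @ \oo --> slice (dt Phi) t}.
Proof.
move=> t0 SPhi; have [sPhi cPhi] := SPhi.
have SdPhi := smooth_in_dt SPhi; have [sdPhi cdPhi] := SdPhi.
have sddPhi : smooth (dt (dt Phi)) by exact: smooth_derive.
have [B B0 HB] : exists2 B, 0 < B & forall i j p, closed_cylinder (t + 1) p ->
    `|dt (dt Phi) p i j| <= B.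
  have /choice[b Hb] : forall ij : 'I_m * 'I_k, exists b, forall p,
      closed_cylinder (t + 1) p -> `|dt (dt Phi) p ij.1 ij.2| <= b.
    move=> ij; apply: within_continuous_bounded; apply: continuous_subspaceT.
    exact: continuous_entry (smooth_continuous sddPhi).
  exists (\sum_ij `|b ij| + 1); first by rewrite ltr_wpDl// sumr_ge0.
  move=> i j p Dp; rewrite (le_trans (Hb (i, j) p Dp))//.
  rewrite (bigD1 (i, j))//= -addrA (le_trans (ler_norm _))// lerDl addr_ge0//.
  exact: sumr_ge0.
apply: uniform_cvg_entries => e e0.
have d0 : 0 < e / B by rewrite divr_gt0.
near=> l => x i j.
have [y uy yE] := periodic_unit_cube x.
have -> : diff_quotient Phi t l x = diff_quotient Phi t l y.
  rewrite /diff_quotient; congr (_ *: _ + _ *: _).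
    by have [_ p] := cPhi (t + l.+1%:R^-1); exact: (yE _ _ p).
  by have [_ p] := cPhi t; exact: (yE _ _ p).
have -> : slice (dt Phi) t x = slice (dt Phi) t y.
  by have [_ p] := cdPhi t; exact: (yE _ _ p).
set s : R := l.+1%:R^-1.
have s0 : 0 < s by rewrite invr_gt0.
have s1 : s <= 1 by rewrite invf_le1// ler1n.
have sl : l.+1%:R = s^-1 :> R by rewrite invrK.
have tts : t < t + s by rewrite ltrDl.
have [c /andP[c1 c2] cE] := MVT_itv tts (fun r _ => is_derive_time r y i j sPhi).
have [c' /andP[c1' c2'] cE'] := MVT_itv c1 (fun r _ => is_derive_time r y i j sdPhi).
have -> : diff_quotient Phi t l y i j = dt Phi (c, y) i j.
  rewrite !mxE -/s sl mulNr -mulrBr cE [t + s]addrC addrK mulrC mulfK//.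
  by rewrite gt_eqF.
rewrite /slice distrC cE' normrM [`|c - t|]gtr0_norm ?subr_gt0//.
apply: (@le_lt_trans _ _ (B * s)).
  apply: ler_pM => //; last by rewrite lerBlDl ltW.
    by rewrite subr_ge0 ltW.
  apply: HB; split => /=; first by rewrite in_itv/=; apply/andP; split; lra.
  by move=> i0; have /andP[-> /ltW] := uy i0.
rewrite -ltr_pdivlMl// mulrC.
by rewrite /s; near: l; exact: (near_infty_natSinv_lt (PosNum d0)).
Unshelve. all: by end_near. Qed.

Lemma linear_operator_comb m k m' k' X Y (G : operator (R := R) d m k m' k') a b f g :
  linear_operator X Y G -> dom G f -> dom G g ->
  dom G (fun x => a *: f x + b *: g x) /\
  G (fun x => a *: f x + b *: g x) = (fun x => a *: G f x + b *: G g x).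
Proof.
move=> [_ _ lin] Df Dg.
(* Linearity is given only for a f + g, so c h is produced as (c - 1) h + h. *)
have scale c h : dom G h ->
    dom G (fun x => c *: h x) /\ G (fun x => c *: h x) = (fun x => c *: G h x).
  move=> Dh; have [] := lin (c - 1) h h Dh Dh.
  have e q q' (z : space -> 'M[R]_(q, q')) :
      (fun x => (c - 1) *: z x + z x) = (fun x => c *: z x).
    by apply/funext => x; rewrite scalerBl scale1r subrK.
  by rewrite !e.
have [Dg' Eg] := scale b g Dg.
by have [h1 h2] := lin a f _ Df Dg'; split=> //; rewrite h2 Eg.
Qed.

(** The coefficient depends on time only, hence is a constant on each slice. *)
Lemma slicewise_scale m k m' k' X Y (G : operator (R := R) d m k m' k') (a : R -> R) Psi :
  linear_operator X Y G -> (forall t, dom G (slice Psi t)) ->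
  slicewise G (fun p => a p.1 *: Psi p) = (fun p => a p.1 *: slicewise G Psi p).
Proof.
move=> lin DG; apply/funext => -[t x]; rewrite /slicewise/=.
have [_] := linear_operator_comb (a t) 0 lin (DG t) (DG t).
have e q q' (z : space -> 'M[R]_(q, q')) :
    (fun x => a t *: z x + 0 *: z x) = (fun x => a t *: z x).
  by apply/funext => y; rewrite scale0r addr0.
by rewrite !e => /(congr1 (fun h => h x)).
Qed.

End time_derivative.

Section problem_operators.
Context {R : realType} {d n N Z : nat} (P : problem R d n N Z) (PS : setting P).
Local Notation spacetime := (R * 'rV[R]_d)%type.
Local Notation domF := (F_dom P).

(** [L] maps the difference quotients of [Psi] to those of L Psi; both converge uniformly, so
    closedness of [L] identifies the limits. *)
Lemma slicewise_L_dt (Psi : spacetime -> 'M[R]_N) t x : 0 <= t ->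
  smooth_in (CX_sym N) Psi ->
  slicewise (L_op P) (dt Psi) (t, x) = dt (slicewise (L_op P) Psi) (t, x).
Proof.
move=> t0 SPsi; have [sPsi cPsi] := SPsi.
have [Ldom SL] := (proj1 (L_spatial PS)) _ SPsi.
have [sL cL] := SL.
have Df l : dom (L_op P) (diff_quotient Psi t l) /\
    L_op P (diff_quotient Psi t l) = diff_quotient (slicewise (L_op P) Psi) t l.
  exact: (linear_operator_comb l.+1%:R (- l.+1%:R) (L_linear PS) (Ldom (t + l.+1%:R^-1)) (Ldom t)).
have [_ XdPsi] := smooth_in_sym_dt SPsi.
have [_ YdL] := smooth_in_dt SL.
have [|_ E] := L_closed PS (XdPsi t) (YdL t) (fun l => proj1 (Df l))
    (diff_quotient_cvg t0 (conj sPsi (fun t => proj1 (cPsi t)))).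
  have -> : (fun l => L_op P (diff_quotient Psi t l)) = diff_quotient (slicewise (L_op P) Psi) t.
    by apply/funext => l; case: (Df l).
  exact: diff_quotient_cvg.
by have := congr1 (fun h => h x) E.
Qed.

Lemma within_continuous_comp (A : set spacetime) (V W : topologicalType)
    (f : spacetime -> V) (g : V -> W) :
  {within A, continuous f} -> (forall p, A p -> {for f p, continuous g}) ->
  {within A, continuous (g \o f)}.
Proof.
move=> /subspace_continuousP cf cg; apply/subspace_continuousP => p Ap.
exact: (cvg_comp _ _ (cf p Ap) (cg p Ap)).
Qed.

Section along_solution.
Variables (T : R) (v : spacetime -> 'rV[R]_n).
Hypotheses (cv : CTX T 1 n v) (vO : forall p, strip T p -> domF^° (v p)).

Lemma within_continuous_dF l : {within strip T, continuous (dF P l \o v)}.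
Proof.
apply: within_continuous_comp; first by case: cv.
by move=> p /vO Op; case: (F_C1 PS l Op).
Qed.

Lemma bmeas_dF l i j : bmeas (cylinder T) (fun p => dF P l (v p) i j).
Proof.
apply: continuous_bmeas.
exact: (@continuous_entry _ (subspace (strip T)) _ _ (dF P l \o v) i j (@within_continuous_dF l)).
Qed.

Lemma bmeas_sharp l : bmeas (cylinder T) (fun p => sharp P (v p) ord0 l).
Proof.
apply: (bmeas_ext (f := fun p => 2^-1 * \sum_i dF P l (v p) i i)).
  by move=> p /cylinder_strip/vO Op; rewrite (sharpE PS).
by apply: bmeasZ; apply: bmeas_sum => i; exact: bmeas_dF.
Qed.

End along_solution.
End problem_operators.

(** * Cutting off in time *)

Lemma cvg_sum_seq {R : realType} {X : Type} {F : set_system X} {FF : Filter F}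
    (I : Type) (r : seq I) (f : I -> X -> R) (l : I -> R) :
  (forall i, f i k @[k --> F] --> l i) ->
  \sum_(i <- r) f i k @[k --> F] --> \sum_(i <- r) l i.
Proof.
move=> H; elim: r => [|i r IH].
  by under eq_fun do rewrite big_nil; rewrite big_nil; exact: cvg_cst.
by under eq_fun do rewrite big_cons; rewrite big_cons; apply: cvgD.
Qed.

Section spacetime_integrals.
Context {R : realType} {d : nat}.
Local Notation space := 'rV[R]_d.
Local Notation spacetime := (R * 'rV[R]_d)%type.
Local Notation mcyl := (@measurable_cylinder R d).

Lemma bmeas_time T (f : R -> R) : (forall t, 0 <= t <= T -> {for t, continuous f}) ->
  bmeas (cylinder T : set spacetime) (fun p => f p.1).
Proof.
move=> cf; apply: continuous_bmeas; apply: within_continuous_glue => p Sp.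
by apply: (@continuous_comp _ _ _ fst f); [exact: cvg_fst|exact: cf].
Qed.

Lemma cylinderS (T1 T : R) : T1 <= T -> cylinder T1 `<=` (cylinder T : set spacetime).
Proof.
move=> T1T p [/= + h]; rewrite !in_itv/= => /andP[p0 p1]; split => //=.
by rewrite in_itv/= p0 (le_trans p1).
Qed.

Lemma stripS (T1 T : R) : T1 <= T -> strip T1 `<=` (strip T : set spacetime).
Proof. by move=> T1T p /andP[p0 p1]; rewrite /strip /= p0 (le_trans p1). Qed.

Lemma Leb_cylinderS_fin T (A : set spacetime) : measurable A -> A `<=` cylinder T ->
  (Leb A < +oo)%E.
Proof.
move=> mA AT; apply: le_lt_trans (Leb_cylinder_fin T).
by apply: le_measure; rewrite ?inE//; exact: mcyl.
Qed.

Lemma Leb_integrable T (A : set spacetime) f : measurable A -> A `<=` cylinder T ->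
  bmeas A f -> Leb.-integrable A (EFin \o f).
Proof. by move=> mA AT; apply: bmeas_integrable => //; exact: Leb_cylinderS_fin AT. Qed.

Lemma measurable_set1R (c : R) : measurable ([set c] : set R).
Proof. by rewrite -set_itv1; exact: measurable_itv. Qed.

Lemma Leb_time_null (c : R) : Leb ([set p | p.1 = c] : set spacetime) = 0%E.
Proof.
have -> : ([set p | p.1 = c] : set spacetime) = [set c] `*` setT.
  by apply/seteqP; split => [p /= ->|p [/= ->]].
rewrite /Leb product_measure1E//.
by rewrite [X in (X * _)%E](_ : _ = 0%E) ?mul0e//; exact: lebesgue_measure_set1.
Qed.

(** Dominated convergence with three exceptional time slices, all null for dx dt; they will be 0,
    [T1] and T. *)
Lemma Rintegral_Leb_cvg T (f_ : nat -> spacetime -> R) (f : spacetime -> R) M (c1 c2 c3 : R) :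
  (forall k, bmeas (cylinder T) (f_ k)) -> measurable_fun (cylinder T) f ->
  (forall k p, cylinder T p -> `|f_ k p| <= M) ->
  (forall p, cylinder T p -> p.1 != c1 -> p.1 != c2 -> p.1 != c3 ->
    f_ k p @[k --> \oo] --> f p) ->
  \int[Leb]_(p in cylinder T) f_ k p @[k --> \oo] --> \int[Leb]_(p in cylinder T) f p.
Proof.
move=> bf mf fM ff; have mD := mcyl T.
have [i1 _ i3] : [/\ Leb.-integrable (cylinder T) (EFin \o f),
    (\int[Leb]_(x in cylinder T) `|(EFin \o f_ n) x - (EFin \o f) x| @[n --> \oo] --> 0)%E &
    (\int[Leb]_(x in cylinder T) (EFin \o f_ n) x @[n --> \oo] -->
     \int[Leb]_(x in cylinder T) (EFin \o f) x)%E].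
  apply: (@dominated_convergence _ _ _ Leb (cylinder T) mD (fun k => EFin \o f_ k) _ (fun=> M%:E)).
  - by move=> k; apply/measurable_EFinP; case: (bf k).
  - exact/measurable_EFinP.
  - have mt (c : R) : measurable ([set p | p.1 = c] : set spacetime).
      rewrite (_ : [set p | _] = setT `&` fst @^-1` [set c]); last by rewrite setTI.
      by apply: measurable_fst => //; exact: measurable_set1R.
    exists ([set p | p.1 = c1] `|` [set p | p.1 = c2] `|` [set p | p.1 = c3]); split.
    + by do 2?apply: measurableU; exact: mt.
    + apply/eqP; rewrite eq_le measure_ge0 andbT.
      apply: (le_trans (measureU2 _ _ _)); [by apply: measurableU; exact: mt|exact: mt|].
      rewrite [X in (_ + X)%E]Leb_time_null adde0.
      apply: (le_trans (measureU2 _ _ _)); [exact: mt|exact: mt|].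
      by rewrite [X in (X + _)%E]Leb_time_null [X in (_ + X)%E]Leb_time_null adde0.
    + move=> p /= np; apply: contrapT => nU; apply: np => Dp.
      apply: cvg_EFin; first exact: nearW.
      by apply: ff => //; apply/eqP => e; apply: nU; [left; left|left; right|right].
  - by apply: (Leb_integrable (T := T)) => //; exact: bmeas_cst.
  - by apply: aeW => p Dp k; rewrite /= lee_fin fM.
by apply: fine_cvg; rewrite fineK//; exact: integrable_fin_num.
Qed.

Lemma Rintegral_sub (mu : {measure set spacetime -> \bar R}) (D A : set spacetime) (f : spacetime -> R) :
  A `<=` D -> \int[mu]_(p in D) (\1_A p * f p) = \int[mu]_(p in A) f p.
Proof.
move=> AD; rewrite Rintegral_mkcond [RHS]Rintegral_mkcond; apply: eq_Rintegral => p _.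
rewrite !patchE indicE; case: (boolP (p \in A)) => pA; rewrite ?mul1r ?mul0r; last by case: ifP.
by rewrite mem_set//; apply: AD; rewrite inE in pA.
Qed.

(** [is_derive_tail] stops short of the endpoint T; a tail taken up to T + 1, shifted by a constant,
    has the same values and is differentiable at T as well. *)
Lemma tail_continuous_ext T (h : R -> R) : continuous h -> 0 <= T -> exists K : R -> R,
  (forall t, 0 <= t <= T -> {for t, continuous K}) /\
  forall t, 0 <= t <= T -> tail T h t = K t.
Proof.
move=> ch T0; pose K (t : R) := tail (T + 1) h t - tail (T + 1) h T.
exists K; split.
  move=> t /andP[t0 tT]; apply: cvgB; last exact: cvg_cst.
  have tT1 : t < T + 1 by lra.
  exact: (is_derive_continuous (is_derive_tail ch tT1)).
move=> t /andP[t0 tT]; rewrite /K /tail.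
have I := continuous_itv_integrable t (T + 1) ch.
have bT : (BLeft t <= BRight T)%O by rewrite bnd_simp.
have bT1 : (BRight T <= BRight (T + 1))%O by rewrite bnd_simp lerDl.
have := Rintegral_itvB I bT bT1; rewrite Rintegral_itv_obnd_cbnd.
  by move=> <-; ring.
apply: integrableS (continuous_itv_integrable T (T + 1) ch) => //.
exact: subset_itv_oc_cc.
Qed.

Lemma bmeas_tail T (h : R -> R) : continuous h -> 0 <= T ->
  bmeas (cylinder T : set spacetime) (fun p => tail T h p.1).
Proof.
move=> ch T0; have [K [cK KE]] := tail_continuous_ext ch T0.
by apply: bmeas_ext (bmeas_time cK) => p /cylinder_strip/KE.
Qed.

(** * Limits of integrals along the polynomial cut-offs *)

Section cutoff.
Variables (T T1 : R) (w w' : R -> R) (G : nat -> {poly R}) (M : R).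
Hypotheses (T1_bounds : 0 < T1 < T)
  (cw : forall t, 0 <= t <= T1 -> {for t, continuous w} /\ {for t, continuous w'})
  (GM : forall n t, 0 <= t <= T -> `|(G n).[t]| <= M /\ `|(G n)^`().[t]| <= M)
  (Gw : forall t, 0 <= t <= T ->
    (G n).[t] @[n --> \oo] --> (if t <= T1 then w t else 0))
  (Gw' : forall t, 0 < t < T -> t != T1 ->
    (G n)^`().[t] @[n --> \oo] --> (if t <= T1 then w' t else 0)).

Let T1T : T1 <= T. Proof. by case/andP: T1_bounds => _ /ltW. Qed.
Let C1T : cylinder T1 `<=` (cylinder T : set spacetime). Proof. exact: cylinderS. Qed.

Lemma bmeas_w : bmeas (cylinder T1 : set spacetime) (fun p => w p.1).
Proof. by apply: bmeas_time => t /cw[]. Qed.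

Lemma bmeas_w' : bmeas (cylinder T1 : set spacetime) (fun p => w' p.1).
Proof. by apply: bmeas_time => t /cw[]. Qed.

Let bG n : bmeas (cylinder T : set spacetime) (fun p => (G n).[p.1]).
Proof. by apply: bmeas_time => t _; exact: continuous_horner. Qed.

Let bG' n : bmeas (cylinder T : set spacetime) (fun p => (G n)^`().[p.1]).
Proof. by apply: bmeas_time => t _; exact: continuous_horner. Qed.

Let ind p : cylinder T p -> (p.1 <= T1) = (p \in (cylinder T1 : set spacetime)).
Proof.
move=> [/=]; rewrite in_itv/= => /andP[p0 pT] pc; apply/idP/idP.
  by move=> pT1; rewrite inE; split => //=; rewrite in_itv/= p0.
by rewrite inE => -[/=]; rewrite in_itv/= => /andP[].
Qed.

Let lim_ind (c : R -> R) (p : spacetime) (f : spacetime -> R) : cylinder T p ->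
  (if p.1 <= T1 then c p.1 else 0) * f p = \1_(cylinder T1 : set spacetime) p * (c p.1 * f p).
Proof. by move=> Dp; rewrite (ind Dp) indicE; case: ifP; rewrite ?mul1r ?mul0r. Qed.

(** The values converge at every time, including [T1], which is what an arbitrary charge demands. *)
Lemma charge_int_cutoff (nu : {charge set spacetime -> \bar R}) f :
  bmeas (cylinder T) f ->
  charge_int nu (cylinder T) (fun p => (G n).[p.1] * f p) @[n --> \oo] -->
  charge_int nu (cylinder T1) (fun p => w p.1 * f p).
Proof.
move=> bf; have bf1 := bmeasW (mcyl T) C1T bf.
have bwf := bmeasM bmeas_w bf1.
rewrite (charge_int_sub nu (mcyl T) (mcyl T1) C1T bwf).
have [_ [K fK]] := bf.
apply: (@charge_int_cvg _ _ _ _ _ _ _ (`|M| * K) (mcyl T)).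
- by move=> n; exact: bmeasM.
- by case: (bmeas_restrict (mcyl T) (mcyl T1) C1T bwf).
- move=> n p Dp; rewrite normrM ler_pM ?fK//.
  have [h _] := GM n (cylinder_strip Dp).
  by rewrite (le_trans h)// ler_norm.
- move=> p Dp; rewrite -lim_ind//; apply: cvgM; last exact: cvg_cst.
  exact: (Gw (cylinder_strip Dp)).
Qed.

Lemma Rintegral_cutoff (f : spacetime -> R) : bmeas (cylinder T) f ->
  \int[Leb]_(p in cylinder T) ((G n).[p.1] * f p) @[n --> \oo] -->
  \int[Leb]_(p in cylinder T1) (w p.1 * f p).
Proof.
move=> bf; have bf1 := bmeasW (mcyl T) C1T bf.
have bwf := bmeasM bmeas_w bf1.
rewrite -(Rintegral_sub _ _ C1T); have [_ [K fK]] := bf.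
apply: (@Rintegral_Leb_cvg _ _ _ (`|M| * K) 0 0 0).
- by move=> n; exact: bmeasM.
- by case: (bmeas_restrict (mcyl T) (mcyl T1) C1T bwf).
- move=> n p Dp; rewrite normrM ler_pM ?fK//.
  have [h _] := GM n (cylinder_strip Dp).
  by rewrite (le_trans h)// ler_norm.
- move=> p Dp _ _ _; rewrite -lim_ind//; apply: cvgM; last exact: cvg_cst.
  exact: (Gw (cylinder_strip Dp)).
Qed.

(** Restricted to dx dt because the derivatives are not known to converge on the slices 0, [T1] and
    T. *)
Lemma Rintegral_cutoff' (f : spacetime -> R) : bmeas (cylinder T) f ->
  \int[Leb]_(p in cylinder T) ((G n)^`().[p.1] * f p) @[n --> \oo] -->
  \int[Leb]_(p in cylinder T1) (w' p.1 * f p).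
Proof.
move=> bf; have bf1 := bmeasW (mcyl T) C1T bf.
have bwf := bmeasM bmeas_w' bf1.
rewrite -(Rintegral_sub _ _ C1T); have [_ [K fK]] := bf.
apply: (@Rintegral_Leb_cvg _ _ _ (`|M| * K) 0 T T1).
- by move=> n; exact: bmeasM.
- by case: (bmeas_restrict (mcyl T) (mcyl T1) C1T bwf).
- move=> n p Dp; rewrite normrM ler_pM ?fK//.
  have [_ h] := GM n (cylinder_strip Dp).
  by rewrite (le_trans h)// ler_norm.
- move=> p Dp p0 pT pT1; rewrite -lim_ind//; apply: cvgM; last exact: cvg_cst.
  have /andP[q0 qT] := cylinder_strip Dp.
  by apply: (Gw' _ pT1); rewrite !lt_neqAle eq_sym p0 q0 pT qT.
Qed.

Lemma pairing_cutoff m k (mu : mx_charge spacetime m k) (f : spacetime -> 'M[R]_(m, k)) :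
  (forall i j, bmeas (cylinder T) (fun p => f p i j)) ->
  pairing (cylinder T) (fun p => (G n).[p.1] *: f p) mu @[n --> \oo] -->
  pairing (cylinder T1) (fun p => w p.1 *: f p) mu.
Proof.
move=> bf; rewrite /pairing; apply: cvg_sum_seq => i; apply: cvg_sum_seq => j.
rewrite (_ : (fun p => (w p.1 *: f p) i j) = (fun p => w p.1 * f p i j)); last first.
  by apply/funext => p; rewrite mxE.
under eq_fun do under eq_charge_int do rewrite mxE.
exact: charge_int_cutoff.
Qed.

End cutoff.

Lemma charge_sum (I : eqType) (r : seq I) (D : set spacetime) (nu : I -> {charge set spacetime -> \bar R}) :
  measurable D -> exists nu' : {charge set spacetime -> \bar R},
    (forall A, measurable A -> fine (nu' A) = \sum_(i <- r) fine (nu i A)) /\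
    (forall f, bmeas D f -> charge_int nu' D f = \sum_(i <- r) charge_int (nu i) D f).
Proof.
move=> mD; elim: r => [|i r [nu' [H1 H2]]].
  exists czero; split => [A _|f bf]; rewrite big_nil//.
  by rewrite (@charge_int_lin _ _ _ czero czero czero D 0 0)// => *; rewrite /czero/=; ring.
exists (cadd (nu i) nu'); split => [A mA|f bf]; rewrite big_cons.
  by rewrite -H1// -fineD// fin_num_measure.
rewrite -H2// (@charge_int_lin _ _ _ (cadd (nu i) nu') (nu i) nu' D 1 1)//; first by ring.
by move=> A mA AD; rewrite [LHS]fineD ?fin_num_measure//; ring.
Qed.

Lemma mx_charge_density m k (nu : mx_charge spacetime m k) (D : set spacetime) (g : spacetime -> R) :
  measurable D -> bmeas D g -> exists nu' : mx_charge spacetime m k,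
  [/\ measures_on D nu',
      forall i j A, measurable A -> A `<=` D -> fine (nu' i j A) = charge_int (nu i j) A g &
      forall i j A f, measurable A -> A `<=` D -> bmeas D f ->
        charge_int (nu' i j) A f = charge_int (nu i j) A (fun p => g p * f p)].
Proof.
move=> mD bg.
have /choice[c Hc] : forall ij : 'I_m * 'I_k, exists nu' : {charge set spacetime -> \bar R},
    [/\ forall A, measurable A -> nu' A = nu' (A `&` D),
        forall A, measurable A -> A `<=` D -> fine (nu' A) = charge_int (nu ij.1 ij.2) A g &
        forall f, bmeas D f ->
          charge_int nu' D f = charge_int (nu ij.1 ij.2) D (fun p => f p * g p)].
  by move=> ij; exact: charge_density.
exists (\matrix_(i, j) c (i, j)); split.
- by move=> i j A mA; rewrite mxE; have [H _ _] := Hc (i, j); exact: H.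
- by move=> i j A mA AD; rewrite mxE; have [_ H _] := Hc (i, j); exact: H.
- move=> i j A f mA AD bf; rewrite mxE; have [_ _ H] := Hc (i, j).
  rewrite (charge_int_sub _ mD mA AD (bmeasW mD AD bf)) H; last first.
    by apply: bmeas_restrict => //; exact: bmeasW bf.
  rewrite /= (charge_int_sub (nu i j) mD mA AD); last first.
    by apply: bmeasM; [exact: bmeasW bg|exact: bmeasW bf].
  by apply: eq_charge_int => p _; ring.
Qed.

End spacetime_integrals.

(** * Reweighting the strong solution *)

Section cylinder_measures.
Context {R : realType} {d : nat}.
Local Notation space := 'rV[R]_d.
Local Notation spacetime := (R * 'rV[R]_d)%type.
Local Notation mcyl := (@measurable_cylinder R d).

Lemma smooth_bmeas T m k (Phi : spacetime -> 'M[R]_(m, k)) i j : smooth Phi ->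
  bmeas (cylinder T) (fun p => Phi p i j).
Proof.
move=> sPhi; apply: continuous_bmeas; apply: continuous_subspaceT.
exact: continuous_entry (smooth_continuous sPhi).
Qed.

Lemma pairing_supp (D D' : set spacetime) m k (f : spacetime -> 'M[R]_(m, k)) mu :
  measurable D -> measurable D' -> D `<=` D' -> measures_on D mu ->
  (forall i j, bmeas D' (fun p => f p i j)) -> pairing D' f mu = pairing D f mu.
Proof.
move=> mD mD' DD' Dmu bf; apply: eq_bigr => i _; apply: eq_bigr => j _.
by apply: charge_int_supp => //; exact: Dmu.
Qed.

Lemma measures_onS (D D' : set spacetime) m k (mu : mx_charge (R := R) spacetime m k) :
  measurable D' -> D `<=` D' -> measures_on D mu -> measures_on D' mu.
Proof.
move=> mD' DD' H i j A mA; rewrite H// [RHS]H; last exact: measurableI.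
by rewrite -setIA (setIidr DD').
Qed.

Lemma CTXS (T1 T : R) m k (f : spacetime -> 'M[R]_(m, k)) : T1 <= T ->
  CTX T m k f -> CTX T1 m k f.
Proof.
move=> T1T [cf pf]; split; first exact: continuous_subspaceW (stripS T1T) cf.
by move=> t /andP[t0 tT]; apply: pf; rewrite t0 (le_trans tT).
Qed.

Lemma charge_int_cadd (nu1 nu2 : {charge set spacetime -> \bar R}) D f :
  measurable D -> bmeas D f ->
  charge_int (cadd nu1 nu2) D f = charge_int nu1 D f + charge_int nu2 D f.
Proof.
move=> mD bf; rewrite (@charge_int_lin _ _ _ (cadd nu1 nu2) nu1 nu2 D 1 1) ?mul1r//.
by move=> A mA AD; rewrite [LHS]fineD ?fin_num_measure// !mul1r.
Qed.

Lemma pairing_mx_charge_sub (D : set spacetime) m k (f : spacetime -> 'M[R]_(m, k)) mu nu :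
  measurable D -> (forall i j, bmeas D (fun p => f p i j)) ->
  pairing D f (mx_charge_sub mu nu) = pairing D f mu - pairing D f nu.
Proof.
move=> mD bf; rewrite /pairing -sumrB; apply: eq_bigr => i _.
rewrite -sumrB; apply: eq_bigr => j _; rewrite mxE.
rewrite (@charge_int_lin _ _ _ _ (mu i j) (nu i j) D 1 (-1)) ?mul1r ?mulN1r//.
move=> A mA AD; rewrite [LHS]fineD ?fin_num_measure//.
by rewrite /copp fineN mul1r mulN1r.
Qed.

Lemma measures_on_sub (D : set spacetime) m k (mu nu : mx_charge (R := R) spacetime m k) :
  measures_on D mu -> measures_on D nu -> measures_on D (mx_charge_sub mu nu).
Proof.
move=> H1 H2 i j A mA; rewrite mxE /= /cadd /= /copp.
by congr (_ + - _)%E; [exact: H1|exact: H2].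
Qed.

Lemma bmeas_frob (D : set spacetime) m k (f g : spacetime -> 'M[R]_(m, k)) :
  (forall i j, bmeas D (fun p => f p i j)) -> (forall i j, bmeas D (fun p => g p i j)) ->
  bmeas D (fun p => frob (f p) (g p)).
Proof.
by move=> bf bg; apply: bmeas_sum => i; apply: bmeas_sum => j; exact: bmeasM.
Qed.

(** Realizes a h I dx dt + b B as an actual matrix of charges, so that [pairing_psd_ge0] applies to
    it. *)
Lemma shifted_charge T (D : set spacetime) N (h : spacetime -> R) (a b : R)
    (B : mx_charge (R := R) spacetime N N) : measurable D -> D `<=` cylinder T -> bmeas D h ->
  exists nu : mx_charge (R := R) spacetime N N,
    (forall A, measurable A -> A `<=` D ->
      mass nu A = (a * \int[Leb]_(p in A) h p)%:M + b *: mass B A) /\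
    forall G : spacetime -> 'M[R]_N, (forall i j, bmeas D (fun p => G p i j)) ->
      pairing D G nu = a * \int[Leb]_(p in D) (h p * \tr (G p)) + b * pairing D G B.
Proof.
move=> mD DT bh.
have [ka [_ k2 k3]] := measure_density mD (Leb_cylinderS_fin mD DT) bh.
pose nu : mx_charge (R := R) spacetime N N :=
  \matrix_(i, j) (cadd (cscale (a * (i == j)%:R) ka) (cscale b (B i j))
    : {charge set spacetime -> \bar R}).
have nuE i j A : measurable A ->
    fine (nu i j A) = a * (i == j)%:R * fine (ka A) + b * fine (B i j A).
  move=> mA; rewrite mxE [LHS]fineD.
  - by rewrite /cscale !fineM ?fin_num_measure.
  - by rewrite /cscale fin_numM ?fin_num_measure.
  - by rewrite /cscale fin_numM ?fin_num_measure.
exists nu; split.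
  move=> A mA AD; apply/matrixP => i j; rewrite mxE nuE// k2// !mxE mulr_natr.
  by case: (i == j); rewrite ?mulr1 ?mulr0 ?mul0r.
move=> G bG; rewrite /pairing.
transitivity (\sum_i \sum_j (a * (i == j)%:R * \int[Leb]_(p in D) (G p i j * h p) +
    b * charge_int (B i j) D (fun p => G p i j))).
  apply: eq_bigr => i _; apply: eq_bigr => j _; rewrite -k3//.
  by apply: charge_int_lin => // A mA AD; exact: nuE.
under eq_bigr do rewrite big_split -mulr_sumr /=.
rewrite big_split -mulr_sumr/=; congr (_ + _).
have I i : Leb.-integrable D (EFin \o (fun p => h p * G p i i)).
  by apply: (Leb_integrable mD DT); exact: bmeasM.
have -> : \int[Leb]_(p in D) (h p * \tr (G p)) = \sum_i \int[Leb]_(p in D) (h p * G p i i).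
  rewrite /mxtrace; under eq_Rintegral do rewrite mulr_sumr.
  elim: (index_enum _) => [|i r IH].
    under eq_Rintegral do rewrite big_nil.
    by rewrite big_nil /Rintegral integral0.
  under eq_Rintegral do rewrite big_cons.
  rewrite big_cons -IH RintegralD//.
  by apply: (Leb_integrable mD DT); apply: bmeas_sum => j; exact: bmeasM.
rewrite mulr_sumr; apply: eq_bigr => i _.
rewrite (bigD1 i)//= big1 ?addr0.
  rewrite eqxx mulr1; congr (_ * _); apply: eq_Rintegral => p _; exact: mulrC.
by move=> j ji; rewrite eq_sym (negbTE ji) mulr0 mul0r.
Qed.

Lemma scalar_quad N (c : R) (u : 'rV[R]_N) :
  (u *m c%:M *m u^T) ord0 ord0 = c * \tr (u^T *m u).
Proof.
rewrite mul_mx_scalar -scalemxAl mxE; congr (_ * _).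
by rewrite mxtrace_mulC /mxtrace big_ord1.
Qed.

Lemma tr_outer_ge0 N (u : 'rV[R]_N) : 0 <= \tr (u^T *m u).
Proof. by apply: sumr_ge0 => i _; rewrite mxE big_ord1 mxE -expr2 sqr_ge0. Qed.

End cylinder_measures.

(** * Restriction to [0, T1] and the reweighted measures *)

Section restriction.
Context {R : realType} {d n N Z : nat} (P : problem R d n N Z) (PS : setting P).
Local Notation space := 'rV[R]_d.
Local Notation spacetime := (R * 'rV[R]_d)%type.
Local Notation mcyl := (@measurable_cylinder R d).
Variables (v0 : space -> 'rV[R]_n) (v0_cont : CX 1 n v0) (T : R) (h0 : R -> R)
  (v : spacetime -> 'rV[R]_n)
  (Dv : mx_charge (R := R) spacetime 1 n) (Lv : mx_charge (R := R) spacetime N N)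
  (Hpi : mx_charge (R := R) spacetime 1 Z) (HApi : mx_charge (R := R) spacetime 1 n)
  (Hs : strong_solution P T h0 v0 v Dv Lv Hpi HApi)
  (T1 : R) (T1_bounds : 0 < T1 < T).

Let T1T : T1 <= T. Proof. by case/andP: T1_bounds => _ /ltW. Qed.
Let T0 : 0 <= T. Proof. by case/andP: T1_bounds => ? ?; lra. Qed.
Let C1T : cylinder T1 `<=` (cylinder T : set spacetime). Proof. exact: cylinderS. Qed.

Lemma v0_bmeas T' i j : bmeas (cylinder T' : set spacetime) (fun p => v0 p.2 i j).
Proof.
apply: continuous_bmeas; apply: continuous_subspaceT => p.
apply: (@continuous_comp _ _ _ snd (fun x => v0 x i j)); first exact: cvg_snd.
by apply: continuous_entry; case: v0_cont.
Qed.

Lemma admissibleS : admissible P T v -> admissible P T1 v.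
Proof.
move=> [cv vF cF]; split; [exact: CTXS cv| |exact: CTXS cF].
by move=> p /(stripS T1T); exact: vF.
Qed.

(** Extension by zero: a test function for [0, T] is also one for [0, T1], and the pairings see only
    the shorter cylinder. Weak solutions therefore restrict. *)
Lemma LCS (E : mx_charge (R := R) spacetime 1 n) (B : mx_charge (R := R) spacetime N N) :
  LC P T1 E B -> LC P T E B.
Proof.
move=> [HE [HB sB] H]; split.
- exact: (measures_onS (mcyl T) C1T HE).
- by split => //; exact: (measures_onS (mcyl T) C1T HB).
- move=> Psi SPsi kPsi Psi0.
  have [_ [sL _]] := (proj1 (L_spatial PS)) _ SPsi.
  rewrite (pairing_supp (mcyl T1) (mcyl T) C1T HB); last first.
    by move=> i j; apply: smooth_bmeas; apply: smooth_derive; case: SPsi.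
  rewrite (pairing_supp (mcyl T1) (mcyl T) C1T HE); last first.
    by move=> i j; exact: smooth_bmeas.
  apply: H => // t /andP[t0 tT]; apply: kPsi.
  by rewrite t0 (le_trans tT).
Qed.

Lemma weak_solutionS : weak_solution P T v0 v -> weak_solution P T1 v0 v.
Proof.
move=> [adm H]; split; first exact: admissibleS.
move=> E B EB; have := H _ _ (LCS EB); have [HE [HB _] _] := EB.
have [cv _ cF] := adm.
rewrite (pairing_supp (mcyl T1) (mcyl T) C1T HB); last first.
  by move=> i j; exact: CTX_bmeas.
rewrite (pairing_supp (mcyl T1) (mcyl T) C1T HE)// => i j.
have := bmeasB (CTX_bmeas i j cv) (v0_bmeas T i j).
by apply: bmeas_ext => p _; rewrite !mxE.
Qed.

Let vO p : strip T p -> (F_dom P)^° (v p). Proof. exact: (strong_interior Hs). Qed.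
Let cv : CTX T 1 n v. Proof. by case: (strong_weak Hs) => -[]. Qed.

Let bsharp i l : bmeas (cylinder T) (fun p => sharp P (v p) i l).
Proof.
by rewrite (ord1 i); exact: (bmeas_sharp PS cv vO).
Qed.

Let ch0 : continuous h0.
Proof. by case: (strong_weight Hs) => /smooth_continuous. Qed.

Let bH0 : bmeas (cylinder T : set spacetime) (fun p => tail T h0 p.1).
Proof. exact: bmeas_tail. Qed.

Section weighted.
Variables (h1 : R -> R) (w w' : R -> R) (G : nat -> {poly R}) (M : R)
  (Dv1 : mx_charge (R := R) spacetime 1 n) (Lv1 : mx_charge (R := R) spacetime N N)
  (Hpi1 : mx_charge (R := R) spacetime 1 Z) (HApi1 : mx_charge (R := R) spacetime 1 n).
Hypotheses
  (Hw : forall t, 0 <= t <= T1 ->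
        [/\ w t = tail T1 h1 t / tail T h0 t,
            w' t * tail T h0 t = w t * h0 t - h1 t & 0 <= w t])
  (cw : forall t, 0 <= t <= T1 -> {for t, continuous w} /\ {for t, continuous w'})
  (GM : forall n t, 0 <= t <= T -> `|(G n).[t]| <= M /\ `|(G n)^`().[t]| <= M)
  (Gw : forall t, 0 <= t <= T ->
    (G n).[t] @[n --> \oo] --> (if t <= T1 then w t else 0))
  (Gw' : forall t, 0 < t < T -> t != T1 ->
    (G n)^`().[t] @[n --> \oo] --> (if t <= T1 then w' t else 0)).

Let H0w t : 0 <= t <= T1 -> w t * tail T h0 t = tail T1 h1 t.
Proof.
move=> tT; have [-> _ _] := Hw tT; rewrite divfK// gt_eqF//.
apply: (tail_gt0 (strong_weight Hs)); case/andP: tT => -> tT1.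
by case/andP: T1_bounds => _; exact: le_lt_trans.
Qed.

(** States that nu' = w nu on the shorter cylinder, through values and integrals, which makes the
    sequel independent of how the density is constructed. *)
Definition reweighted m k (nu nu' : mx_charge (R := R) spacetime m k) :=
  [/\ measures_on (cylinder T1) nu',
      forall i j A, measurable A -> A `<=` cylinder T1 ->
        fine (nu' i j A) = charge_int (nu i j) A (fun p => w p.1) &
      forall i j A f, measurable A -> A `<=` cylinder T1 -> bmeas (cylinder T1) f ->
        charge_int (nu' i j) A f = charge_int (nu i j) A (fun p => w p.1 * f p)].

Lemma reweighted_pairing m k (nu nu' : mx_charge (R := R) spacetime m k)
    (f : spacetime -> 'M[R]_(m, k)) :
  reweighted nu nu' -> (forall i j, bmeas (cylinder T1) (fun p => f p i j)) ->
  pairing (cylinder T1) f nu' = pairing (cylinder T1) (fun p => w p.1 *: f p) nu.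
Proof.
move=> [_ _ H] bf; apply: eq_bigr => i _; apply: eq_bigr => j _.
rewrite H//; last exact: mcyl.
by apply: eq_charge_int => p _; rewrite mxE.
Qed.

(** The identity on [0, T] is tested with G_k(t) Phi, where G_k passes through [L], and both sides
    converge; w H = H1 then gives the new tail. *)
Lemma reweighted_L : reweighted Lv Lv1 -> forall Phi, smooth_in (CX_sym N) Phi ->
  pairing (cylinder T1) Phi Lv1 = \int[Leb]_(p in cylinder T1)
    (tail T1 h1 p.1 * frob (slicewise (L_op P) Phi p) (sharp P (v p))).
Proof.
move=> H Phi SPhi; have [sPhi _] := SPhi.
have [Ldom [sL _]] := (proj1 (L_spatial PS)) _ SPhi.
rewrite (reweighted_pairing H); last by move=> i j; exact: smooth_bmeas.
have l1 := pairing_cutoff (mu := Lv) T1_bounds cw GM Gw (fun i j => smooth_bmeas T i j sPhi).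
pose f (p : spacetime) := tail T h0 p.1 * frob (slicewise (L_op P) Phi p) (sharp P (v p)).
have bf : bmeas (cylinder T) f.
  by apply: bmeasM => //; apply: bmeas_frob => // i j; exact: smooth_bmeas.
have l2 := Rintegral_cutoff T1_bounds cw GM Gw bf.
have E k : pairing (cylinder T) (fun p => (G k).[p.1] *: Phi p) Lv =
    \int[Leb]_(p in cylinder T) ((G k).[p.1] * f p).
  rewrite (strong_L Hs); last by apply: smooth_in_time_poly => //; exact: CX_symZ.
  apply: eq_Rintegral => p _; rewrite (slicewise_scale (horner (G k)) (L_linear PS) Ldom).
  by rewrite frobZl /f mulrCA.
rewrite (_ : (fun k => _) = (fun k => \int[Leb]_(p in cylinder T) ((G k).[p.1] * f p))) in l1; last first.
  by apply/funext => k; exact: E.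
rewrite (cvg_unique _ l1 l2)//; apply: eq_Rintegral => p; rewrite inE => Dp.
by rewrite /f mulrA H0w//; exact: (cylinder_strip Dp).
Qed.

Lemma reweighted_Api : reweighted Hpi Hpi1 -> reweighted HApi HApi1 ->
  forall phi, smooth_in (CX 1 n) phi ->
  pairing (cylinder T1) phi HApi1 = pairing (cylinder T1) (slicewise (A_op P) phi) Hpi1.
Proof.
move=> H1 H2 phi Sphi; have [sphi _] := Sphi.
have [Adom [sA _]] := (proj1 (A_spatial PS)) _ Sphi.
rewrite (reweighted_pairing H2); last by move=> i j; exact: smooth_bmeas.
rewrite (reweighted_pairing H1); last by move=> i j; exact: smooth_bmeas.
have l1 := pairing_cutoff (mu := HApi) T1_bounds cw GM Gw (fun i j => smooth_bmeas T i j sphi).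
have l2 := pairing_cutoff (mu := Hpi) T1_bounds cw GM Gw (fun i j => smooth_bmeas T i j sA).
rewrite (_ : (fun k => _) = (fun k => pairing (cylinder T)
    (fun p => (G k).[p.1] *: slicewise (A_op P) phi p) Hpi)) in l1; last first.
  apply/funext => k; rewrite (strong_Api Hs); last by apply: smooth_in_time_poly => //; exact: CXZ.
  by rewrite (slicewise_scale (horner (G k)) (A_linear PS) Adom).
exact: (cvg_unique _ l1 l2).
Qed.

(** The product rule for d/dt (w H v^#): the summand [a] is w d/dt (H v^#) and [b] is w' H v^# dx
    dt. *)
Definition reweighted_dt_charge (D' : mx_charge (R := R) spacetime 1 n) :=
  forall i j, exists a b : {charge set spacetime -> \bar R},
  [/\ D' i j = cadd a b,
      (forall A, measurable A -> a A = a (A `&` cylinder T1)) /\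
      (forall A, measurable A -> b A = b (A `&` cylinder T1)),
      forall A, measurable A -> A `<=` cylinder T1 ->
        fine (a A) = charge_int (Dv i j) A (fun p => w p.1),
      forall f, bmeas (cylinder T1) f -> charge_int a (cylinder T1) f =
        charge_int (Dv i j) (cylinder T1) (fun p => w p.1 * f p) &
      (forall A, measurable A -> A `<=` cylinder T1 -> fine (b A) =
        \int[Leb]_(p in A) (w' p.1 * tail T h0 p.1 * sharp P (v p) i j)) /\
      (forall f, bmeas (cylinder T1) f -> charge_int b (cylinder T1) f =
        \int[Leb]_(p in cylinder T1) (f p * (w' p.1 * tail T h0 p.1 * sharp P (v p) i j)))].

Let bc i j : bmeas (cylinder T1) (fun p => w' p.1 * tail T h0 p.1 * sharp P (v p) i j).
Proof.
apply: bmeasM; last exact: bmeasW (mcyl T) C1T _.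
apply: bmeasM; last exact: bmeasW (mcyl T) C1T _.
exact: bmeas_w' cw.
Qed.

Lemma reweighted_dt_exists : exists D' : mx_charge (R := R) spacetime 1 n, reweighted_dt_charge D'.
Proof.
have /choice[ab Hab] : forall ij : 'I_1 * 'I_n, exists ab : {charge set spacetime -> \bar R} * {charge set spacetime -> \bar R},
  [/\ (forall A, measurable A -> ab.1 A = ab.1 (A `&` cylinder T1)) /\
      (forall A, measurable A -> ab.2 A = ab.2 (A `&` cylinder T1)),
      forall A, measurable A -> A `<=` cylinder T1 ->
        fine (ab.1 A) = charge_int (Dv ij.1 ij.2) A (fun p => w p.1),
      forall f, bmeas (cylinder T1) f -> charge_int ab.1 (cylinder T1) f =
        charge_int (Dv ij.1 ij.2) (cylinder T1) (fun p => w p.1 * f p) &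
      (forall A, measurable A -> A `<=` cylinder T1 -> fine (ab.2 A) =
        \int[Leb]_(p in A) (w' p.1 * tail T h0 p.1 * sharp P (v p) ij.1 ij.2)) /\
      (forall f, bmeas (cylinder T1) f -> charge_int ab.2 (cylinder T1) f =
        \int[Leb]_(p in cylinder T1) (f p * (w' p.1 * tail T h0 p.1 * sharp P (v p) ij.1 ij.2)))].
  move=> [i j].
  have [a [a1 a2 a3]] := charge_density (Dv i j) (mcyl T1) (bmeas_w cw).
  have [b [b1 b2 b3]] := measure_density (mcyl T1) (Leb_cylinder_fin T1) (bc i j).
  exists (a, b); split => //=.
  by move=> f bf; rewrite a3//; apply: eq_charge_int => p _; exact: mulrC.
exists (\matrix_(i, j) (cadd (ab (i, j)).1 (ab (i, j)).2 : {charge set spacetime -> \bar R})).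
move=> i j; exists (ab (i, j)).1, (ab (i, j)).2; rewrite mxE.
by have [h1' h2 h3 h4] := Hab (i, j); split.
Qed.

(** Testing with G_k phi, which still vanishes at t = 0, produces a term with G_k' and one with G_k.
    In the limit the first is cancelled by the absolutely continuous part of [Dv1]. *)
Lemma reweighted_dt : reweighted_dt_charge Dv1 -> forall phi, smooth_in (CX 1 n) phi ->
  (forall x, phi (0, x) = 0) ->
  pairing (cylinder T1) phi Dv1 = - \int[Leb]_(p in cylinder T1)
    (tail T1 h1 p.1 * frob (dt phi p) (sharp P (v p))).
Proof.
move=> H phi Sphi phi0; have [sphi _] := Sphi.
have bphi T' i j : bmeas (cylinder T') (fun p => phi p i j) by exact: smooth_bmeas.
pose f (p : spacetime) := tail T h0 p.1 * frob (phi p) (sharp P (v p)).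
pose g (p : spacetime) := tail T h0 p.1 * frob (dt phi p) (sharp P (v p)).
have bf : bmeas (cylinder T) f by apply: bmeasM => //; exact: bmeas_frob.
have bg : bmeas (cylinder T) g.
  apply: bmeasM => //; apply: bmeas_frob => // i j; apply: smooth_bmeas.
  exact: smooth_derive.
have l1 := pairing_cutoff (mu := Dv) T1_bounds cw GM Gw (bphi T).
have l2 := Rintegral_cutoff T1_bounds cw GM Gw bg.
have l3 := Rintegral_cutoff' T1_bounds cw GM Gw' bf.
have bG k : bmeas (cylinder T : set spacetime) (fun p => (G k).[p.1]).
  by apply: bmeas_time => t _; exact: continuous_horner.
have bG' k : bmeas (cylinder T : set spacetime) (fun p => (G k)^`().[p.1]).
  by apply: bmeas_time => t _; exact: continuous_horner.
rewrite (_ : (fun k => _) = (fun k => - (\int[Leb]_(p in cylinder T) ((G k)^`().[p.1] * f p) +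
    \int[Leb]_(p in cylinder T) ((G k).[p.1] * g p)))) in l1; last first.
  apply/funext => k; rewrite (strong_dt Hs); last 2 first.
  - by apply: smooth_in_time_poly => //; exact: CXZ.
  - by move=> x; rewrite phi0 scaler0.
  congr (- _); rewrite -RintegralD//; last 3 first.
  - exact: mcyl.
  - by apply: (Leb_integrable (mcyl T) (@subset_refl _ _)); exact: bmeasM.
  - by apply: (Leb_integrable (mcyl T) (@subset_refl _ _)); exact: bmeasM.
  apply: eq_Rintegral => p _; rewrite dt_time_poly// frobDl !frobZl /f /g; ring.
have E := cvg_unique _ l1 (cvgN (cvgD l3 l2)).
have -> : pairing (cylinder T1) phi Dv1 =
    pairing (cylinder T1) (fun p => w p.1 *: phi p) Dv +
    \int[Leb]_(p in cylinder T1) (w' p.1 * f p).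
  have -> : \int[Leb]_(p in cylinder T1) (w' p.1 * f p) = \sum_i \sum_j
      \int[Leb]_(p in cylinder T1) (phi p i j * (w' p.1 * tail T h0 p.1 * sharp P (v p) i j)).
    rewrite big_ord1.
    have I j : Leb.-integrable (cylinder T1) (EFin \o
        (fun p => phi p ord0 j * (w' p.1 * tail T h0 p.1 * sharp P (v p) ord0 j))).
      by apply: (Leb_integrable (mcyl T1) (@subset_refl _ _)); exact: bmeasM.
    transitivity (\int[Leb]_(p in cylinder T1) \sum_j
        (phi p ord0 j * (w' p.1 * tail T h0 p.1 * sharp P (v p) ord0 j))).
      apply: eq_Rintegral => p _; rewrite /f /frob big_ord1 !mulr_sumr.
      by apply: eq_bigr => j _; ring.
    elim: (index_enum _) => [|j r IH].
      under eq_Rintegral do rewrite big_nil.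
      by rewrite big_nil /Rintegral integral0.
    under eq_Rintegral do rewrite big_cons.
    rewrite big_cons -IH RintegralD//; first exact: mcyl.
    apply: (Leb_integrable (mcyl T1) (@subset_refl _ _)); apply: bmeas_sum => i.
    exact: bmeasM.
  rewrite -big_split; apply: eq_bigr => i _; rewrite -big_split; apply: eq_bigr => j _ /=.
  have [a [b [-> _ _ ha [_ hb]]]] := H i j.
  rewrite charge_int_cadd//; last exact: mcyl.
  rewrite ha// hb//; congr (_ + _).
  by apply: eq_charge_int => p _; rewrite mxE.
rewrite E// opprD addrAC addNr add0r; congr (- _).
apply: eq_Rintegral => p; rewrite inE => Dp.
by rewrite /g mulrA H0w//; exact: (cylinder_strip Dp).
Qed.

End weighted.
End restriction.

Section restricted_solution.
Context {R : realType} {d n N Z : nat} (P : problem R d n N Z) (PS : setting P).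
Local Notation space := 'rV[R]_d.
Local Notation spacetime := (R * 'rV[R]_d)%type.
Local Notation mcyl := (@measurable_cylinder R d).
Variables (v0 : space -> 'rV[R]_n) (v0_cont : CX 1 n v0) (T : R) (h0 : R -> R)
  (v : spacetime -> 'rV[R]_n)
  (Dv : mx_charge (R := R) spacetime 1 n) (Lv : mx_charge (R := R) spacetime N N)
  (Hpi : mx_charge (R := R) spacetime 1 Z) (HApi : mx_charge (R := R) spacetime 1 n)
  (Hs : strong_solution P T h0 v0 v Dv Lv Hpi HApi)
  (T1 : R) (T1_bounds : 0 < T1 < T).

Let T1T : T1 <= T. Proof. by case/andP: T1_bounds => _ /ltW. Qed.
Let C1T : cylinder T1 `<=` (cylinder T : set spacetime). Proof. exact: cylinderS. Qed.

Let vO p : strip T p -> (F_dom P)^° (v p). Proof. exact: (strong_interior Hs). Qed.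
Let cv : CTX T 1 n v. Proof. by case: (strong_weak Hs) => -[]. Qed.

Let bsharp i l : bmeas (cylinder T) (fun p => sharp P (v p) i l).
Proof. by rewrite (ord1 i); exact: (bmeas_sharp PS cv vO). Qed.

Let bdF l i j : bmeas (cylinder T) (fun p => dF P l (v p) i j).
Proof. exact: (bmeas_dF PS cv vO). Qed.

Let ch0 : continuous h0.
Proof. by case: (strong_weight Hs) => /smooth_continuous. Qed.

Let bh0 : bmeas (cylinder T : set spacetime) (fun p => h0 p.1).
Proof. by apply: bmeas_time => t _; exact: ch0. Qed.

Section weighted.
Variables (h1 : R -> R) (w w' : R -> R)
  (Dv1 : mx_charge (R := R) spacetime 1 n) (Lv1 : mx_charge (R := R) spacetime N N)
  (HApi1 : mx_charge (R := R) spacetime 1 n).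
Hypotheses
  (ch1 : continuous h1)
  (Hw : forall t, 0 <= t <= T1 ->
        [/\ w t = tail T1 h1 t / tail T h0 t,
            w' t * tail T h0 t = w t * h0 t - h1 t & 0 <= w t])
  (cw : forall t, 0 <= t <= T1 -> {for t, continuous w} /\ {for t, continuous w'}).

(** The strong equation is an equality of measures on sets; assembling its left side into one charge
    allows any bounded measurable [g] to be integrated against it. *)
Lemma strong_equation_density (l : 'I_n) S (g : spacetime -> R) : measurable S ->
  S `<=` cylinder T -> bmeas S g ->
  \int[Leb]_(p in S) (g p * (h0 p.1 * sharp P (v p) ord0 l)) +
  charge_int (Dv ord0 l) S g + \sum_i \sum_j charge_int (Lv i j) S (fun p => g p * dF P l (v p) i j) =
  charge_int (HApi ord0 l) S g.
Proof.
move=> mS ST bg.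
have bS (f : spacetime -> R) : bmeas (cylinder T) f -> bmeas S f by exact: bmeasW (mcyl T) ST.
have [ka [_ k2 k3]] := measure_density mS (Leb_cylinderS_fin mS ST) (bS _ (bmeasM bh0 (bsharp ord0 l))).
have /choice[la Hla] : forall ij : 'I_N * 'I_N, exists nu' : {charge set spacetime -> \bar R},
    [/\ forall A, measurable A -> nu' A = nu' (A `&` S),
        forall A, measurable A -> A `<=` S ->
          fine (nu' A) = charge_int (Lv ij.1 ij.2) A (fun p => dF P l (v p) ij.1 ij.2) &
        forall f, bmeas S f -> charge_int nu' S f =
          charge_int (Lv ij.1 ij.2) S (fun p => f p * dF P l (v p) ij.1 ij.2)].
  by move=> ij; apply: charge_density => //; exact: bS.
have [nu [nu1 nu2]] := @charge_sum _ _ _ (index_enum ('I_N * 'I_N)%type) S la mS.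
have E : charge_int (HApi ord0 l) S g = charge_int (cadd (cadd ka (Dv ord0 l)) nu) S g.
  apply: eq_charge_int_charge => // A mA AS.
  rewrite -(strong_equation Hs)//; last exact: subset_trans ST.
  rewrite fineD ?fin_num_measure//; congr (_ + _).
    by rewrite fineD ?fin_num_measure// k2.
  rewrite nu1// /pairing pair_big/=; apply: eq_bigr => -[i j] _ /=.
  by have [_ H _] := Hla (i, j); rewrite H.
rewrite E charge_int_cadd// charge_int_cadd// k3// nu2//; congr (_ + _).
rewrite pair_big/=; apply: eq_bigr => -[i j] _ /=.
by have [_ _ H] := Hla (i, j); rewrite H.
Qed.

(** The old equation integrated against w, with w h0 = h1 + w' H: the first part is the new weight
    term and the second joins [Dv1]. *)
Lemma reweighted_equation (l : 'I_n) S : reweighted_dt_charge P T h0 v Dv T1 w w' Dv1 ->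
  reweighted T1 w Lv Lv1 -> reweighted T1 w HApi HApi1 ->
  measurable S -> S `<=` cylinder T1 ->
  \int[Leb]_(p in S) (h1 p.1 * sharp P (v p) ord0 l) + fine (Dv1 ord0 l S) +
    pairing S (fun p => dF P l (v p)) Lv1 = fine (HApi1 ord0 l S).
Proof.
move=> HD [_ _ HL] [_ HA _] mS ST1; have ST := subset_trans ST1 C1T.
have bw := @bmeas_w R d T1 w w' cw.
have bw' := @bmeas_w' R d T1 w w' cw.
have b1S (f : spacetime -> R) : bmeas (cylinder T1) f -> bmeas S f by exact: bmeasW (mcyl T1) ST1.
have bS (f : spacetime -> R) : bmeas (cylinder T) f -> bmeas S f by exact: bmeasW (mcyl T) ST.
rewrite HA// -(strong_equation_density l mS ST (b1S _ bw)).
have -> : pairing S (fun p => dF P l (v p)) Lv1 =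
    \sum_i \sum_j charge_int (Lv i j) S (fun p => w p.1 * dF P l (v p) i j).
  apply: eq_bigr => i _; apply: eq_bigr => j _; apply: HL => //.
  exact: bmeasW (mcyl T) C1T _.
congr (_ + _); have [a [b [DE [_ _] Ha _ [Hb _]]]] := HD ord0 l.
rewrite DE fineD ?fin_num_measure// Ha// Hb// [RHS]addrC addrCA; congr (_ + _).
have bhs : bmeas S (fun p => h1 p.1 * sharp P (v p) ord0 l).
  by apply: bmeasM; [apply: b1S; apply: bmeas_time => t _; exact: ch1|exact: bS].
have bH0 : bmeas (cylinder T : set spacetime) (fun p => tail T h0 p.1).
  by apply: bmeas_tail => //; case/andP: T1_bounds => ? ?; lra.
rewrite -RintegralD//; last 2 first.
- exact: (Leb_integrable mS ST).
- apply: (Leb_integrable mS ST); apply: bmeasM; last exact: bS.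
  by apply: bmeasM; [exact: b1S|exact: bS].
apply: eq_Rintegral => p; rewrite inE => /ST1/cylinder_strip tp.
have [_ -> _] := Hw tp; ring.
Qed.

Lemma reweighted_sym : reweighted T1 w Lv Lv1 -> sym_measures_on (cylinder T1) Lv1.
Proof.
move=> [H1 H2 _]; split => // i j A mA.
have mA1 : measurable (A `&` cylinder T1) by apply: measurableI => //; exact: mcyl.
rewrite H1// [RHS]H1//.
rewrite -[LHS]fineK ?fin_num_measure// -[RHS]fineK ?fin_num_measure//; congr (_%:E).
rewrite !H2//; have [_ sL] := strong_L_measure Hs.
apply: eq_charge_int_charge => //; first by move=> X mX _; rewrite sL.
exact: bmeasW (mcyl T1) (@subIsetr _ _ _) (bmeas_w cw).
Qed.

(** Pairs the nonnegative measure c I dx dt + Lv with the semidefinite function w(t) u^T u. *)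
Lemma reweighted_lower_bound (c : R) A (u : 'rV[R]_N) :
  measure_ge0_on (cylinder T) (fun S => (c * fine (Leb S))%:M + mass Lv S) ->
  reweighted T1 w Lv Lv1 -> measurable A -> A `<=` cylinder T1 ->
  0 <= c * \tr (u^T *m u) * \int[Leb]_(p in A) w p.1 + (u *m mass Lv1 A *m u^T) ord0 ord0.
Proof.
move=> Hc [_ H2 _] mA AT1; have AT := subset_trans AT1 C1T.
have bw : bmeas A (fun p => w p.1) by exact: bmeasW (mcyl T1) AT1 (bmeas_w cw).
have [nu [nu1 nu2]] := shifted_charge c 1 Lv mA AT (bmeas_cst A 1).
pose Q := u^T *m u; pose G (p : spacetime) : 'M[R]_N := w p.1 *: Q.
have bG i j : bmeas A (fun p => G p i j).
  by apply: bmeas_ext (bmeasZ (Q i j) bw) => p _; rewrite [RHS]mxE mulrC.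
have := @pairing_psd_ge0 _ _ _ A mA N G nu bG.
have pG p : A p -> psd (G p).
  move=> /AT1/cylinder_strip/Hw[_ _ w0]; have [q1 q2] := psd_outer u.
  split; first by rewrite linearZ/= q1.
  move=> x; rewrite -scalemxAr -scalemxAl mxE mulr_ge0//; exact: q2.
have nu0 : measure_ge0_on A (mass nu).
  move=> X mX XA; rewrite nu1// scale1r Rintegral_cst// mul1r.
  by apply: Hc => //; exact: subset_trans AT.
move=> /(_ pG nu0); rewrite nu2// mul1r.
have -> : \int[Leb]_(p in A) (1 * \tr (G p)) = \tr Q * \int[Leb]_(p in A) w p.1.
  rewrite -RintegralZl//; last exact: (Leb_integrable mA AT).
  by apply: eq_Rintegral => p _; rewrite mul1r /G linearZ/= mulrC.
rewrite mulrA; congr (0 <= _ + _).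
rewrite psd_entry /pairing; apply: eq_bigr => i _; apply: eq_bigr => j _.
rewrite mxE H2//.
transitivity (Q i j * charge_int (Lv i j) A (fun p => w p.1)).
  by rewrite -charge_intZ//; apply: eq_charge_int => p _; rewrite mxE mulrC.
rewrite mxE big_ord1 mxE; ring.
Qed.

End weighted.

Lemma strong_solution_reweight : exists2 gamma : R, 0 < gamma &
  let h := exp_weight gamma in
  exists (Dv1 : mx_charge (R := R) spacetime 1 n) (Lv1 : mx_charge (R := R) spacetime N N)
    (Hpi1 : mx_charge (R := R) spacetime 1 Z) (HApi1 : mx_charge (R := R) spacetime 1 n),
  [/\ strong_solution P T1 h v0 v Dv1 Lv1 Hpi1 HApi1, same_multiplier T h0 Hpi T1 h Hpi1 &
      measure_ge0_on (cylinder T1) (shifted_measure h Lv1)].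
Proof.
have /andP[T10 T1T'] := T1_bounds.
have [c c0 Hc] := strong_lower_bound Hs.
have [_ [c1 [C1 [c10 Hc1]]]] := strong_weight Hs.
(* A lower bound for the old tail on [0, T1]. *)
pose m := c1 * (T - T1); have m0 : 0 < m by rewrite mulr_gt0// subr_gt0.
(* Chosen so that 2 c <= gamma m; the summand 1 keeps [gamma] positive when c = 0. *)
pose gamma := 2 * c / m + 1.
have gamma0 : 0 < gamma.
  have h : 0 <= 2 * c / m by apply: divr_ge0; [exact: mulr_ge0|exact: ltW].
  by rewrite /gamma; lra.
exists gamma => //; move=> h1.
have [w [w' [G [M [Hw cw GM Gw Gw']]]]] := weight_quotient (strong_weight Hs) T1_bounds gamma0.
have [Dv1 HD] := reweighted_dt_exists PS Hs T1_bounds cw.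
have bw := @bmeas_w R d T1 w w' cw.
have [Lv1 HL] := mx_charge_density Lv (mcyl T1) bw.
have [Hpi1 HP] := mx_charge_density Hpi (mcyl T1) bw.
have [HApi1 HA] := mx_charge_density HApi (mcyl T1) bw.
exists Dv1, Lv1, Hpi1, HApi1.
have ch1 : continuous (h1 : R -> R) by exact: continuous_exp_weight.
have h1_gt0 t : 0 < h1 t by exact: expR_gt0.
have h1_le1 t : 0 <= t -> h1 t <= 1.
  by move=> t0; rewrite /h1 /exp_weight -expR0 ler_expR mulNr oppr_le0 mulr_ge0 // ltW.
have bh1 T' : bmeas (cylinder T' : set spacetime) (fun p => h1 p.1).
  by apply: bmeas_time => t _; exact: ch1.
have sLv1 := reweighted_sym cw HL.
have massT A : measurable A -> (mass Lv1 A)^T = mass Lv1 A.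
  by move=> mA; apply/matrixP => i j; rewrite !mxE; have [_ ->] := sLv1.
(* Dropping h1(T1) from the new tail gives w <= h1 / (gamma m). *)
have wh t : 0 <= t <= T1 -> 2 * c * w t <= h1 t.
  move=> tT; have /andP[t0 tT1] := tT.
  have [-> _ _] := Hw t tT; rewrite tail_exp_weight ?gt_eqF//.
  have tT' : t < T by lra.
  have Hm : m <= tail T h0 t.
    apply: le_trans (tail_ge ch0 (ltW tT') (c := c1) _).
      by rewrite ler_pM2l//; lra.
    by move=> s /andP[s1 s2]; have /andP[] := Hc1 s ltac:(apply/andP; split; lra).
  have H0 : 0 < tail T h0 t by exact: lt_le_trans Hm.
  rewrite mulrA ler_pdivrMr// mulrA ler_pdivrMr//.
  have cm : 2 * c <= gamma * m by rewrite /gamma [leRHS]mulrDl divfK ?gt_eqF// mul1r lerDl ltW.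
  have hT1 := h1_gt0 T1; have ht := h1_gt0 t; rewrite -/h1.
  apply: (@le_trans _ _ (2 * c * h1 t)).
    by rewrite ler_wpM2l ?mulr_ge0// lerBlDr lerDl ltW.
  rewrite mulrC -mulrA ler_pM2l// (le_trans cm)// mulrC ler_pM2r//.
have shifted A (u : 'rV[R]_N) : measurable A -> A `<=` cylinder T1 ->
    0 <= \int[Leb]_(p in A) h1 p.1 * \tr (u^T *m u) + 2 * (u *m mass Lv1 A *m u^T) ord0 ord0.
  move=> mA AT1; have := reweighted_lower_bound Hw cw u Hc HL mA AT1.
  have Q0 := tr_outer_ge0 u; set q := \tr _ in Q0 *.
  have AT := subset_trans AT1 C1T.
  have bwA := bmeasW (mcyl T1) AT1 bw.
  have : 2 * c * \int[Leb]_(p in A) w p.1 <= \int[Leb]_(p in A) h1 p.1.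
    rewrite -RintegralZl//; last exact: (Leb_integrable mA AT).
    apply: le_Rintegral => //.
    - by apply: (Leb_integrable mA AT); exact: bmeasZ.
    - by apply: (Leb_integrable mA AT); exact: bmeasW (mcyl T) AT (bh1 T).
    - by move=> p /AT1/cylinder_strip; exact: wh.
  by move=> /(ler_wpM2r Q0); lra.
have T1_0 : 0 <= T1 by lra.
split.
- split.
  + exact: weight_exp.
  + exact: (weak_solutionS PS v0_cont T1_bounds (strong_weak Hs)).
  + by move=> p /(stripS T1T); exact: vO.
  + move=> i j A mA; have [a [b [-> [Ha Hb] _ _ _]]] := HD i j.
    by rewrite /cadd/=; congr (_ + _)%E; [exact: Ha|exact: Hb].
  + exact: (reweighted_dt PS Hs T1_bounds Hw cw GM Gw Gw' HD).
  + exact: sLv1.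
  + exact: (reweighted_L PS Hs T1_bounds Hw cw GM Gw HL).
  (* Since h <= 1 for t >= 0, half of the shifted inequality yields the one-sided bound with
     constant 1/2. *)
  + exists 2^-1; first by rewrite invr_ge0.
    move=> A mA AT1; split.
      by rewrite linearD/= tr_scalar_mx massT.
    move=> u; rewrite mulmxDr mulmxDl [X in 0 <= X]mxE scalar_quad.
    have := shifted A u mA AT1; have Q0 := tr_outer_ge0 u.
    have AT := subset_trans AT1 C1T.
    have : \int[Leb]_(p in A) h1 p.1 <= fine (Leb A).
      rewrite -[leRHS]mul1r -Rintegral_cst//; apply: le_Rintegral => //.
      * by apply: (Leb_integrable mA AT); exact: bmeasW (mcyl T) AT (bh1 T).
      * by apply: (Leb_integrable mA AT); exact: bmeas_cst.
      * by move=> p /AT1/cylinder_strip/andP[/h1_le1].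
    by move=> /(ler_wpM2r Q0); lra.
  + by move=> t /andP[t0 tT1]; apply: (strong_energy Hs); rewrite t0 (le_trans tT1).
  + by case: HP.
  + by case: HA.
  + exact: (reweighted_Api PS Hs T1_bounds cw GM Gw HP HA).
  + by move=> l S mS ST1; exact (@reweighted_equation h1 w w' Dv1 Lv1 HApi1 ch1 Hw cw l S HD HL HA mS ST1).
- move=> k S mS ST1; have [_ H _] := HP; rewrite H//.
  by apply: eq_charge_int => p /ST1/cylinder_strip/Hw[].
- move=> A mA AT1; split.
    by rewrite /shifted_measure linearD/= linearZ/= tr_scalar_mx massT.
  move=> u; rewrite /shifted_measure mulmxDr mulmxDl [X in 0 <= X]mxE scalar_quad.
  rewrite -scalemxAr -scalemxAl [X in _ + X]mxE; exact: shifted.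
Qed.

End restricted_solution.

(** * Duality *)

Section lebesgue_transfer.
Context {R : realType}.

Let toR (x : measurableTypeR R) : R := x.

Let measurable_toR : measurable_fun setT toR.
Proof. by move=> _ Y mY; rewrite setTI. Qed.

(** The two measures agree as set functions but live on different measurable types over the reals;
    the identity map transports one integral to the other as a pushforward. *)
Lemma Rintegral_lebesgueR (D : set R) (f : R -> R) : measurable D -> measurable_fun D f ->
  (forall x, D x -> 0 <= f x) ->
  Rintegral lebesgueR D f = Rintegral (@lebesgue_measure R) D f.
Proof.
move=> mD mf f0; congr fine.
have := @ge0_integral_pushforward _ _ _ _ R toR measurable_toR lebesgue_measure D (EFin \o f) mD.
move=> <-.
- exact: eq_measure_integral.
- exact/measurable_EFinP.
- by move=> x; rewrite inE => /f0; rewrite lee_fin.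
Qed.

End lebesgue_transfer.

Section fubini.
Context {R : realType} {d : nat}.
Local Notation space := 'rV[R]_d.
Local Notation spacetime := (R * 'rV[R]_d)%type.
Local Notation mcyl := (@measurable_cylinder R d).

Lemma within_continuous_slice T (V : topologicalType) (f : spacetime -> V) t :
  {within strip T, continuous f} -> 0 <= t <= T -> continuous (fun x => f (t, x)).
Proof.
move=> /subspace_continuousP cf tT x U /(cf (t, x) tT) [[U1 U2] /= [n1 n2] sub].
apply: (@filterS _ (nbhs x) _ U2) n2 => y Uy.
by apply: sub => //; split => //=; exact: nbhs_singleton.
Qed.

(** Fubini for an integrand whose spatial integral is the same at all times: the time integral of
    the weight factors out. *)
Lemma Rintegral_cylinder_prod T (h : R -> R) (f : spacetime -> R) k :
  continuous h -> (forall t, 0 <= t <= T -> 0 <= h t) ->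
  {within strip T, continuous f} ->
  (forall t, 0 <= t <= T -> \int[torus_measure d]_(x in unit_cube) f (t, x) = k) ->
  \int[Leb]_(p in cylinder T) (h p.1 * f p) = tail T h 0 * k.
Proof.
move=> ch h0 cf fk.
have bf := continuous_bmeas cf.
have bhf : bmeas (cylinder T) (fun p => h p.1 * f p).
  by apply: bmeasM => //; apply: bmeas_time => t _; exact: ch.
pose g : spacetime -> \bar R := (EFin \o (fun p => h p.1 * f p)) \_ (cylinder T).
have ig : Leb.-integrable setT g.
  apply/(integrable_mkcond _ (mcyl T)).
  exact: (Leb_integrable (mcyl T) (@subset_refl _ _)).
have mI : measurable (`[0, T]%classic : set R) by [].
have mh : measurable_fun (`[0, T]%classic : set R) h.
  by apply: measurable_funTS; exact: continuous_measurable_fun.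
pose I : set R := `[0, T]%classic.
have IT : (lebesgueR I < +oo)%E.
  by rewrite [X in (X < _)%E]lebesgue_measure_itv/=; case: ifP => //; rewrite ltry.
have bh : bmeas (`[0, T]%classic : set R) h.
  split => //; have cw : {within `[0, T], continuous h} by exact: continuous_subspaceT.
  have /compact_bounded[M [_ HM]] := continuous_compact cw (@segment_compact R 0 T).
  by exists (M + 1) => t tT; apply: (HM (M + 1)); [rewrite ltrDl|exists t].
have -> : tail T h 0 * k = \int[lebesgueR]_(t in `[0, T]) (h t * k).
  rewrite RintegralZr//; last exact: bmeas_integrable.
  by congr (_ * _); rewrite Rintegral_lebesgueR// => t; rewrite /= in_itv/=; exact: h0.
rewrite /Rintegral [in LHS]integral_mkcond -/g.
have := integral12_prod_meas1 (m1 := lebesgueR) (m2 := torus_measure d) ig.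
rewrite -/Leb => <-.
congr fine; rewrite [RHS]integral_mkcond; apply: eq_integral => t _.
rewrite /fubini_F patchE; case: ifPn => [|nt].
  rewrite inE => tI; have tT : 0 <= t <= T by move: tI; rewrite /= in_itv.
  transitivity (\int[torus_measure d]_(x in unit_cube) (h t * f (t, x))%:E)%E.
    rewrite [RHS]integral_mkcond; apply: eq_integral => x _.
    rewrite /g !patchE; congr (if _ then _ else _).
    by apply/idP/idP; rewrite !inE; [case|split].
  have bs : bmeas unit_cube (fun x => f (t, x)).
    by apply: continuous_torus_bmeas; exact: within_continuous_slice cf tT.
  have ibs := bmeas_integrable measurable_unit_cube torus_cube_fin (bmeasZ (h t) bs).
  rewrite -[LHS]fineK; last first.
    exact: (integrable_fin_num measurable_unit_cube ibs).
  rewrite /= -(fk t tT) -RintegralZl//; first exact: measurable_unit_cube.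
  exact: (bmeas_integrable measurable_unit_cube torus_cube_fin bs).
rewrite integral0_eq// => x _; rewrite /g patchE ifN//.
by apply: contra nt; rewrite !inE => -[].
Qed.

End fubini.

(** * Saddle point, values of the four problems, and the maximizer *)

Section duality.
Context {R : realType} {d n N Z : nat} (P : problem R d n N Z) (PS : setting P).
Local Notation space := 'rV[R]_d.
Local Notation spacetime := (R * 'rV[R]_d)%type.
Local Notation mcyl := (@measurable_cylinder R d).
Local Notation F := (F_map P).
Variables (v0 : space -> 'rV[R]_n) (v0_cont : CX 1 n v0) (T : R) (T_gt0 : 0 < T) (h : R -> R)
  (v : spacetime -> 'rV[R]_n)
  (Dv : mx_charge (R := R) spacetime 1 n) (Lv : mx_charge (R := R) spacetime N N)
  (Hpi : mx_charge (R := R) spacetime 1 Z) (HApi : mx_charge (R := R) spacetime 1 n)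
  (Hs : strong_solution P T h v0 v Dv Lv Hpi HApi)
  (shifted_ge0 : measure_ge0_on (cylinder T) (shifted_measure h Lv)).

Let E := mx_charge_sub Dv HApi.
Let vO p : strip T p -> (F_dom P)^° (v p). Proof. exact: (strong_interior Hs). Qed.
Let adm : admissible P T v. Proof. by case: (strong_weak Hs). Qed.
Let cv : CTX T 1 n v. Proof. by case: adm. Qed.
Let cF : CTX T N N (F \o v). Proof. by case: adm. Qed.
Let vF p : strip T p -> F_dom P (v p). Proof. by case: adm => _ + _; apply. Qed.

Let ch : continuous h.
Proof. by case: (strong_weight Hs) => /smooth_continuous. Qed.

Let bh : bmeas (cylinder T : set spacetime) (fun p => h p.1).
Proof. by apply: bmeas_time => t _; exact: ch. Qed.

(** After [L] and d/dt are exchanged, the contributions of [Lv] and [Dv] cancel, and the multiplier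
    term vanishes because A L Psi = 0 on [0, T]. *)
Lemma optimal_LC : LC P T E Lv.
Proof.
split.
- exact: measures_on_sub (strong_dt_measure Hs) (strong_Api_measure Hs).
- exact: (strong_L_measure Hs).
- move=> Psi SPsi kPsi Psi0.
  have [Ldom SL] := (proj1 (L_spatial PS)) _ SPsi; have [sL _] := SL.
  rewrite (strong_L Hs); last exact: smooth_in_sym_dt.
  rewrite pairing_mx_charge_sub//; [|exact: mcyl|by move=> i j; exact: smooth_bmeas].
  rewrite (strong_dt Hs SL); last first.
    move=> x; rewrite /slicewise/=.
    (* Obtains L 0 = 0, so that L Psi vanishes at t = 0 and is a legitimate test function for
       [strong_dt]. *)
    have [_] := linear_operator_comb 0 0 (L_linear PS) (Ldom 0) (Ldom 0).
    have -> : (fun x => 0 *: slice Psi 0 x + 0 *: slice Psi 0 x) = slice Psi 0.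
      by apply/funext => y; rewrite /slice Psi0 scaler0 addr0.
    by move=> ->; rewrite !scale0r addr0.
  rewrite (strong_Api Hs SL).
  have -> : pairing (cylinder T) (slicewise (A_op P) (slicewise (L_op P) Psi)) Hpi = 0.
    rewrite (eq_pairing (g := fun=> 0)); last first.
      move=> p /cylinder_strip tp; rewrite /slicewise -/(slicewise (L_op P) Psi).
      by have [_ ->] := kPsi p.1 tp.
    rewrite /pairing big1// => i _; rewrite big1// => j _.
    by rewrite -[RHS](charge_int0 (Hpi i j) (cylinder T)); apply: eq_charge_int => p _; rewrite mxE.
  rewrite subr0; apply/eqP; rewrite subr_eq0; apply/eqP.
  apply: eq_Rintegral => -[t x]; rewrite inE => /cylinder_strip/andP[t0 _].
  by rewrite slicewise_L_dt.
Qed.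

(** The entropy of a solution is bounded on each slice, so K0 is a finite number and extended-real
    arithmetic can be left behind. *)
Lemma energy_value : K0 P v0 = (fine (K0 P v0))%:E /\
  forall t, 0 <= t <= T ->
    \int[torus_measure d]_(x in unit_cube) (\tr (F (v (t, x)))) = 2 * fine (K0 P v0).
Proof.
have H t : 0 <= t <= T ->
    K0 P v0 = (\int[torus_measure d]_(x in unit_cube) (2^-1 * \tr (F (v (t, x)))))%:E /\
    \int[torus_measure d]_(x in unit_cube) (\tr (F (v (t, x)))) =
    2 * \int[torus_measure d]_(x in unit_cube) (2^-1 * \tr (F (v (t, x)))).
  move=> tT; have btr : bmeas unit_cube (fun x => \tr (F (v (t, x)))).
    apply: bmeas_sum => i; apply: continuous_torus_bmeas.
    apply: continuous_entry; case: cF => c _.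
    exact: (within_continuous_slice c tT).
  have ib := bmeas_integrable measurable_unit_cube torus_cube_fin btr.
  have ib2 := bmeas_integrable measurable_unit_cube torus_cube_fin (bmeasZ 2^-1 btr).
  split.
    rewrite -(strong_energy Hs tT).
    have -> : (\int[torus_measure d]_(x in unit_cube) entropy P (v (t, x)) =
        \int[torus_measure d]_(x in unit_cube) (2^-1 * \tr (F (v (t, x))))%:E)%E.
      apply: eq_integral => x _; rewrite /entropy ifT//.
      by rewrite inE; exact: vF.
    by rewrite fineK//; exact: (integrable_fin_num measurable_unit_cube ib2).
  by rewrite RintegralZl//; [field|exact: measurable_unit_cube].
have t00 : 0 <= (0 : R) <= T by rewrite lexx ltW.
have [K00 _] := H 0 t00; split; first by rewrite K00.
by move=> t tT; have [-> ->] := H t tT.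
Qed.

Let V := tail T h 0 * fine (K0 P v0).

Lemma entropy_integral :
  \int[Leb]_(p in cylinder T) (h p.1 * \tr (F (v p))) = 2 * V.
Proof.
have [_ H] := energy_value.
rewrite (@Rintegral_cylinder_prod _ _ T h (fun p => \tr (F (v p))) (2 * fine (K0 P v0)))//.
- by rewrite /V; ring.
- have [_ [c [C [c0 hc]]]] := strong_weight Hs.
  by move=> t /hc/andP[]; lra.
- case: cF => c _; apply/subspace_continuousP => p Sp.
  have /subspace_continuousP/(_ p Sp) := c => cp.
  have ctr : continuous (fun A : 'M[R]_N => \tr A).
    move=> A; apply: (@cvg_sum_seq R _ (nbhs A) _ _ _ (fun i (B : 'M[R]_N) => B i i)).
    by move=> i; exact: coord_continuous.
  exact: (cvg_comp _ _ cp (ctr _)).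
Qed.

Lemma solution_value (E' : mx_charge (R := R) spacetime 1 n) (B' : mx_charge (R := R) spacetime N N) :
  LC P T E' B' -> saddle T h (fun p => v p - v0 p.2) (F \o v) E' B' = V.
Proof.
move=> /(proj2 (strong_weak Hs)) H; rewrite /saddle.
have -> : \int[Leb]_(p in cylinder T) (h p.1 * \tr ((F \o v) p)) = 2 * V by exact: entropy_integral.
lra.
Qed.

Let bv0 i j : bmeas (cylinder T : set spacetime) (fun p => v0 p.2 i j).
Proof. exact: v0_bmeas. Qed.

Let bE m k (f g : spacetime -> 'M[R]_(m, k)) :
  (forall i j, bmeas (cylinder T) (fun p => f p i j)) ->
  (forall i j, bmeas (cylinder T) (fun p => g p i j)) ->
  forall i j, bmeas (cylinder T) (fun p => (f p - g p) i j).
Proof.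
by move=> bf bg i j; apply: bmeas_ext (bmeasB (bf i j) (bg i j)) => p _; rewrite !mxE.
Qed.

Lemma pairing_sum_fun m k (I : Type) (r : seq I) (f : I -> spacetime -> 'M[R]_(m, k)) mu :
  (forall l i j, bmeas (cylinder T) (fun p => f l p i j)) ->
  pairing (cylinder T) (fun p => \sum_(l <- r) f l p) mu =
  \sum_(l <- r) pairing (cylinder T) (f l) mu.
Proof.
move=> bf; elim: r => [|l r IH].
  rewrite big_nil /pairing big1// => i _; rewrite big1// => j _.
  by rewrite -[RHS](charge_int0 (mu i j) (cylinder T)); apply: eq_charge_int => p _; rewrite big_nil mxE.
rewrite big_cons -IH -pairingD//; [|exact: mcyl|].
  by apply: eq_pairing => p _; rewrite big_cons.
move=> i j; apply: (bmeas_ext (f := fun p => \sum_(l <- r) f l p i j)).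
  by move=> p _; rewrite summxE.
by apply: bmeas_sum => l'; exact: bf.
Qed.

(* Weak duality against the optimal pair: by Loewner convexity
   M - F(v) - sum_l (z - v)_l d_l F(v) >= 0, and pairing this with
   h I + 2 B >= 0 produces the strong equation tested with z - v. *)
Lemma optimal_lower_bound (z : spacetime -> 'rV[R]_n) (M : spacetime -> 'M[R]_N) :
  relaxed_pairs P T (z, M) -> V <= saddle T h (fun p => z p - v0 p.2) M E Lv.
Proof.
move=> [/= cz cM zM].
have bz i j : bmeas (cylinder T) (fun p => z p i j) by exact: CTX_bmeas cz.
have bv i j : bmeas (cylinder T) (fun p => v p i j) by exact: CTX_bmeas cv.
have bM i j : bmeas (cylinder T) (fun p => M p i j) by exact: CTX_bmeas cM.
have bFv i j : bmeas (cylinder T) (fun p => (F \o v) p i j) by exact: CTX_bmeas cF.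
have bdF l i j : bmeas (cylinder T) (fun p => dF P l (v p) i j) by exact: (bmeas_dF PS cv vO).
have [nu [nu1 nu2]] := shifted_charge 1 2 Lv (mcyl T) (@subset_refl _ _) bh.
pose g l p := (z p - v p) ord0 l.
have bg l : bmeas (cylinder T) (g l) by exact: bE.
pose X p := \sum_l g l p *: dF P l (v p).
have bgd l i j : bmeas (cylinder T) (fun p => (g l p *: dF P l (v p)) i j).
  by apply: bmeas_ext (bmeasM (bg l) (bdF l i j)) => p _; rewrite [RHS]mxE.
have bX i j : bmeas (cylinder T) (fun p => X p i j).
  apply: (bmeas_ext (f := fun p => \sum_l (g l p *: dF P l (v p)) i j)).
    by move=> p _; rewrite [RHS]summxE.
  by apply: bmeas_sum => l; exact: bgd.
have psdG p : cylinder T p -> psd (M p - (F \o v) p - X p).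
  move=> /cylinder_strip Sp; have [Dz _ pM] := zM p Sp.
  have pL := loewner_gradient PS (vO Sp) Dz.
  (* The slack of M over F(z) plus the Loewner remainder of [F] at v. *)
  have -> : M p - (F \o v) p - X p = (M p - F (z p)) + (F (z p) - F (v p) - X p).
    by rewrite /= -!addrA; congr (_ + _); rewrite addKr.
  have [s1 q1] := pM; have [s2 q2] := pL.
  split; first by rewrite [LHS]linearD/= s1 s2.
  by move=> u; rewrite mulmxDr mulmxDl [X in 0 <= X]mxE addr_ge0.
have := @pairing_psd_ge0 _ _ _ _ (mcyl T) N (fun p => M p - (F \o v) p - X p) nu
  (bE (bE bM bFv) bX) psdG.
have nu0 : measure_ge0_on (cylinder T) (mass nu).
  by move=> A mA AT; rewrite nu1// mul1r; exact: shifted_ge0.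
move=> /(_ nu0).
rewrite (pairingB (mcyl T) _ (bE bM bFv) bX) (pairingB (mcyl T) _ bM bFv).
rewrite (nu2 M bM) (nu2 _ bFv) !mul1r.
(* Since the trace of d_l F(v) is 2 v^#_l, pairing with h I dx dt + 2 Lv gives twice the first and
   third terms of the strong equation tested with [g l]; what remains is the multiplier term minus
   the time derivative. *)
have -> : pairing (cylinder T) X nu =
    \sum_l (2 * (charge_int (HApi ord0 l) (cylinder T) (g l) - charge_int (Dv ord0 l) (cylinder T) (g l))).
  rewrite /X (pairing_sum_fun _ nu bgd); apply: eq_bigr => l _.
  rewrite (nu2 _ (bgd l)) mul1r.
  rewrite -(strong_equation_density PS Hs l (mcyl T) (@subset_refl _ _) (bg l)).
  rewrite addrAC addrK mulrDr; congr (_ + 2 * _).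
    rewrite -RintegralZl//; last 2 first.
    - exact: mcyl.
    - apply: (Leb_integrable (mcyl T) (@subset_refl _ _)); apply: bmeasM => //.
      by apply: bmeasM => //; exact: (bmeas_sharp PS cv vO).
    apply: eq_Rintegral => p; rewrite inE => /cylinder_strip/vO Op.
    by rewrite (sharpE PS)// [X in _ * X]linearZ/=; field.
  by apply: eq_bigr => i _; apply: eq_bigr => j _; apply: eq_charge_int => p _; rewrite [LHS]mxE.
rewrite -mulr_sumr.
have -> : \sum_l (charge_int (HApi ord0 l) (cylinder T) (g l) - charge_int (Dv ord0 l) (cylinder T) (g l)) =
    - pairing (cylinder T) (fun p => z p - v p) E.
  rewrite (pairing_mx_charge_sub _ _ (mcyl T) (bE bz bv)) opprB /pairing !big_ord1.
  by rewrite sumrB.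
have EV := solution_value optimal_LC; rewrite /saddle in EV *.
have -> : pairing (cylinder T) (fun p => z p - v0 p.2) E =
    pairing (cylinder T) (fun p => z p - v p) E + pairing (cylinder T) (fun p => v p - v0 p.2) E.
  rewrite -(pairingD (mcyl T) _ (bE bz bv) (bE bv bv0)).
  by apply: eq_pairing => p _; rewrite addrA subrK.
lra.
Qed.

Lemma admissible_relaxed z : admissible P T z -> relaxed_pairs P T (z, F \o z).
Proof.
move=> [cz zF cFz]; split => //= p Sp; have Dp := zF p Sp.
split => //; first by case: (F_psd PS Dp).
by rewrite subrr; split; [rewrite trmx0|move=> u; rewrite mulmx0 mul0mx mxE].
Qed.

Let Ve := (V%:E : \bar R).
Let EB : mx_charge (R := R) spacetime 1 n * mx_charge (R := R) spacetime N N := (E, Lv).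

Let lower z M : relaxed_pairs P T (z, M) -> (Ve <= Lagrangian T h v0 z M EB)%E.
Proof. by move=> H; rewrite lee_fin; exact: optimal_lower_bound. Qed.

Let upper EB' : LC_pairs P T EB' -> Lagrangian T h v0 v (F \o v) EB' = Ve.
Proof. by move=> H; congr EFin; exact: solution_value. Qed.

(** All four values rest on the saddle point: (v, F(v)) makes the Lagrangian equal to [Ve] for every
    constrained pair, and [EB] keeps it at least [Ve] for every competitor. *)
Lemma primal_value : primal P T h v0 = Ve.
Proof.
apply/eqP; rewrite eq_le; apply/andP; split.
  apply: (@le_trans _ _ (ereal_sup [set Lagrangian T h v0 v (F \o v) EB' | EB' in LC_pairs P T])).
    by apply: ereal_inf_lbound; exists v.
  by apply: ge_ereal_sup => _ [EB' H <-]; rewrite upper.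
apply: le_ereal_inf_tmp => _ [z Hz <-]; apply: (le_trans (lower (admissible_relaxed Hz))).
by apply: ereal_sup_ubound; exists EB => //; exact: optimal_LC.
Qed.

Lemma relaxed_primal_value : relaxed_primal P T h v0 = Ve.
Proof.
apply/eqP; rewrite eq_le; apply/andP; split.
  apply: (@le_trans _ _ (ereal_sup [set Lagrangian T h v0 v (F \o v) EB' | EB' in LC_pairs P T])).
    by apply: ereal_inf_lbound; exists (v, F \o v) => //; exact: admissible_relaxed.
  by apply: ge_ereal_sup => _ [EB' H <-]; rewrite upper.
apply: le_ereal_inf_tmp => _ [[z M] Hz <-]; apply: (le_trans (lower Hz)).
by apply: ereal_sup_ubound; exists EB => //; exact: optimal_LC.
Qed.

Lemma dual_value : dual P T h v0 = Ve.
Proof.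
apply/eqP; rewrite eq_le; apply/andP; split.
  apply: ge_ereal_sup => _ [EB' H <-]; rewrite -(upper H).
  by apply: ereal_inf_lbound; exists v.
apply: (@le_trans _ _ (ereal_inf [set Lagrangian T h v0 z (F \o z) EB | z in admissible P T])).
  by apply: le_ereal_inf_tmp => _ [z Hz <-]; exact: lower (admissible_relaxed Hz).
by apply: ereal_sup_ubound; exists EB => //; exact: optimal_LC.
Qed.

Lemma relaxed_dual_value : relaxed_dual P T h v0 = Ve.
Proof.
apply/eqP; rewrite eq_le; apply/andP; split.
  apply: ge_ereal_sup => _ [EB' H <-]; rewrite -(upper H).
  by apply: ereal_inf_lbound; exists (v, F \o v) => //; exact: admissible_relaxed.
apply: (@le_trans _ _ (ereal_inf [set Lagrangian T h v0 zM.1 zM.2 EB | zM in relaxed_pairs P T])).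
  by apply: le_ereal_inf_tmp => _ [[z M] Hz <-]; exact: lower Hz.
by apply: ereal_sup_ubound; exists EB => //; exact: optimal_LC.
Qed.

Let saddle_shift z M (E' : mx_charge (R := R) spacetime 1 n) B' : relaxed_pairs P T (z, M) ->
  saddle T h (fun p => z p - v0 p.2) M E' B' =
  - pairing (cylinder T) (fun p => v0 p.2) E' + saddle T h z M E' B'.
Proof.
move=> [/= cz _ _]; rewrite /saddle (pairingB (mcyl T)); [ring| |exact: bv0].
by move=> i j; exact: CTX_bmeas cz.
Qed.

(** For an arbitrary feasible pair the dual functional is bounded by its value at (v, F(v)), so the
    objective is at most [Ve]; [optimal_lower_bound] shows that (E, Lv) attains at least [Ve]. *)
Lemma optimal_pair : dual_maximizer P T h v0 E Lv.
Proof.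
split; first by split; [exact: optimal_LC|].
move=> E' B' [LCE' _]; apply: (@le_trans _ _ Ve).
  have Rv := admissible_relaxed adm.
  rewrite /Ve -(solution_value LCE') (saddle_shift _ _ Rv) EFinD.
  by apply: leeD => //; apply: ereal_inf_lbound; exists (v, F \o v).
rewrite /dual_objective -leeBlDl//.
apply: le_ereal_inf_tmp => _ [[z M] Hz <-].
rewrite leeBlDl// -EFinD lee_fin -saddle_shift//.
exact: optimal_lower_bound.
Qed.

End duality.

Theorem mainTheorem2 (R : realType) (d n N Z : nat)
  (d_gt0 : (0 < d)%N) (n_gt0 : (0 < n)%N) (N_gt0 : (0 < N)%N)
  (P : problem R d n N Z) (P_setting : setting P) (P_cons : conservative P)
  (v0 : 'rV[R]_d -> 'rV[R]_n)
  (v0_cont : CX 1 n v0)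
  (v0_interior : forall x, interior (F_dom P) (v0 x))
  (v0_ker : ker (A_op P) v0)
  (T : R) (T_gt0 : 0 < T) (h0 : R -> R)
  (v : R * 'rV[R]_d -> 'rV[R]_n)
  (Dv : mx_charge (R * 'rV[R]_d)%type 1 n)
  (Lv : mx_charge (R * 'rV[R]_d)%type N N)
  (Hpi : mx_charge (R * 'rV[R]_d)%type 1 Z)
  (HApi : mx_charge (R * 'rV[R]_d)%type 1 n)
  (v_strong : strong_solution P T h0 v0 v Dv Lv Hpi HApi)
  (T1 : R) (T1_bounds : 0 < T1 < T) :
  exists2 gamma : R, 0 < gamma &
    let h := exp_weight gamma in
    exists (Dv1 : mx_charge (R * 'rV[R]_d)%type 1 n)
      (Lv1 : mx_charge (R * 'rV[R]_d)%type N N)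
      (Hpi1 : mx_charge (R * 'rV[R]_d)%type 1 Z)
      (HApi1 : mx_charge (R * 'rV[R]_d)%type 1 n),
    [/\ strong_solution P T1 h v0 v Dv1 Lv1 Hpi1 HApi1 /\
          same_multiplier T h0 Hpi T1 h Hpi1,
        measure_ge0_on (cylinder T1) (shifted_measure h Lv1),
        [/\ primal P T1 h v0 = relaxed_dual P T1 h v0,
            relaxed_dual P T1 h v0 = relaxed_primal P T1 h v0,
            relaxed_primal P T1 h v0 = dual P T1 h v0 &
            dual P T1 h v0 = ((tail T1 h 0)%:E * K0 P v0)%E] &
        dual_maximizer P T1 h v0 (mx_charge_sub Dv1 HApi1) Lv1].

Proof.
have /andP[T1_gt0 _] := T1_bounds.
have [gamma gamma0 [Dv1 [Lv1 [Hpi1 [HApi1 [Hs Hpi1E shifted_ge0]]]]]] :=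
  strong_solution_reweight P_setting v0_cont v_strong T1_bounds.
exists gamma => // h; exists Dv1, Lv1, Hpi1, HApi1; split=> //.
- have [K0E _] := energy_value T1_gt0 Hs.
  rewrite (primal_value P_setting v0_cont T1_gt0 Hs shifted_ge0).
  rewrite (relaxed_primal_value P_setting v0_cont T1_gt0 Hs shifted_ge0).
  rewrite (dual_value P_setting v0_cont T1_gt0 Hs shifted_ge0).
  rewrite (relaxed_dual_value P_setting v0_cont T1_gt0 Hs shifted_ge0).
  (* Finiteness of K0 turns the extended product into the real number shared by all four values. *)
  by split => //; rewrite K0E.
- exact: (optimal_pair P_setting v0_cont T1_gt0 Hs shifted_ge0).
Qed.
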